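(* Let $m,n,k,l$ be positive integers with $1\le k\le \lfloor n/2\rfloor$, $1\le l\le \lfloor m/2\rfloor$, $k<l$ and $m-l>n-k$, and suppose that $m-l\ge 2k^2-k-1$ or $1\le k\le 3$. Let $f:G_{m,l}\to G_{n,k}$ be any continuous map. Then there exists $x\in G_{m,l}$ such that $f(x)\subset x$.
   Context: $G_{n,k}$ denotes the complex Grassmann manifold of $k$-dimensional complex vector subspaces of $\mathbb{C}^n$. Here $\mathbb{C}^n$ is regarded as the subspace $\mathbb{C}^n\oplus 0\subset \mathbb{C}^n\oplus\mathbb{C}^{m-n}=\mathbb{C}^m$ (vectors whose last $m-n$ coordinates vanish), so that for $y\in G_{n,k}$ and $x\in G_{m,l}$ the inclusion $y\subset x$ of subspaces of $\mathbb{C}^m$ is meaningful. *)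

(* Defs.v *)
From Stdlib Require Import Reals.
Open Scope R_scope.

Definition Cx := (R * R)%type.
Definition C0 : Cx := (0, 0).
Definition Cadd (a b : Cx) : Cx := (fst a + fst b, snd a + snd b).
Definition Cmul (a b : Cx) : Cx :=
  (fst a * fst b - snd a * snd b, fst a * snd b + snd a * fst b).
Definition Cnorm2 (a : Cx) : R := fst a * fst a + snd a * snd a.

(* Vectors of C^N for all N at once: finitely supported sequences.
   C^n is the set of vectors vanishing at indices >= n, so C^n ⊂ C^m
   as the vectors whose last m-n coordinates vanish. *)
Definition cvec := nat -> Cx.
Definition vzero : cvec := fun _ => C0.
Definition vadd (u v : cvec) : cvec := fun i => Cadd (u i) (v i).
Definition vscale (c : Cx) (v : cvec) : cvec := fun i => Cmul c (v i).
Definition vsub (u v : cvec) : cvec := vadd u (vscale (-1, 0) v).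

Definition supported (n : nat) (v : cvec) : Prop :=
  forall i, (n <= i)%nat -> v i = C0.

Fixpoint norm2 (n : nat) (v : cvec) : R :=
  match n with
  | O => 0
  | S p => norm2 p v + Cnorm2 (v p)
  end.
Definition vnorm (n : nat) (v : cvec) : R := sqrt (norm2 n v).

Fixpoint lincomb (k : nat) (c : nat -> Cx) (b : nat -> cvec) : cvec :=
  match k with
  | O => vzero
  | S p => vadd (lincomb p c b) (vscale (c p) (b p))
  end.

Definition is_subspace (n : nat) (V : cvec -> Prop) : Prop :=
  (forall v, V v -> supported n v) /\
  V vzero /\
  (forall u v, V u -> V v -> V (vadd u v)) /\
  (forall c v, V v -> V (vscale c v)).

Definition has_dim (k : nat) (V : cvec -> Prop) : Prop :=
  exists b : nat -> cvec,
    (forall i, (i < k)%nat -> V (b i)) /\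
    (forall c : nat -> Cx, lincomb k c b = vzero ->
        forall i, (i < k)%nat -> c i = C0) /\
    (forall v, V v -> exists c : nat -> Cx, v = lincomb k c b).

Definition Grass (n k : nat) : Type :=
  { V : cvec -> Prop | is_subspace n V /\ has_dim k V }.

Definition gsub {n k : nat} (x : Grass n k) : cvec -> Prop := proj1_sig x.

(* Standard (gap-metric) topology on G_{n,k}:  gap_lt n d V W  says that
   every unit vector of V is within distance d of W and vice versa, i.e.
   the gap  ||P_V - P_W||  (= Hausdorff distance data of the unit spheres)
   is (essentially) less than d.  These sets form a neighbourhood base of
   the usual manifold topology of the Grassmannian. *)
Definition gap_lt (n : nat) (d : R) (V W : cvec -> Prop) : Prop :=
  (forall v, V v -> vnorm n v = 1 ->
     exists w, W w /\ vnorm n (vsub v w) < d) /\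
  (forall w, W w -> vnorm n w = 1 ->
     exists v, V v /\ vnorm n (vsub w v) < d).

Definition grass_continuous {m l n k : nat} (f : Grass m l -> Grass n k) : Prop :=
  forall (x : Grass m l) (eps : R), 0 < eps ->
    exists delta : R, 0 < delta /\
      forall y : Grass m l, gap_lt m delta (gsub x) (gsub y) ->
        gap_lt n eps (gsub (f x)) (gsub (f y)).

(* Main.v *)
(** Complex lines carry a mod 2 Chern class, realised by an explicit Alexander-Spanier cocycle, so
    a tower of projective bundles has cohomology described by polynomials in the Chern classes of
    its lines.  Choosing a hyperplane C^M of C^m (or C^m itself) with M odd, replace x by a complete
    flag (L_0, ..., L_(M-1)) of C^M, x being the orthogonal complement of L_0, ..., L_(m-l-1), and
    f(x) by a flag of lines l_0, ..., l_(k-1); let t_j and s_a be the Chern classes.  A line s of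
    f(x) in C^n satisfies s^n = 0 and a monic equation of degree k over the flag manifold.  Because
    n < M, evaluating the t_j at the M-th roots of unity (distinct, as M is odd) shows that this
    equation is s^k = 0, hence the polynomial with roots s_a is X^k.  If f(x) were never contained
    in x, some L_j (j < m - l) would meet some l_a non-orthogonally at every point, so by the
    Lusternik-Schnirelmann argument the product of all t_j - s_a, that is, of all t_j^k (j < m - l),
    would vanish; but k < l makes it a nonzero element of the monomial basis of the flag manifold. *)
From Stdlib Require Import Reals Lra ZArith Classical ClassicalEpsilon FunctionalExtensionality PropExtensionality List.
From Coquelicot Require Import Complex.
(* Stdlib's tactics on [R] and [C]; MathComp's [ring] shadows the names. *)
Ltac sring := ring.
Ltac sfield := field.
From mathcomp Require Import all_boot all_algebra separable galois finfield cyclotomic.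
From mathcomp Require Import zify ring.
Require Import Defs.
Set Implicit Arguments.
Unset Strict Implicit.
Unset Printing Implicit Defensive.
Import GRing.Theory.
Delimit Scope R_scope with Re.
Delimit Scope Z_scope with ZZ.
Local Close Scope R_scope.
Local Open Scope ring_scope.

(** * Compact pseudometric spaces and cochains *)

(** Characteristic 2 serves twice: coboundaries need no signs and phases need only be rounded to
    whole turns modulo 2; and X^M - 1 is separable for odd M, so an extension of the prime field
    contains M roots. This is why the flags live in C^M rather than in C^m. Continuity of [f] enters
    only through the closedness of the set of pairs formed by a flag and a line of the image.
    Alexander-Spanier cochains live on any closed subset of a compact pseudometric space, so no cell
    structure has to be built; a pseudometric also avoids quotients, since a line is any of its unit
    vectors. The global computations rest on one comparison principle: two theories with
    Mayer-Vietoris that agree over points agree everywhere. The coefficients of the equation of s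
    are polynomials in the t_j, known only modulo the relations of the flag manifold. In Artin
    normal form they are determined by their values at tuples of distinct roots of unity w_j.
    Putting t_j = w_j tau and s = x tau turns every relation into a multiple of tau^M, so the
    coefficient of tau^n in s^n = 0 is unaffected and the specialised monic equation divides x^n. *)

Record cpm := Cpm {
  cpt :> Type;
  dist : cpt -> cpt -> R;
  dist_refl : forall x, dist x x = 0%Re;
  dist_sym : forall x y, dist x y = dist y x;
  dist_tri : forall x y z, (dist x z <= dist x y + dist y z)%Re;
  cpm_compact : forall r : cpt -> R, (forall x, (0 < r x)%Re) ->
    exists s : list cpt, forall y, exists x, List.In x s /\ (dist x y < r x)%Re }.

Section Pseudometric.
Variable T : cpm.

Lemma dist_ge0 (x y : T) : (0 <= dist x y)%Re.
Proof.
have := dist_tri x y x; rewrite dist_refl (dist_sym y x); lra.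
Qed.

Definition closed (A : T -> Prop) :=
  forall x, ~ A x -> exists e, (0 < e)%Re /\ forall y, (dist x y < e)%Re -> ~ A y.

Lemma closedU (A B : T -> Prop) : closed A -> closed B -> closed (fun x => A x \/ B x).
Proof.
move=> cA cB x nx; have [e [e0 he]] := cA x (fun h => nx (or_introl h)).
have [e' [e0' he']] := cB x (fun h => nx (or_intror h)).
exists (Rmin e e'); split; first exact: Rmin_glb_lt.
by move=> y hy [/he|/he'] h; apply: h; apply: Rlt_le_trans hy _; [exact: Rmin_l|exact: Rmin_r].
Qed.

Lemma closedI (A B : T -> Prop) : closed A -> closed B -> closed (fun x => A x /\ B x).
Proof.
move=> cA cB x nx; case: (classic (A x)) => [ax|/cA [e [e0 he]]].
  have /cB [e [e0 he]] : ~ B x by move=> bx; apply: nx.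
  by exists e; split=> // y /he h [].
by exists e; split=> // y /he h [].
Qed.

Lemma closed_ext (A B : T -> Prop) : (forall x, A x <-> B x) -> closed A -> closed B.
Proof.
move=> AB cA x nx; have [|e [e0 he]] := cA x; first by move/AB.
by exists e; split=> // y /he h /AB.
Qed.

(** Points at distance 0 cannot be separated, so this class replaces the singleton of b; it is the
    smallest closed set containing b. *)
Definition ptset (b : T) : T -> Prop := fun y => dist b y = 0%Re.

Lemma closed_pt b : closed (ptset b).
Proof.
move=> x nx; exists (dist b x); split; first by have := dist_ge0 b x; rewrite /ptset in nx; lra.
by move=> y hy; rewrite /ptset => h; have := dist_tri b y x; rewrite h (dist_sym y x); lra.
Qed.

Definition cball (b : T) (e : R) : T -> Prop := fun y => (dist b y <= e)%Re.

Lemma closed_ball b e : closed (cball b e).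
Proof.
move=> x nx; exists (dist b x - e)%Re; rewrite /cball in nx *; split; first lra.
by move=> y hy h; have := dist_tri b y x; rewrite (dist_sym y x); lra.
Qed.

Lemma min_pos (r : T -> R) (s : list T) : (forall x, (0 < r x)%Re) ->
  exists d, (0 < d)%Re /\ forall x, List.In x s -> (d <= r x)%Re.
Proof.
move=> r0; elim: s => [|x s [d [d0 hd]]]; first by exists 1%Re; split; [lra|].
exists (Rmin (r x) d); split; first exact: Rmin_glb_lt.
move=> y /= [<-|/hd h]; first exact: Rmin_l.
exact: Rle_trans (Rmin_r _ _) h.
Qed.

Lemma compact_choice (P : T -> R -> Prop) :
  (forall x, exists e, (0 < e)%Re /\ P x e) ->
  exists (s : list T) (r : T -> R), (forall x, (0 < r x)%Re /\ P x (r x)) /\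
    forall y, exists x, List.In x s /\ (dist x y < r x)%Re.
Proof.
move=> h; pose r x := proj1_sig (constructive_indefinite_description _ (h x)).
have hr x : (0 < r x)%Re /\ P x (r x) by rewrite /r; case: constructive_indefinite_description.
have [|s hs] := @cpm_compact T r; first by move=> x; case: (hr x).
by exists s, r.
Qed.

(** The form in which compactness enters the Mayer-Vietoris arguments: finitely many balls on which
    [Q] holds cover [A], points off [A] receiving balls that miss [A], and the union step adds one
    ball at a time. *)
Lemma compact_ind (A : T -> Prop) (Q : (T -> Prop) -> Prop) : closed A ->
  (forall B B', (forall x, B' x -> B x) -> Q B -> Q B') ->
  Q (fun _ => False) ->
  (forall B B', closed B -> closed B' -> (forall x, B x -> A x) -> (forall x, B' x -> A x) ->
     Q B -> Q B' -> Q (fun x => B x \/ B' x)) ->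
  (forall b, A b -> exists e, (0 < e)%Re /\ Q (fun y => A y /\ cball b e y)) ->
  Q A.
Proof.
move=> cA Qm Q0 QU Ql.
have [|s [r [hr hs]]] := @compact_choice (fun b e => Q (fun y => A y /\ cball b e y)).
  move=> x; case: (classic (A x)) => [|/cA [e [e0 he]]]; first exact: Ql.
  (* Half the radius, so that the closed ball stays inside the open ball missing [A]. *)
  exists (e / 2)%Re; split; first lra.
  apply: Qm Q0 => y [ay hy]; apply: (he y) => //; rewrite /cball in hy; lra.
pose U (s' : list T) := fun y => A y /\ exists x, List.In x s' /\ cball x (r x) y.
suff HU s' : closed (U s') /\ Q (U s').
  apply: Qm (proj2 (HU s)) => y ay; split=> //; have [x [hx hy]] := hs y.
  by exists x; split=> //; rewrite /cball; lra.
elim: s' => [|x s' [cU qU]].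
  split; first by move=> x _; exists 1%Re; split; [lra|move=> y _ [_ [? []]]].
  by apply: Qm Q0 => y [_ [? []]].
have E y : (A y /\ cball x (r x) y \/ U s' y) <-> U (x :: s') y.
  split; first by case=> [[ay hy]|[ay [z [hz hy]]]]; split=> //; [exists x|exists z]; split=> //; [left|right].
  by case=> ay [z [[<-|hz] hy]]; [left|right; split=> //; exists z].
have cx : closed (fun y => A y /\ cball x (r x) y) by apply: closedI => //; exact: closed_ball.
split; first by apply: closed_ext E _; exact: closedU.
apply: Qm (QU _ _ cx cU _ _ (proj2 (hr x)) qU); [by move=> y /E|by move=> y []|by move=> y []].
Qed.

(** The vertices are close to one point of [A] but need not lie in [A]: cochains are defined on the
    whole space, and their germs along [A] are read on such simplices. *)
Definition small (A : T -> Prop) (e : R) (s : seq T) :=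
  exists a, A a /\ forall z, List.In z s -> (dist a z < e)%Re.

Lemma small_le A e e' s : (e <= e')%Re -> small A e s -> small A e' s.
Proof. by move=> h [a [aA ha]]; exists a; split=> // z /ha; lra. Qed.

Lemma small_sub A (B : T -> Prop) e s : (forall x, A x -> B x) -> small A e s -> small B e s.
Proof. by move=> AB [a [aA ha]]; exists a; split=> //; apply: AB. Qed.

Lemma small_incl A e s s' : (forall z, List.In z s' -> List.In z s) -> small A e s -> small A e s'.
Proof. by move=> ss [a [aA ha]]; exists a; split=> // z /ss /ha. Qed.

(** The compactness fact that makes Mayer-Vietoris exact for closed sets. A vertex of s is needed to
    select a ball of the finite cover, hence the nonempty list. *)
Lemma small_inter A B e : closed A -> closed B -> (0 < e)%Re ->
  exists d, (0 < d)%Re /\ forall s, s <> [::] -> small A d s -> small B d s ->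
    small (fun x => A x /\ B x) e s.
Proof.
move=> cA cB e0.
(* Either t lies in both sets, or its ball of radius 2r misses one of them; a list near both sets
   with a vertex within r of t excludes the second case. *)
pose P t r := ((A t /\ B t) /\ (r <= e / 2)%Re) \/
  (forall y, (dist t y < 2 * r)%Re -> ~ A y) \/ (forall y, (dist t y < 2 * r)%Re -> ~ B y).
have [|l [r [hr hl]]] := @compact_choice P.
  move=> x; case: (classic (A x)) => [ax|/cA [d [d0 hd]]]; last first.
    by exists (d / 2)%Re; split; [lra|right; left=> y hy; apply: hd; lra].
  case: (classic (B x)) => [bx|/cB [d [d0 hd]]]; last first.
    by exists (d / 2)%Re; split; [lra|right; right=> y hy; apply: hd; lra].
  by exists (e / 2)%Re; split; [lra|left; split=> //; lra].
have [d [d0 hd]] := @min_pos r l (fun x => proj1 (hr x)).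
exists (Rmin d (e / 4)); split; first by apply: Rmin_glb_lt; lra.
have m1 := Rmin_l d (e / 4); have m2 := Rmin_r d (e / 4).
move=> [//|z s] _ [a [aA ha]] [b [bB hb]].
have [t [tl htz]] := hl z; have := hd t tl => dt.
have haz : (dist a z < Rmin d (e / 4))%Re by apply: ha; left.
have hbz : (dist b z < Rmin d (e / 4))%Re by apply: hb; left.
have [_ [[[at_ bt] re]|[nA|nB]]] := hr t; last 2 first.
- by case: (nA a) => //; have := dist_tri t z a; rewrite (dist_sym z a); lra.
- by case: (nB b) => //; have := dist_tri t z b; rewrite (dist_sym z b); lra.
exists t; split=> // w hw; have := ha w hw => haw.
by have := dist_tri t z w; have := dist_tri z a w; rewrite (dist_sym z a); lra.
Qed.

End Pseudometric.

(** * Inhomogeneous cochains, unsigned coboundary and cup product *)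

Section Cochains.
Variable F : fieldType.

Definition fsub (X : Type) (a b : X -> F) : X -> F := fun x => a x - b x.
Definition fadd (X : Type) (a b : X -> F) : X -> F := fun x => a x + b x.
Definition fzero (X : Type) : X -> F := fun _ => 0.
Definition fscale (X : Type) (c : F) (a : X -> F) : X -> F := fun x => c * a x.

(** The simplicial coboundary without its signs, which is a differential in characteristic 2. *)
Fixpoint faces (T : Type) (f : seq T -> F) (s : seq T) : F :=
  if s is x :: s' then f s' + faces (fun u => f (x :: u)) s' else 0.

(* The guard removes the augmentation: the complex is the unreduced one. *)
Definition cob (T : Type) (f : seq T -> F) (s : seq T) : F :=
  if s is [:: _] then 0 else faces f s.

(** The Alexander-Whitney product, summed over all vertices at which the list can be split: a
    cochain has components in all degrees at once, so no degree has to be named. *)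
Fixpoint cup (T : Type) (f g : seq T -> F) (s : seq T) : F :=
  if s is x :: s' then f [:: x] * g s + cup (fun u => f (x :: u)) g s' else 0.

(** The unit class of cohomology (c-one, not a mapping cone). *)
Definition cone (T : Type) (s : seq T) : F := if s is [:: _] then 1 else 0.

Definition pull (T U : Type) (h : T -> U) (f : seq U -> F) : seq T -> F := fun s => f (map h s).

Lemma pull_cob T U (h : T -> U) f : pull h (cob f) = cob (pull h f).
Proof.
apply: functional_extensionality => -[|x [|y s]] //; rewrite /pull /cob.
have E : forall s f, faces f (map h s) = faces (fun u => f (map h u)) s.
  by elim=> [|{}x {}s IH] {}f //=; rewrite IH.
exact: E.
Qed.

Lemma pull_cup T U (h : T -> U) f g : pull h (cup f g) = cup (pull h f) (pull h g).
Proof.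
apply: functional_extensionality => s; rewrite /pull.
by elim: s f => [|x s IH] f //=; rewrite IH.
Qed.

Lemma faces_eq0 T (f : seq T -> F) s :
  (forall s', (forall z, List.In z s' -> List.In z s) -> size s' = (size s).-1 -> f s' = 0) ->
  faces f s = 0.
Proof.
elim: s f => [|x s IH] f h //=; rewrite h //=; last by move=> z; right.
rewrite add0r; case: s IH h => [|y s] IH h //; apply: IH => s' hs' sz; apply: h.
  by move=> z /= [->|/hs' hz]; [left|right].
by rewrite /= sz.
Qed.

Lemma cob_eq0 T (f : seq T -> F) s :
  (forall s', (forall z, List.In z s' -> List.In z s) -> (0 < size s' <= (size s).-1)%N -> f s' = 0) ->
  cob f s = 0.
Proof.
case: s => [|x [|y s]] h //; rewrite /cob; apply: faces_eq0 => s' h1 h2; apply: h => //.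
by rewrite h2 /= leqnn.
Qed.

Lemma cup_eq0 T (f g : seq T -> F) s :
  (forall s1 s2, (forall z, List.In z s1 -> List.In z s) -> (forall z, List.In z s2 -> List.In z s) ->
     (0 < size s1)%N -> (0 < size s2)%N -> (size s1 + size s2 = (size s).+1)%N -> f s1 * g s2 = 0) ->
  cup f g s = 0.
Proof.
elim: s f => [|x s IH] f h //=; rewrite h //=; last by move=> z [->|[]]; left.
rewrite add0r; apply: IH => s1 s2 h1 h2 p1 p2 sz; apply: (h (x :: s1) s2) => //.
- by move=> z /= [->|/h1]; [left|right].
- by move=> z /h2; right.
- by rewrite /= addSn sz.
Qed.

Lemma faces_sub T (f g : seq T -> F) s : faces (fsub f g) s = faces f s - faces g s.
Proof.
elim: s f g => [|x s IH] f g /=; first by rewrite subr0.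
have -> : (fun u => fsub f g (x :: u)) = fsub (fun u => f (x :: u)) (fun u => g (x :: u)) by [].
by rewrite IH /fsub; ring.
Qed.

Lemma cob_sub T (f g : seq T -> F) : cob (fsub f g) = fsub (cob f) (cob g).
Proof.
apply: functional_extensionality => -[|x [|y s]]; rewrite /fsub /cob ?subr0 //.
exact: faces_sub.
Qed.

Lemma cup_subl T (f g h : seq T -> F) : cup (fsub f g) h = fsub (cup f h) (cup g h).
Proof.
apply: functional_extensionality => s.
elim: s f g => [|x s IH] f g /=; first by rewrite /fsub subr0.
have -> : (fun u => fsub f g (x :: u)) = fsub (fun u => f (x :: u)) (fun u => g (x :: u)) by [].
by rewrite IH /fsub /=; ring.
Qed.

Lemma cup_subr T (f g h : seq T -> F) : cup h (fsub f g) = fsub (cup h f) (cup h g).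
Proof.
apply: functional_extensionality => s.
elim: s h => [|x s IH] h /=; first by rewrite /fsub subr0.
by rewrite IH /fsub /=; ring.
Qed.

Lemma cup_scalel T c (f h : seq T -> F) : cup (fscale c f) h = fscale c (cup f h).
Proof.
apply: functional_extensionality => s.
elim: s f => [|x s IH] f /=; first by rewrite /fscale mulr0.
have -> : (fun u => fscale c f (x :: u)) = fscale c (fun u => f (x :: u)) by [].
by rewrite IH /fscale /=; ring.
Qed.

Lemma cup_scaler T c (f h : seq T -> F) : cup h (fscale c f) = fscale c (cup h f).
Proof.
apply: functional_extensionality => s.
elim: s h => [|x s IH] h /=; first by rewrite /fscale mulr0.
by rewrite IH /fscale /=; ring.
Qed.

Lemma faces_scale T c (h : seq T -> F) s : faces (fscale c h) s = c * faces h s.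
Proof.
elim: s h => [|x s IH] h /=; first by rewrite mulr0.
have -> : (fun u => fscale c h (x :: u)) = fscale c (fun u => h (x :: u)) by [].
by rewrite IH /fscale; ring.
Qed.

Lemma cob_scale T c (f : seq T -> F) : cob (fscale c f) = fscale c (cob f).
Proof.
by apply: functional_extensionality => -[|x [|y s]]; rewrite /fscale /cob ?mulr0 //; exact: faces_scale.
Qed.

Lemma cob_add T (f g : seq T -> F) : cob (fadd f g) = fadd (cob f) (cob g).
Proof.
have E (a b : seq T -> F) : fadd a b = fsub a (fscale (-1) b).
  by apply: functional_extensionality => u; rewrite /fsub /fadd /fscale; ring.
by rewrite !E cob_sub cob_scale.
Qed.

Lemma cup_assoc T (f g h : seq T -> F) : cup f (cup g h) = cup (cup f g) h.
Proof.
have distr : forall s (a b : seq T -> F) , cup (fadd a b) h s = cup a h s + cup b h s.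
  move=> s; elim: s => [|x s IH] a b /=; first by rewrite addr0.
  have -> : (fun u => fadd a b (x :: u)) = fadd (fun u => a (x :: u)) (fun u => b (x :: u)) by [].
  by rewrite IH /fadd /=; ring.
have sc : forall s (a : seq T -> F) c, cup (fun u => c * a u) h s = c * cup a h s.
  by move=> s a c; rewrite (cup_scalel c).
apply: functional_extensionality => s.
elim: s f => [|x s IH] f //=; rewrite IH.
have -> : (fun u => f [:: x] * g (x :: u) + cup (fun u0 => f (x :: u0)) g u)
  = fadd (fun u => f [:: x] * g (x :: u)) (cup (fun u => f (x :: u)) g) by [].
by rewrite distr sc addr0; ring.
Qed.

Lemma cup1l T (f : seq T -> F) s : s <> [::] -> cup (@cone T) f s = f s.
Proof.
case: s => [//|x s] _ /=; rewrite mul1r.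
have E : forall s (g : seq T -> F), (forall u, u <> [::] -> g u = 0) -> cup g f s = 0.
  elim=> [|y s' IH] g hg //=; rewrite hg // mul0r add0r; apply: IH => u _; exact: hg.
by rewrite E ?addr0 // => -[|y u].
Qed.

Lemma cup1r T (f : seq T -> F) s : s <> [::] -> cup f (@cone T) s = f s.
Proof.
elim: s f => [//|x s IH] f _ /=.
case: s IH => [|y s] IH; first by rewrite mulr1 addr0.
by rewrite mulr0 add0r IH.
Qed.

Hypothesis char2 : forall x : F, x + x = 0.

Lemma oppF (x : F) : - x = x.
Proof. by apply/eqP; rewrite -subr_eq0 -opprD char2 oppr0. Qed.

Lemma faces_add T (f g : seq T -> F) s : faces (fadd f g) s = faces f s + faces g s.
Proof.
have -> : fadd f g = fsub f g by apply: functional_extensionality => u; rewrite /fsub oppF.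
by rewrite faces_sub oppF.
Qed.

Lemma faces_faces T (f : seq T -> F) s : faces (faces f) s = 0.
Proof.
elim: s f => [|x s IH] f //=.
have -> : (fun u => f u + faces (fun v => f (x :: v)) u) = fadd f (faces (fun v => f (x :: v))) by [].
by rewrite faces_add IH addr0 char2.
Qed.

Lemma cob_cob T (f : seq T -> F) : cob (cob f) = @fzero _.
Proof.
apply: functional_extensionality => -[|x [|y s]] //.
have E : forall a b : seq T -> F, (forall u, size u <> 1%N -> a u = b u) ->
    forall s', (1 < size s')%N -> size s' <> 2%N -> faces a s' = faces b s'.
  move=> a b hab s' p2 n2.
  have : faces (fsub a b) s' = 0.
    apply: faces_eq0 => u _ su; rewrite /fsub hab ?subrr //; lia.
  by rewrite faces_sub => /eqP; rewrite subr_eq0 => /eqP.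
case: s => [|z s]; first by rewrite /cob /= !addr0.
suff Q : faces (cob f) [:: x, y, z & s] = 0 by exact: Q.
rewrite (@E (cob f) (faces f)) ?faces_faces //.
by move=> -[|u [|v w]].
Qed.

Lemma cup_addl T (f g h : seq T -> F) : cup (fadd f g) h = fadd (cup f h) (cup g h).
Proof.
have E (a b : seq T -> F) : fadd a b = fsub a b.
  by apply: functional_extensionality => u; rewrite /fsub oppF.
by rewrite !E cup_subl.
Qed.

(** The Leibniz rule for the augmented complex. Deleting the shared vertex occurs twice and cancels;
    the two terms with the empty list compensate for [faces] on fronts and backs with one vertex. *)
Lemma faces_cup T (f g : seq T -> F) x s :
  faces (cup f g) (x :: s) = cup (faces f) g (x :: s) + cup f (faces g) (x :: s)
    + f [::] * g (x :: s) + f (x :: s) * g [::].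
Proof.
elim: s f x => [|y s' IH] f x.
  transitivity ((f [::] * g [:: x] + f [::] * g [:: x]) + (f [:: x] * g [::] + f [:: x] * g [::])).
    by rewrite !char2 /= !addr0.
  by rewrite /=; ring.
set s := y :: s' in IH *; pose A u := f (x :: u); pose gx u := g (x :: u).
have IHA : faces (cup A g) s = _ := IH A y.
have -> : faces (cup f g) (x :: s) = cup f g s + faces (fadd (fscale (f [:: x]) gx) (cup A g)) s by [].
have -> : cup (faces f) g (x :: s) = f [::] * g (x :: s) + cup (fadd f (faces A)) g s.
  by rewrite /= addr0.
have -> : cup f (faces g) (x :: s) = f [:: x] * (g s + faces gx s) + cup A (faces g) s by [].
rewrite faces_add faces_scale IHA cup_addl /fadd.
have := char2 (f [::] * g (x :: s)); rewrite -/s {1}/A.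
set a := cup f g s; set b := f [::] * _; set c := faces gx s; set d := cup (faces A) g s.
set e := cup A _ s => h.
transitivity (a + (f [:: x] * c + (d + e + f [:: x] * g s + A s * g [::])) + (b + b)); last by rewrite /A; ring.
by rewrite h addr0.
Qed.

Lemma cob_cup T (f g : seq T -> F) : cob (cup f g) = fadd (cup (cob f) g) (cup f (cob g)).
Proof.
have E1 : forall s (a b h : seq T -> F), (forall u, u <> [::] -> a u = b u) -> cup a h s = cup b h s.
  move=> s a b h hab; apply/eqP; rewrite -subr_eq0; apply/eqP; rewrite -/(fsub (cup a h) (cup b h) s) -cup_subl.
  by apply: cup_eq0 => -[//|z s1] s2 _ _ _ _ _; rewrite /fsub hab ?subrr ?mul0r.
have E2 : forall s (a b h : seq T -> F), (forall u, u <> [::] -> a u = b u) -> cup h a s = cup h b s.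
  move=> s a b h hab; apply/eqP; rewrite -subr_eq0; apply/eqP; rewrite -/(fsub (cup h a) (cup h b) s) -cup_subr.
  by apply: cup_eq0 => s1 [//|z s2] _ _ _ _ _; rewrite /fsub hab ?subrr ?mulr0.
(* With value 0 on the empty list, [faces] and [cob] agree in every degree and the two extra terms
   of the augmented rule vanish. *)
pose nz (h : seq T -> F) := fun u => if u is [::] then 0 else h u.
have F1 h u : faces (nz h) u = cob h u.
  case: u => [|x [|y u]] //=; rewrite ?addr0 //.
apply: functional_extensionality => s; case: s => [|x [|y s]].
- by rewrite /fadd /= addr0.
- by rewrite /fadd /= !mul0r !mulr0 !addr0.
have -> : cob (cup f g) [:: x, y & s] = faces (cup (nz f) (nz g)) [:: x, y & s].
  have E3 u : cup f g u = cup (nz f) (nz g) u.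
    rewrite (E1 u f (nz f)); last by case.
    by rewrite (E2 u g (nz g)) //; case.
  rewrite /cob; congr faces; exact: functional_extensionality.
rewrite faces_cup.
have -> : nz f [::] * nz g [:: x, y & s] = 0 by rewrite mul0r.
have -> : nz f [:: x, y & s] * nz g [::] = 0 by rewrite mulr0.
have -> : faces (nz f) = cob f by apply: functional_extensionality => u; exact: F1.
have -> : faces (nz g) = cob g by apply: functional_extensionality => u; exact: F1.
rewrite !addr0 /fadd (E2 _ (nz g) g); last by case.
by rewrite (E1 _ (nz f) f) //; case.
Qed.
End Cochains.

(** * Comparison of Mayer-Vietoris theories *)

Section Comparison.
Variables (F : fieldType) (T : cpm).

(* What the inductive comparison of two cohomology theories on the closed subsets
   of T uses: a filtration by "null" cochains satisfying Mayer-Vietoris. *)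
Record mvt := Mvt {
  mX : Type;
  mK : (T -> Prop) -> nat -> (mX -> F) -> Prop;
  md : (mX -> F) -> mX -> F;
  md_sub : forall a b, md (fsub a b) = fsub (md a) (md b);
  mdd : forall x, md (md x) = @fzero F _;
  mK_0 : forall A x, mK A 0 x;
  mK_z : forall A p, mK A p (@fzero F _);
  mK_sub : forall A p x y, mK A p x -> mK A p y -> mK A p (fsub x y);
  mK_mono : forall (A A' : T -> Prop) p x, (forall t, A' t -> A t) -> mK A p x -> mK A' p x;
  mK_d : forall A p x, mK A p x -> mK A p.+1 (md x);
  mK_emp : forall p x, mK (fun _ => False) p x;
  mK_U : forall A A' p x, mK A p x -> mK A' p x -> mK (fun t => A t \/ A' t) p x;
  mK_I : forall A A' p x, closed A -> closed A' -> mK (fun t => A t /\ A' t) p x ->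
    exists y, mK A p y /\ mK A' p (fsub x y);
  mK_loc : forall b p x, mK (ptset b) p x -> exists e, (0 < e)%Re /\ mK (cball b e) p x }.

(** The differential raises the degree, so a cocycle condition in degrees below p concerns [md x] in
    degrees below p + 1. *)
Definition mZ (M : mvt) A p (x : mX M -> F) := mK A p.+1 (md x).
Definition mB (M : mvt) A p (x : mX M -> F) := exists y, mK A p (fsub x (md y)).

Variables (M N : mvt) (B : T -> Prop) (th : (mX M -> F) -> mX N -> F).

Definition minj A p := forall x, mZ A p x -> mB A p (th x) -> mB A p x.
Definition msurj A p := forall y, mZ A p y -> exists x, mZ A p x /\ mB A p (fsub y (th x)).

Hypothesis th_sub : forall x y, th (fsub x y) = fsub (th x) (th y).
Hypothesis th_K : forall A p x, mK A p x -> mK A p (th x).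
Hypothesis th_d : forall p x, mK B p (fsub (th (md x)) (md (th x))).

Let zsub (M' : mvt) A p (x y : mX M' -> F) : mK A p (fsub x y) -> mK A p y -> mK A p x.
Proof.
move=> h1 h2.
have hz := mK_sub (@mK_z M' A p) h2.
have := mK_sub h1 hz; congr mK; apply: functional_extensionality => u.
by rewrite /fsub /fzero; ring.
Qed.

Ltac fe := apply: functional_extensionality => ?; rewrite /fsub /fzero ?/fsub; ring.

Lemma mZ_mono (M' : mvt) (A A' : T -> Prop) p (x : mX M' -> F) :
  (forall t, A' t -> A t) -> mZ A p x -> mZ A' p x.
Proof. exact: mK_mono. Qed.

Lemma mB_mono (M' : mvt) (A A' : T -> Prop) p (x : mX M' -> F) :
  (forall t, A' t -> A t) -> mB A p x -> mB A' p x.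
Proof. by move=> h [y hy]; exists y; exact: mK_mono hy. Qed.

(** One half of the five lemma. Given primitives psi1, psi2 of x on two pieces and a primitive eta
    of [th x], surjectivity in lower degree yields cocycles xi whose images are the defects
    [th psi - eta]. The corrected primitives differ on the intersection by a cocycle with bounding
    image, hence by a coboundary, and can be glued. *)
Let step_inj p A : (forall t, A t -> B t) -> closed A ->
  (forall A', closed A' -> (forall t, A' t -> A t) -> minj A' p /\ msurj A' p) ->
  (forall b, B b -> minj (ptset b) p.+1) -> minj A p.+1.
Proof.
move=> AB cA IH hpt x zx [eta heta].
pose Q A' := mB A' p.+1 x.
apply: (@compact_ind T A Q cA).
- by move=> A1 A2 s; exact: mB_mono.
- by exists (@fzero _ _); exact: mK_emp.
- move=> A1 A2 c1 c2 s1 s2 [psi1 h1] [psi2 h2].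
  have pre (i : T -> Prop) psi : (forall t, i t -> A t) -> mK i p.+1 (fsub x (md psi)) ->
      mZ i p (fsub (th psi) eta).
    move=> si hi; rewrite /mZ md_sub.
    have e1 : mK i p.+1 (fsub (th x) (th (md psi))) by rewrite -th_sub; exact: th_K.
    have e2 := mK_mono si heta.
    have e3 := mK_mono (fun t h => AB t (si t h)) (th_d p.+1 psi).
    have := mK_sub (mK_sub e2 e1) e3; congr mK; fe.
  have [_ sj1] := IH A1 c1 s1; have [_ sj2] := IH A2 c2 s2.
  have [xi1 [zxi1 [zeta1 k1]]] := sj1 _ (pre _ _ s1 h1).
  have [xi2 [zxi2 [zeta2 k2]]] := sj2 _ (pre _ _ s2 h2).
  pose A12 := fun t => A1 t /\ A2 t.
  have m1 : forall t, A12 t -> A1 t by move=> t [].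
  have m2 : forall t, A12 t -> A2 t by move=> t [].
  have [ij _] := IH A12 (closedI c1 c2) (fun t h => s1 t (m1 t h)).
  pose q1 := fsub psi1 xi1; pose q2 := fsub psi2 xi2.
  have hq1 : mK A1 p.+1 (fsub x (md q1)).
    rewrite /q1 md_sub; apply: zsub h1.
    have := mK_sub (@mK_z _ A1 p.+1) zxi1; have := mK_sub (@mK_z _ A1 p.+1) (mK_sub (@mK_z _ A1 p.+1) zxi1).
    by move=> + _; congr mK; fe.
  have hq2 : mK A2 p.+1 (fsub x (md q2)).
    rewrite /q2 md_sub; apply: zsub h2.
    have := mK_sub (@mK_z _ A2 p.+1) (mK_sub (@mK_z _ A2 p.+1) zxi2).
    by congr mK; fe.
  have zq : mZ A12 p (fsub q1 q2).
    rewrite /mZ md_sub; have := mK_sub (mK_mono m2 hq2) (mK_mono m1 hq1); congr mK; fe.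
  have bq : mB A12 p (th (fsub q1 q2)).
    exists (fsub zeta1 zeta2); rewrite md_sub !th_sub.
    have := mK_sub (mK_mono m1 k1) (mK_mono m2 k2); congr mK; rewrite /q1 /q2; fe.
  have [chi hchi] := ij _ zq bq.
  have [y1 [ky1 ky2]] := mK_I c1 c2 hchi.
  exists (fsub q1 y1); apply: mK_U.
    rewrite md_sub; apply: zsub hq1; have := mK_sub (@mK_z _ A1 p.+1) (mK_sub (@mK_z _ A1 p.+1) (mK_d ky1)).
    by congr mK; fe.
  apply: zsub hq2.
  have := mK_sub (@mK_z _ A2 p.+1) (mK_d ky2).
  rewrite !md_sub mdd; congr mK; fe.
- move=> b bA.
  have pA t : ptset b t -> A t.
    move=> ht; apply: NNPP => /cA [e [e0 he]]; apply: (he b) => //.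
    by rewrite dist_sym ht.
  have [y hy] := hpt b (AB b bA) x (mZ_mono pA zx) (mB_mono pA (ex_intro _ eta heta)).
  have [e [e0 he]] := mK_loc hy; exists e; split=> //; exists y.
  by apply: mK_mono he => t [].
Qed.

(** The other half. Local preimages of y differ on the intersection by a coboundary, by injectivity
    in the same degree, and glue to x; the defect between the two primitives of [y - th x] is a
    cocycle of lower degree, and a preimage of it corrects x. *)
Let step_surj p A : (forall t, A t -> B t) -> closed A ->
  (forall A', closed A' -> (forall t, A' t -> A t) -> msurj A' p /\ minj A' p.+1) ->
  (forall b, B b -> msurj (ptset b) p.+1) -> msurj A p.+1.
Proof.
move=> AB cA IH hpt y zy.
pose Q A' := exists x, mZ A' p.+1 x /\ mB A' p.+1 (fsub y (th x)).
apply: (@compact_ind T A Q cA).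
- by move=> A1 A2 s [x [h1 h2]]; exists x; split; [exact: mZ_mono h1|exact: mB_mono h2].
- by exists (@fzero _ _); split; [exact: mK_emp|exists (@fzero _ _); exact: mK_emp].
- move=> A1 A2 c1 c2 s1 s2 [x1 [zx1 [eta1 h1]]] [x2 [zx2 [eta2 h2]]].
  pose A12 := fun t => A1 t /\ A2 t.
  have m1 : forall t, A12 t -> A1 t by move=> t [].
  have m2 : forall t, A12 t -> A2 t by move=> t [].
  have [sj ij] := IH A12 (closedI c1 c2) (fun t h => s1 t (m1 t h)).
  have zq : mZ A12 p.+1 (fsub x1 x2).
    by rewrite /mZ md_sub; apply: mK_sub; [exact: mK_mono zx1|exact: mK_mono zx2].
  have bq : mB A12 p.+1 (th (fsub x1 x2)).
    exists (fsub eta2 eta1); rewrite md_sub th_sub.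
    have := mK_sub (mK_mono m2 h2) (mK_mono m1 h1); congr mK; fe.
  have [chi hchi] := ij _ zq bq.
  have [y1 [ky1 ky2]] := mK_I c1 c2 hchi.
  pose x := fsub x1 y1.
  have e1 : mK A1 p.+1 (fsub (fsub y (th x)) (md eta1)).
    have := mK_sub h1 (mK_sub (@mK_z _ A1 p.+1) (th_K ky1)).
    by rewrite /x th_sub; congr mK; fe.
  have e2 : mK A2 p.+1 (fsub (fsub y (th x)) (md (fsub eta2 (th chi)))).
    have d2 := mK_mono (fun t (h : A2 t) => AB t (s2 t h)) (th_d p.+1 chi).
    have := mK_sub (mK_sub h2 (th_K ky2)) d2.
    by rewrite /x !th_sub md_sub; congr mK; fe.
  have zx : mZ (fun t => A1 t \/ A2 t) p.+1 x.
    apply: mK_U.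
      by rewrite /x md_sub; apply: mK_sub zx1 (mK_d ky1).
    have := mK_sub zx2 (mK_sub (@mK_z _ A2 p.+2) (mK_d ky2)).
    by rewrite /x !md_sub mdd; congr mK; fe.
  have zc : mZ A12 p (fsub eta1 (fsub eta2 (th chi))).
    have := mK_sub (mK_mono m2 e2) (mK_mono m1 e1).
    by rewrite /mZ !md_sub; congr mK; fe.
  have [beta [zbeta [gam hgam]]] := sj _ zc.
  have [w1 [kw1 kw2]] := mK_I c1 c2 zbeta.
  have [k1 [kk1 kk2]] := mK_I c1 c2 hgam.
  (* [w1] vanishes near [A1] and equals [md beta] near [A2]: it represents the image of beta under
     the connecting map. *)
  exists (fsub x w1); split.
    apply: mK_U; rewrite md_sub; apply: mK_sub.
    - by apply: mK_mono zx => t; left.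
    - exact: mK_d.
    - by apply: mK_mono zx => t; right.
    have := mK_sub (@mK_z _ A2 p.+2) (mK_d kw2).
    by rewrite !md_sub mdd; congr mK; fe.
  exists (fsub eta1 k1); apply: mK_U; rewrite th_sub.
    have := mK_sub (mK_sub e1 (mK_sub (@mK_z _ A1 p.+1) (th_K kw1))) (mK_sub (@mK_z _ A1 p.+1) (mK_d kk1)).
    by rewrite md_sub; congr mK; fe.
  have d2 := mK_mono (fun t (h : A2 t) => AB t (s2 t h)) (th_d p.+1 beta).
  have := mK_sub (mK_sub (mK_sub e2 (mK_sub (@mK_z _ A2 p.+1) d2)) (th_K kw2)) (mK_d kk2).
  by rewrite !th_sub !md_sub mdd; congr mK; fe.
- move=> b bA.
  have pA t : ptset b t -> A t.
    move=> ht; apply: NNPP => /cA [e [e0 he]]; apply: (he b) => //.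
    by rewrite dist_sym ht.
  have [x [zx [eta heta]]] := hpt b (AB b bA) y (mZ_mono pA zy).
  have [e [e0 he]] := mK_loc zx; have [e' [e0' he']] := mK_loc heta.
  exists (Rmin e e'); split; first exact: Rmin_glb_lt.
  have m := Rmin_l e e'; have m' := Rmin_r e e'.
  exists x; split; first by apply: mK_mono he => t [_]; rewrite /cball; lra.
  by exists eta; apply: mK_mono he' => t [_]; rewrite /cball; lra.
Qed.

(** Agreement on point classes spreads to small balls by [mK_loc] and then to all closed subsets by
    [compact_ind]. The induction runs over p with all closed subsets at once; at p = 0 every cochain
    is null. At p + 1 injectivity must come before surjectivity. *)
Theorem comparison : closed B ->
  (forall b p, B b -> minj (ptset b) p /\ msurj (ptset b) p) ->
  forall p, minj B p /\ msurj B p.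
Proof.
move=> cB hpt p.
suff H : forall A, closed A -> (forall t, A t -> B t) -> minj A p /\ msurj A p by exact: H.
elim: p => [|p IH] A cA sA.
  split; first by move=> x _ _; exists (@fzero _ _); exact: mK_0.
  move=> y _; exists (@fzero _ _); split; last by exists (@fzero _ _); exact: mK_0.
  by apply: mK_d; exact: mK_0.
have I A' (c' : closed A') (s' : forall t, A' t -> A t) : minj A' p.+1.
  apply: step_inj => // [t /s'/sA //|A'' c'' s''|b Bb]; first by apply: IH => // t /s''/s'/sA.
  by case: (hpt b p.+1 Bb).
split; first exact: I.
apply: step_surj => // [A' c' s'|b Bb]; last by case: (hpt b p.+1 Bb).
by split; [case: (IH A' c') => // t /s'/sA|exact: I].
Qed.

End Comparison.

(** * Alexander-Spanier cohomology *)

Section Continuity.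
Variables T U : cpm.

Definition cont (q : U -> T) := forall u e, (0 < e)%Re ->
  exists d, (0 < d)%Re /\ forall v, (dist u v < d)%Re -> (dist (q u) (q v) < e)%Re.

Lemma cont_unif q e : cont q -> (0 < e)%Re ->
  exists d, (0 < d)%Re /\ forall u v, (dist u v < d)%Re -> (dist (q u) (q v) < e)%Re.
Proof.
move=> cq e0.
have [|l [r [hr hl]]] := @compact_choice U
    (fun u d => forall v, (dist u v < 2 * d)%Re -> (dist (q u) (q v) < e / 2)%Re).
  move=> u; have [|d [d0 hd]] := cq u (e / 2)%Re; first lra.
  by exists (d / 2)%Re; split; [lra|move=> v hv; apply: hd; lra].
have [d [d0 hd]] := @min_pos U r l (fun x => proj1 (hr x)).
exists d; split=> // u v huv; have [x [xl hx]] := hl u; have hdx := hd x xl.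
have h1 : (dist (q x) (q u) < e / 2)%Re by apply: (proj2 (hr x)); have := proj1 (hr x); lra.
have h2 : (dist (q x) (q v) < e / 2)%Re by apply: (proj2 (hr x)); have := dist_tri x u v; lra.
by have := dist_tri (q u) (q x) (q v); rewrite (dist_sym (q u) (q x)); lra.
Qed.

Lemma closed_pre q (A : T -> Prop) : cont q -> closed A -> closed (fun u => A (q u)).
Proof.
move=> cq cA u /cA [e [e0 he]]; have [d [d0 hd]] := cq u e e0.
by exists d; split=> // v /hd; exact: he.
Qed.

(** Upper semicontinuity of the fibres of a map of compact spaces. It makes a cochain that is null
    along a fibre null along the part of [W] over a whole ball. *)
Lemma fibre_usc q (W : U -> Prop) b e : cont q -> closed W -> (0 < e)%Re ->
  exists d, (0 < d)%Re /\ forall u, W u -> (dist b (q u) <= d)%Re ->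
    exists v, W v /\ ptset b (q v) /\ (dist v u < e)%Re.
Proof.
move=> cq cW e0.
pose P u r := (W u /\ ptset b (q u) /\ (r <= e)%Re) \/ (forall v, (dist u v < r)%Re -> ~ W v) \/
  (exists d, (0 < d)%Re /\ forall v, (dist u v < r)%Re -> (d < dist b (q v))%Re).
have [|l [r [hr hl]]] := @compact_choice U P.
  move=> u; case: (classic (W u)) => [wu|/cW [d [d0 hd]]]; last by exists d; split=> //; right; left.
  case: (classic (ptset b (q u))) => [pu|npu].
    by exists e; split=> //; left; do !split=> //; lra.
  have p0 : (0 < dist b (q u))%Re by have := dist_ge0 b (q u); rewrite /ptset in npu; lra.
  have [|d [d0 hd]] := cq u (dist b (q u) / 2)%Re; first lra.
  exists d; split=> //; right; right; exists (dist b (q u) / 3)%Re; split; first lra.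
  by move=> v /hd h; have := dist_tri b (q v) (q u); rewrite (dist_sym (q v)); lra.
pose g u d := (forall v, (dist u v < r u)%Re -> W v -> (dist b (q v) <= d)%Re ->
   W u /\ ptset b (q u) /\ (r u <= e)%Re).
have hg u : exists d, (0 < d)%Re /\ g u d.
  case: (hr u) => r0 [[h1 [h2 h3]]|[h|[d [d0 hd]]]].
  - by exists 1%Re; split; [lra|].
  - by exists 1%Re; split; [lra|move=> v /h].
  - by exists d; split=> // v /hd; lra.
have [s [r' [hr' _]]] := @compact_choice U g hg.
have [d [d0 hd]] := @min_pos U r' l (fun x => proj1 (hr' x)).
exists d; split=> // u wu hu; have [x [xl hx]] := hl u.
have [|h1 [h2 h3]] := proj2 (hr' x) u hx wu; first by have := hd x xl; lra.
by exists x; do !split=> //; lra.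
Qed.

End Continuity.

Section Classes.
Variable F : fieldType.
Hypothesis char2 : forall x : F, x + x = 0.

Local Ltac fe := apply: functional_extensionality => ?; rewrite /fsub /fadd /fscale /fzero; ring.

Section OneSpace.
Variable T : cpm.
Implicit Types (A B : T -> Prop) (x y : seq T -> F) (p : nat).

(* Alexander-Spanier cohomology of the closed set A, degree by degree: a list of
   length q + 1 is a q-simplex, and [K A p x] says that the germ of x along A
   vanishes in degrees below p.  [Zc] and [Bc] are the cocycles and the
   coboundaries of the quotient by these cochains, again in degrees below p. *)
Definition K A p x := exists e, (0 < e)%Re /\
  forall s, (0 < size s <= p)%N -> small A e s -> x s = 0.
Definition Zc A p x := K A p.+1 (cob x).
Definition Bc A p x := exists y, K A p (fsub x (cob y)).

Lemma K_0 A x : K A 0 x.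
Proof. by exists 1%Re; split; [lra|move=> s; lia]. Qed.

Lemma K_z A p : K A p (@fzero F _).
Proof. by exists 1%Re; split; [lra|]. Qed.

Lemma K_sub A p x y : K A p x -> K A p y -> K A p (fsub x y).
Proof.
move=> [e [e0 he]] [e' [e0' he']]; exists (Rmin e e'); split; first exact: Rmin_glb_lt.
move=> s hs sm; rewrite /fsub he ?he' ?subr0 //; apply: small_le sm; [exact: Rmin_r|exact: Rmin_l].
Qed.

Lemma K_mono A A' p x : (forall t, A' t -> A t) -> K A p x -> K A' p x.
Proof.
move=> h [e [e0 he]]; exists e; split=> // s hs /(small_sub h); exact: he.
Qed.

Lemma K_le A p p' x : (p' <= p)%N -> K A p x -> K A p' x.
Proof. by move=> h [e [e0 he]]; exists e; split=> // s hs; apply: he; lia. Qed.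

Lemma K_d A p x : K A p x -> K A p.+1 (cob x).
Proof.
move=> [e [e0 he]]; exists e; split=> // s hs sm; apply: cob_eq0 => s' h1 h2.
by apply: he; [lia|exact: small_incl sm].
Qed.

Lemma K_U A A' p x : K A p x -> K A' p x -> K (fun t => A t \/ A' t) p x.
Proof.
move=> [e [e0 he]] [e' [e0' he']]; exists (Rmin e e'); split; first exact: Rmin_glb_lt.
move=> s hs [a [[aA|aA] ha]].
  by apply: he => //; exists a; split=> // z /ha; have := Rmin_l e e'; lra.
by apply: he' => //; exists a; split=> // z /ha; have := Rmin_r e e'; lra.
Qed.

Lemma K_emp p x : K (fun _ => False) p x.
Proof. by exists 1%Re; split; [lra|move=> s _ [? []]]. Qed.

(** The cochain y keeps x exactly on the simplices that are closer to [A'] than to [A]. Such a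
    simplex, if near [A], is near both sets, hence near their intersection, where x vanishes; the
    same argument applies to x - y near [A']. *)
Lemma K_I A A' p x : closed A -> closed A' -> K (fun t => A t /\ A' t) p x ->
  exists y, K A p y /\ K A' p (fsub x y).
Proof.
move=> cA cA' [e [e0 he]]; have [d [d0 hd]] := small_inter cA cA' e0.
pose cl s := forall r, small A' r s -> small A r s.
exists (fun s => if excluded_middle_informative (cl s) then 0 else x s).
have ne s : (0 < size s)%N -> s <> [::] by case: s.
split; exists d; split=> // s hs sm; rewrite /fsub; case: excluded_middle_informative => h //.
- have [r hr] := not_all_ex_not _ _ h.
  have [h1 h2] := imply_to_and _ _ hr.
  apply: he => //; apply: hd => //; first by apply: ne; lia.
  apply: small_le h1; apply: Rnot_lt_le => lt; apply: h2; apply: small_le sm; lra.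
- rewrite subr0; apply: he => //; apply: hd => //; [by apply: ne; lia|exact: h].
- by rewrite subrr.
Qed.

Lemma K_ext A p x y : (forall s, (0 < size s)%N -> x s = y s) -> K A p x -> K A p y.
Proof. by move=> h [e [e0 he]]; exists e; split=> // s hs sm; rewrite -h; [exact: he|lia]. Qed.

Lemma K_add A p x y : K A p x -> K A p y -> K A p (fadd x y).
Proof.
move=> h1 h2; have := K_sub h1 (K_sub (K_z A p) h2); congr K; fe.
Qed.

Lemma K_scale A p c x : K A p x -> K A p (fscale c x).
Proof. by move=> [e [e0 he]]; exists e; split=> // s hs sm; rewrite /fscale he ?mulr0. Qed.

Lemma K_cupl A p x y : K A p x -> K A p (cup x y).
Proof.
move=> [e [e0 he]]; exists e; split=> // s hs sm; apply: cup_eq0 => s1 s2 h1 h2 p1 p2 sz.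
rewrite he ?mul0r //; [lia|exact: small_incl sm].
Qed.

Lemma K_cupr A p x y : K A p y -> K A p (cup x y).
Proof.
move=> [e [e0 he]]; exists e; split=> // s hs sm; apply: cup_eq0 => s1 s2 h1 h2 p1 p2 sz.
rewrite he ?mulr0 //; [lia|exact: small_incl sm].
Qed.

Lemma Z_one A p : Zc A p (@cone F T).
Proof.
apply: K_ext (K_z A p.+1) => -[|x [|y s]] //= _.
transitivity (faces (@cone F T) [:: x, y & s]) => //.
case: s => [|z s]; first by rewrite /= !addr0 char2.
by rewrite faces_eq0 // => -[|a [|b s']].
Qed.

Lemma Z_sub A p x y : Zc A p x -> Zc A p y -> Zc A p (fsub x y).
Proof. by move=> h1 h2; rewrite /Zc cob_sub; exact: K_sub. Qed.

Lemma Z_scale A p c x : Zc A p x -> Zc A p (fscale c x).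
Proof. by move=> h; rewrite /Zc cob_scale; exact: K_scale. Qed.

Lemma Z_mono A A' p x : (forall t, A' t -> A t) -> Zc A p x -> Zc A' p x.
Proof. exact: K_mono. Qed.

Lemma B_K A p x : K A p x -> Bc A p x.
Proof.
move=> h; exists (@fzero F _); apply: K_ext h => s _.
by rewrite /fsub cob_eq0 // subr0.
Qed.

Lemma B_cob A p x : Bc A p (cob x).
Proof. by exists x; apply: K_ext (K_z A p) => s _; rewrite /fsub subrr. Qed.

Lemma B_0 A p : Bc A p (@fzero F _).
Proof. exact/B_K/K_z. Qed.

Lemma B_sub A p x y : Bc A p x -> Bc A p y -> Bc A p (fsub x y).
Proof.
move=> [a ha] [b hb]; exists (fsub a b); rewrite cob_sub.
have := K_sub ha hb; congr K; fe.
Qed.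

Lemma B_add A p x y : Bc A p x -> Bc A p y -> Bc A p (fadd x y).
Proof.
move=> h1 h2; have := B_sub h1 (B_sub (B_0 A p) h2); congr Bc; fe.
Qed.

Lemma B_scale A p c x : Bc A p x -> Bc A p (fscale c x).
Proof.
move=> [y hy]; exists (fscale c y); rewrite cob_scale.
have := K_scale c hy; congr K; fe.
Qed.

Lemma B_mono A A' p x : (forall t, A' t -> A t) -> Bc A p x -> Bc A' p x.
Proof. by move=> h [y hy]; exists y; exact: K_mono hy. Qed.

Lemma B_ext A p x y : (forall s, (0 < size s)%N -> x s = y s) -> Bc A p x -> Bc A p y.
Proof. by move=> h [u hu]; exists u; apply: K_ext hu => s hs; rewrite /fsub h. Qed.

Lemma B_trans A p x y z : Bc A p (fsub x y) -> Bc A p (fsub y z) -> Bc A p (fsub x z).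
Proof. move=> h1 h2; have := B_add h1 h2; congr Bc; fe. Qed.

Lemma B_congr A p x y : Bc A p (fsub x y) -> Bc A p y -> Bc A p x.
Proof. move=> h1 h2; have := B_add h1 h2; congr Bc; fe. Qed.

Lemma B_cupl A p x y : (forall q, K A q (cob y)) -> Bc A p x -> Bc A p (cup x y).
Proof.
move=> zy [a ha]; exists (cup a y).
have h1 := K_cupl y ha; have h2 := K_cupr a (zy p).
have := K_sub h1 h2; congr K.
by rewrite cob_cup // cup_subl; fe.
Qed.

Lemma B_cupr A p x y : (forall q, K A q (cob x)) -> Bc A p y -> Bc A p (cup x y).
Proof.
move=> zx [a ha]; exists (cup x a).
have h1 := K_cupr x ha; have h2 := K_cupl a (zx p).
have := K_sub h1 h2; congr K.
by rewrite cob_cup // cup_subr; fe.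
Qed.

Lemma Z_cup A x y : (forall q, K A q (cob x)) -> (forall q, K A q (cob y)) ->
  forall q, K A q (cob (cup x y)).
Proof.
move=> hx hy q; rewrite cob_cup //; apply: K_add; [exact: K_cupl|exact: K_cupr].
Qed.

(* The Lusternik-Schnirelmann argument. *)
Lemma B_cup_cover A A1 A2 p x y : (forall t, A t -> A1 t \/ A2 t) ->
  (forall q, K A q (cob x)) -> (forall q, K A q (cob y)) ->
  Bc A1 p x -> Bc A2 p y -> Bc A p (cup x y).
Proof.
move=> cov zx zy [a ha] [b hb].
have e1 : Bc A p (cup (fsub x (cob a)) (fsub y (cob b))).
  apply: B_K; apply: K_mono cov _; apply: K_U; [exact: K_cupl|exact: K_cupr].
have e2 : Bc A p (cup x (cob b)) by apply: B_cupr => //; exact: B_cob.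
have e3 : Bc A p (cup (cob a) (fsub y (cob b))).
  apply: B_cupl; last exact: B_cob.
  move=> q; rewrite cob_sub cob_cob //; apply: K_sub => //; exact: K_z.
have := B_add (B_add e1 e3) e2; congr Bc.
by rewrite !cup_subl !cup_subr; fe.
Qed.

(** Prefixing the vertex b is a contracting homotopy: simplices near the class of b stay near it
    when b is added. *)
Lemma pt_class b p x : Zc (ptset b) p x -> Bc (ptset b) p (fsub x (fscale (x [:: b]) (@cone F T))).
Proof.
move=> [e [e0 he]]; exists (fun s => x (b :: s)); exists e; split=> // s hs [a [ab ha]].
have hb z : List.In z (b :: s) -> (dist a z < e)%Re.
  by case=> [<-|/ha //]; rewrite dist_sym ab.
have := he (b :: s); rewrite /= => H; have {H} : cob x (b :: s) = 0.
  by apply: H; [lia|exists a].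
rewrite /fsub /fscale; case: s hs ha {hb} => [//|y [|z s]] hs ha; rewrite /cob /=.
  by rewrite mulr1 !addr0 subr0 (oppF char2).
by move=> H; rewrite mulr0 subr0 (oppF char2).
Qed.

(** Evaluation at the 0-simplex b kills coboundaries, by the guard in [cob]. *)
Lemma pt_inj b A p c : A b -> (0 < p)%N -> Bc A p (fscale c (@cone F T)) -> c = 0.
Proof.
move=> hb p0 [y [e [e0 he]]]; have := he [:: b].
rewrite /fsub /fscale /= mulr1 subr0; apply => //; exists b; split=> // z [<-|//].
by rewrite dist_refl.
Qed.

Definition acyclic A := (exists a, A a) /\
  forall p x, Zc A p x -> exists c, Bc A p (fsub x (fscale c (@cone F T))).

Lemma acyclic_pt b A : (forall t, A t <-> ptset b t) -> acyclic A.
Proof.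
move=> Ab; split; first by exists b; apply/Ab; exact: dist_refl.
move=> p x zx; exists (x [:: b]).
have /pt_class [y hy] : Zc (ptset b) p x by apply: Z_mono zx => t /Ab.
by exists y; apply: K_mono hy => t /Ab.
Qed.

Lemma acyclic_ext A B : (forall t, A t <-> B t) -> acyclic A -> acyclic B.
Proof.
move=> AB [[a Aa] h]; split; first by exists a; apply/AB.
move=> p x zx; have [|c hc] := h p x; first by apply: Z_mono zx => t /AB.
by exists c; apply: B_mono hc => t /AB.
Qed.

End OneSpace.

Section Pullback.
Variables T U : cpm.

Lemma K_pull (q : U -> T) (A : U -> Prop) (B : T -> Prop) p x : cont q -> (forall u, A u -> B (q u)) ->
  K B p x -> K A p (pull q x).
Proof.
move=> cq AB [e [e0 he]]; have [d [d0 hd]] := cont_unif cq e0.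
exists d; split=> // s hs [a [aA ha]]; apply: he; first by rewrite size_map.
by exists (q a); split; [exact: AB|move=> z /in_map_iff [w [<- hw]]; apply: hd; exact: ha].
Qed.

Lemma B_pull (q : U -> T) (A : U -> Prop) (B : T -> Prop) p x : cont q -> (forall u, A u -> B (q u)) ->
  Bc B p x -> Bc A p (pull q x).
Proof.
by move=> cq AB [y hy]; exists (pull q y); rewrite -pull_cob; have := K_pull cq AB hy.
Qed.

Lemma Z_pull (q : U -> T) (A : U -> Prop) (B : T -> Prop) p x : cont q -> (forall u, A u -> B (q u)) ->
  Zc B p x -> Zc A p (pull q x).
Proof. by move=> cq AB h; rewrite /Zc -pull_cob; exact: K_pull AB h. Qed.

End Pullback.

Section Theories.
Variables T U : cpm.

Section Over.
Variables (q : U -> T) (W : U -> Prop).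
Hypotheses (cq : cont q) (cW : closed W).

(** The theory sending a closed set of the base to the cohomology of the part of [W] above it;
    locality is [fibre_usc]. *)
Definition over_mvt : mvt F T.
Proof.
refine (@Mvt F T (seq U) (fun A p x => K (fun u => W u /\ A (q u)) p x) (@cob F U)
  (@cob_sub F U) (@cob_cob F char2 U) _ _ _ _ _ _ _ _ _).
- by move=> A x; exact: K_0.
- by move=> A p; exact: K_z.
- by move=> A p x y; exact: K_sub.
- by move=> A A' p x h; apply: K_mono => u [wu /h].
- by move=> A p x; exact: K_d.
- by move=> p x; apply: K_mono (K_emp p x) => t [].
- by move=> A A' p x h1 h2; apply: K_mono (K_U h1 h2) => t [wt [a|a]]; [left|right].
- move=> A A' p x cA cA' h; apply: K_I; try by apply: closedI => //; exact: closed_pre.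
  by apply: K_mono h => t [[wt a] [_ a']].
- move=> b p x [e [e0 he]]; have [|d [d0 hd]] := fibre_usc b (e := (e / 2)%Re) cq cW; first lra.
  exists d; split=> //; exists (e / 2)%Re; split; first lra.
  move=> s hs [a [[wa ba] ha]]; apply: he => //.
  have [v [wv [pv hv]]] := hd a wa ba; exists v; split=> // z /ha; have := dist_tri v a z; lra.
Defined.
End Over.

Section Sum.
Variables (r : nat) (e : 'I_r -> nat).

(** A direct sum of copies of the cohomology of the base, the i-th one shifted by [e i]: the source
    of the Leray-Hirsch map. *)
Definition sum_mvt : mvt F T.
Proof.
refine (@Mvt F T ('I_r * seq T)%type (fun A p x => forall i, K A (p - e i) (fun s => x (i, s)))
  (fun x js => cob (fun s => x (js.1, s)) js.2) _ _ _ _ _ _ _ _ _ _ _).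
- move=> a b; apply: functional_extensionality => -[i s] /=.
  by rewrite /fsub /=; have := cob_sub (fun s => a (i, s)) (fun s => b (i, s)); move/(congr1 (fun f => f s)).
- move=> x; apply: functional_extensionality => -[i s] /=.
  by have := cob_cob char2 (fun s => x (i, s)); move/(congr1 (fun f => f s)).
- by move=> A x i; exact: K_0.
- by move=> A p i; exact: K_z.
- by move=> A p x y hx hy i; exact: K_sub (hx i) (hy i).
- by move=> A A' p x h hx i; exact: K_mono (hx i).
- move=> A p x hx i /=; case: (leqP (e i) p) => h; first by rewrite subSn //; exact: K_d.
  have -> : (p.+1 - e i = 0)%N by lia.
  exact: K_0.
- by move=> p x i; exact: K_emp.
- by move=> A A' p x h1 h2 i; exact: K_U.
- move=> A A' p x cA cA' h.
  pose y i := proj1_sig (constructive_indefinite_description _ (K_I cA cA' (h i))).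
  have hy i : K A (p - e i) (y i) /\ K A' (p - e i) (fsub (fun s => x (i, s)) (y i)).
    by rewrite /y; case: constructive_indefinite_description.
  by exists (fun js => y js.1 js.2); split=> i; case: (hy i).
- move=> b p x h.
  have h' i : exists d, (0 < d)%Re /\ K (cball b d) (p - e i) (fun s => x (i, s)).
    have [d [d0 hd]] := h i; exists (d / 2)%Re; split; first lra.
    exists (d / 2)%Re; split; first lra.
    move=> s hs [a [ba ha]]; apply: hd => //; exists b; split; first exact: dist_refl.
    by move=> z /ha; have := dist_tri b a z; rewrite /cball in ba; lra.
  pose d i := proj1_sig (constructive_indefinite_description _ (h' i)).
  have hd i : (0 < d i)%Re /\ K (cball b (d i)) (p - e i) (fun s => x (i, s)).
    by rewrite /d; case: constructive_indefinite_description.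
  have [m [m0 hm]] : exists m, (0 < m)%Re /\ forall i, (m <= d i)%Re.
    have : exists m, (0 < m)%Re /\ forall i, i \in enum 'I_r -> (m <= d i)%Re.
      elim: (enum 'I_r) => [|i l [m [m0 hm]]]; first by exists 1%Re; split; [lra|].
      exists (Rmin (d i) m); split; first by apply: Rmin_glb_lt => //; case: (hd i).
      move=> j; rewrite inE => /orP [/eqP ->|/hm]; first exact: Rmin_l.
      by have := Rmin_r (d i) m; lra.
    by move=> [m [m0 hm]]; exists m; split=> // i; apply: hm; rewrite mem_enum.
  exists m; split=> // i; apply: K_mono (proj2 (hd i)) => t; rewrite /cball; have := hm i; lra.
Defined.
End Sum.

End Theories.
End Classes.

(** * Leray-Hirsch, Vietoris-Begle and suspension *)

Section LerayHirsch.
Variable F : fieldType.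
Hypothesis char2 : forall x : F, x + x = 0.

Local Ltac fe := apply: functional_extensionality => ?; rewrite /fsub /fadd /fscale /fzero; ring.

Lemma B_sum (T : cpm) (A : T -> Prop) p (I : Type) (l : seq I) (f : I -> seq T -> F) :
  (forall i, Bc A p (f i)) -> Bc A p (fun s => \sum_(i <- l) f i s).
Proof.
move=> h; elim: l => [|i l IH].
  by apply: B_ext (B_0 F A p) => s _; rewrite big_nil.
by apply: B_ext (B_add (h i) IH) => s _; rewrite big_cons.
Qed.

Lemma K_sum (T : cpm) (A : T -> Prop) p (I : Type) (l : seq I) (f : I -> seq T -> F) :
  (forall i, K A p (f i)) -> K A p (fun s => \sum_(i <- l) f i s).
Proof.
move=> h; elim: l => [|i l IH].
  by apply: K_ext (K_z F A p) => s _; rewrite big_nil.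
by apply: K_ext (K_add (h i) IH) => s _; rewrite big_cons.
Qed.

Lemma cob_sum T (I : Type) (l : seq I) (f : I -> seq T -> F) s :
  cob (fun s => \sum_(i <- l) f i s) s = \sum_(i <- l) cob (f i) s.
Proof.
elim: l => [|i l IH]; first by rewrite big_nil cob_eq0 // => s' _ _; rewrite big_nil.
rewrite big_cons -IH.
have -> : (fun s0 => \sum_(j <- i :: l) f j s0) =
    fsub (f i) (fscale (-1) (fun s0 => \sum_(j <- l) f j s0)).
  by apply: functional_extensionality => u; rewrite big_cons /fsub /fscale; ring.
by rewrite cob_sub cob_scale /fsub /fscale; ring.
Qed.

Lemma Z_sum (T : cpm) (A : T -> Prop) p (I : Type) (l : seq I) (f : I -> seq T -> F) :
  (forall i, Zc A p (f i)) -> Zc A p (fun s => \sum_(i <- l) f i s).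
Proof.
move=> h; rewrite /Zc; apply: K_ext (@K_sum T A p.+1 I l (fun i => cob (f i)) h) => s _.
by rewrite cob_sum.
Qed.

Definition pure T (e : nat) (z : seq T -> F) := forall s, size s <> e.+1 -> z s = 0.

(** A product with a class of degree e sees x only in degrees e lower. The truncated subtraction is
    harmless: for e >= p the product vanishes below degree p anyway. *)
Lemma K_cup_pure (T : cpm) (A : T -> Prop) p e x z :
  pure e z -> K A (p - e) x -> K A p (cup x z).
Proof.
move=> pz [d [d0 hd]]; exists d; split=> // s hs sm; apply: cup_eq0 => s1 s2 h1 h2 p1 p2 sz.
case: (eqVneq (size s2) e.+1) => [E|/eqP /pz ->]; last by rewrite mulr0.
rewrite hd ?mul0r //; [lia|exact: small_incl sm].
Qed.

Lemma pull_cone T U (q : U -> T) : pull q (@cone F T) = @cone F U.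
Proof. by apply: functional_extensionality => -[|x [|y s]]. Qed.

Lemma closed_pt_sub (T : cpm) (B : T -> Prop) b : closed B -> B b -> forall t, ptset b t -> B t.
Proof.
move=> cB Bb t ht; apply: NNPP => /cB [e [e0 he]]; apply: (he b) => //; by rewrite dist_sym ht.
Qed.

Section LH.
Variables (T U : cpm) (q : U -> T) (W : U -> Prop) (B : T -> Prop).
Variables (r : nat) (e : 'I_r -> nat) (z : 'I_r -> seq U -> F).
Hypotheses (cq : cont q) (cW : closed W) (cB : closed B).
Hypothesis zpure : forall i, pure (e i) (z i).
Hypothesis zcoc : forall i p, K W p (cob (z i)).
Let Wb b := fun u => W u /\ ptset b (q u).
Let WB := fun u => W u /\ B (q u).
Hypothesis fib_surj : forall b p y, B b -> Zc (Wb b) p y ->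
  exists c : 'I_r -> F, Bc (Wb b) p (fsub y (fun s => \sum_(i < r) c i * z i s)).
Hypothesis fib_inj : forall b p (c : 'I_r -> F), B b ->
  Bc (Wb b) p (fun s => \sum_(i < r) c i * z i s) -> forall i, (e i < p)%N -> c i = 0.

Let M := sum_mvt char2 T e.
Let N := over_mvt char2 cq cW.
(** The Leray-Hirsch map: the sum of the products of the pulled back x_i with z_i. It commutes with
    the differentials only on germs, because the z_i are cocycles only near [W]. *)
Let th (x : mX M -> F) : mX N -> F :=
  fun s => \sum_(i < r) cup (pull q (fun t => x (i, t))) (z i) s.

Let th_sub x y : th (fsub x y) = fsub (th x) (th y).
Proof.
apply: functional_extensionality => s; rewrite /th /fsub -sumrB; apply: eq_bigr => i _.
have -> : pull q (fun t => x (i, t) - y (i, t)) = fsub (pull q (fun t => x (i, t))) (pull q (fun t => y (i, t))) by [].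
by rewrite cup_subl.
Qed.

Let th_K A p x : mK A p x -> mK A p (th x).
Proof.
move=> h; apply: K_sum => i; apply: K_cup_pure; first exact: zpure.
by apply: K_pull (h i) => // u [].
Qed.

Let th_d p x : mK B p (fsub (th (md x)) (md (th x))).
Proof.
have E s : \sum_(i < r) (- (cup (pull q (fun t => x (i, t))) (cob (z i)) s)) =
    fsub (th (md x)) (md (th x)) s.
  rewrite /fsub /th /= cob_sum -sumrB; apply: eq_bigr => i _.
  rewrite cob_cup // /fadd -pull_cob.
  have -> : pull q (fun t => cob (fun s0 => x (i, s0)) t) = pull q (cob (fun t => x (i, t))) by [].
  ring.
apply: K_ext (fun s _ => E s) _; apply: K_sum => i.
have := K_scale (-1) (K_cupr (pull q (fun t => x (i, t))) (K_mono (fun u (h : W u /\ B (q u)) => proj1 h) (zcoc i p))).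
by congr K; apply: functional_extensionality => s; rewrite /fscale mulN1r.
Qed.

Let sumB A p (x : mX M -> F) : (forall i, Bc A (p - e i) (fun s => x (i, s))) -> mB A p x.
Proof.
move=> h; pose y i := proj1_sig (constructive_indefinite_description _ (h i)).
have hy i : K A (p - e i) (fsub (fun s => x (i, s)) (cob (y i))).
  by rewrite /y; case: constructive_indefinite_description.
by exists (fun js => y js.1 js.2).
Qed.

Let th_B A p x : (forall t, A t -> B t) -> mB A p x -> mB A p (th x).
Proof.
move=> AB [y hy]; exists (th y).
have h1 := th_K hy; rewrite th_sub in h1.
have h2 := mK_mono AB (th_d p y).
have := mK_sub h1 (mK_sub (mK_z N A p) h2); congr mK.
by apply: functional_extensionality => s; rewrite /fsub /fzero; ring.
Qed.

Let th_c (c : 'I_r -> F) s : (0 < size s)%N ->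
  th (fun js => c js.1 * cone F js.2) s = \sum_(i < r) c i * z i s.
Proof.
move=> hs; apply: eq_bigr => i _ /=.
have -> : pull q (fun t => c i * cone F t) = fscale (c i) (pull q (@cone F T)) by [].
by rewrite cup_scalel pull_cone /fscale cup1l //; case: s hs.
Qed.

Let LH_comp p : minj th B p /\ msurj th B p.
Proof.
apply: (comparison th_sub th_K th_d cB) => {}p.
move=> {}b; move: p b => b p Bb; have pB := closed_pt_sub cB Bb.
split=> [x zx bx|y zy].
  pose c i := x (i, [:: b]).
  have bc i : Bc (ptset b) (p - e i) (fsub (fun s => x (i, s)) (fscale (c i) (@cone F T))).
    case: (leqP (e i) p) => h.
      apply: pt_class => //; have := zx i; by rewrite /Zc subSn.
    by have -> : (p - e i = 0)%N; [lia|exists (@fzero F _); exact: K_0].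
  have b1 : mB (ptset b) p (fsub x (fun js => c js.1 * cone F js.2)) by exact: sumB.
  have b2 := th_B pB b1; rewrite th_sub in b2.
  have b3 : Bc (Wb b) p (fun s => \sum_(i < r) c i * z i s).
    apply: B_ext (B_sub bx b2) => s hs; rewrite -th_c // /fsub; ring.
  have c0 := fib_inj Bb b3.
  apply: sumB => i; case: (ltnP (e i) p) => h; last first.
    by have -> : (p - e i = 0)%N; [lia|exists (@fzero F _); exact: K_0].
  by have := bc i; rewrite c0 //; congr Bc; fe.
have [c hc] := fib_surj Bb zy.
exists (fun js => c js.1 * cone F js.2); split.
  move=> i /=; case: (leqP (e i) p) => h.
    by rewrite subSn //; apply: (Z_scale (c i)); exact: Z_one.
  by have -> : (p.+1 - e i = 0)%N; [lia|exact: K_0].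
by apply: B_ext hc => s hs; rewrite /fsub th_c.
Qed.

Lemma LH_inj p (x : 'I_r -> seq T -> F) : (forall i, K B (p.+1 - e i) (cob (x i))) ->
  Bc WB p (fun s => \sum_(i < r) cup (pull q (x i)) (z i) s) -> forall i, Bc B (p - e i) (x i).
Proof.
move=> zx bx i; have [ij _] := LH_comp p.
have [||y hy] := ij (fun js => x js.1 js.2); [by []|by []|].
by exists (fun s => y (i, s)); exact: (hy i).
Qed.

Lemma LH_surj p y : Zc WB p y -> exists x : 'I_r -> seq T -> F,
  (forall i, K B (p.+1 - e i) (cob (x i))) /\
  Bc WB p (fsub y (fun s => \sum_(i < r) cup (pull q (x i)) (z i) s)).
Proof.
move=> zy; have [_ sj] := LH_comp p; have [x [zx bx]] := sj y zy.
by exists (fun i s => x (i, s)).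
Qed.

End LH.

Section VB.
Variables (T U : cpm) (q : U -> T) (W : U -> Prop) (B : T -> Prop).
Hypotheses (cq : cont q) (cW : closed W) (cB : closed B).
Hypothesis fib : forall b, B b -> acyclic F (fun u => W u /\ ptset b (q u)).
Let WB := fun u => W u /\ B (q u).

Let zc (i : 'I_1) := @cone F U.
Let e1 (i : 'I_1) := 0%N.
Let zpure i : pure (e1 i) (zc i).
Proof. by move=> -[|x [|y s]]. Qed.
Let zcoc i p : K W p (cob (zc i)).
Proof. by apply: K_le (Z_one char2 W p). Qed.
Let fs b p y : B b -> Zc (fun u => W u /\ ptset b (q u)) p y ->
  exists c : 'I_1 -> F, Bc (fun u => W u /\ ptset b (q u)) p (fsub y (fun s => \sum_(i < 1) c i * zc i s)).
Proof.
move=> Bb /(proj2 (fib Bb)) [c hc]; exists (fun _ => c); apply: B_ext hc => s _.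
by rewrite /fsub big_ord_recl big_ord0 addr0.
Qed.
Let fi b p (c : 'I_1 -> F) : B b -> Bc (fun u => W u /\ ptset b (q u)) p (fun s => \sum_(i < 1) c i * zc i s) ->
  forall i, (e1 i < p)%N -> c i = 0.
Proof.
move=> Bb h i p0; have [[u hu] _] := fib Bb; apply: (pt_inj (A := fun u => W u /\ ptset b (q u)) hu p0).
apply: B_ext h => s _; rewrite big_ord_recl big_ord0 addr0 /fscale.
by rewrite (ord1 i) (_ : ord0 = 0 :> 'I_1).
Qed.

(** The Vietoris-Begle theorem is Leray-Hirsch with the single class 1, since the fibres have the
    cohomology of a point. *)
Lemma VB_inj p (x : seq T -> F) : Zc B p x -> Bc WB p (pull q x) -> Bc B p x.
Proof.
move=> zx bx; rewrite -(subn0 p).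
apply: (LH_inj cq cW cB zpure zcoc fs fi (x := fun _ => x)) (ord0 : 'I_1); first by move=> i; rewrite subn0.
have E s (hs : (0 < size s)%N) : pull q x s = \sum_(i < 1) cup (pull q x) (zc i) s.
  by rewrite big_ord_recl big_ord0 addr0 cup1r //; case: s hs.
exact: (B_ext E bx).
Qed.

Lemma VB_surj p (y : seq U -> F) : Zc WB p y -> exists x : seq T -> F, Zc B p x /\ Bc WB p (fsub y (pull q x)).
Proof.
move=> /(LH_surj cq cW cB zpure zcoc fs fi) [x [zx bx]]; exists (x ord0); split.
  by have := zx ord0; rewrite subn0.
apply: B_ext bx => s hs; rewrite /fsub big_ord_recl big_ord0 addr0 cup1r //; by case: s hs.
Qed.

Lemma VB_acyclic : acyclic F B -> acyclic F WB.
Proof.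
move=> [[b Bb] h]; split.
  have [[u [wu pu]] _] := fib Bb; exists u; split=> //; exact: closed_pt_sub pu.
move=> p y /VB_surj [x [/h [c hc] bx]]; exists c.
apply: B_trans bx _.
have cqB u : WB u -> B (q u) by case.
have := B_pull cq cqB hc; congr Bc; apply: functional_extensionality => s.
by rewrite /pull /fsub /fscale -(pull_cone q).
Qed.
End VB.

Section Suspension.
Variables (T : cpm).

(* [deg1 A j w]: the classes 1 (degree 0) and w (degree j) form a basis of the cohomology of A. *)
Definition deg1 (A : T -> Prop) (j : nat) (w : seq T -> F) :=
  (forall p x, Zc A p x -> exists a b, Bc A p (fsub x (fadd (fscale a (@cone F T)) (fscale b w)))) /\
  (forall p a b, (j < p)%N -> Bc A p (fadd (fscale a (@cone F T)) (fscale b w)) -> a = 0 /\ b = 0).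

(** The 0-sphere: a cocycle with values a at x1 and b at x2 is a + (b - a) w up to a coboundary. *)
Lemma two_points (x1 x2 : T) (w : seq T -> F) : (0 < dist x1 x2)%Re ->
  (forall p, K (ptset x1) p w) -> (forall p, K (ptset x2) p (fsub w (@cone F T))) ->
  deg1 (fun t => ptset x1 t \/ ptset x2 t) 0 w.
Proof.
move=> d12 w1 w2; set A := fun t => _.
have s1 t : ptset x1 t -> A t by left.
have s2 t : ptset x2 t -> A t by right.
split=> [p x zx|p a b p0 hb].
  have [y1 h1] := pt_class char2 (Z_mono s1 zx); set a := x [:: x1] in h1.
  have [y2 h2] := pt_class char2 (Z_mono s2 zx); set b := x [:: x2] in h2.
  have e : K (fun t => ptset x1 t /\ ptset x2 t) p (fsub y1 y2).
    apply: K_mono (K_emp p (fsub y1 y2)) => t [h h'].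
    have := dist_tri x1 t x2; rewrite h (dist_sym t) h'; lra.
  have [k [k1 k2]] := K_I (closed_pt (b := x1)) (closed_pt (b := x2)) e.
  exists a, (b - a), (fsub y1 k); apply: K_U.
    have := K_sub (K_sub h1 (K_scale (b - a) (w1 p))) (K_sub (K_z F _ p) (K_le (leqnSn p) (K_d k1))).
    by rewrite cob_sub; congr K; fe.
  have := K_sub (K_sub h2 (K_scale (b - a) (w2 p))) (K_le (leqnSn p) (K_d k2)).
  by rewrite !cob_sub; congr K; fe.
have ev c : A c -> a + b * w [:: c] = 0.
  move=> Ac; have [y [d [d0 hd]]] := hb.
  have := hd [:: c]; rewrite /fsub /fadd /fscale /= mulr1 subr0; apply => //.
  by exists c; split=> // z [<-|//]; rewrite dist_refl.
have sm c : small (ptset c) 1 [:: c].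
  by exists c; split=> [|z [<-|//]]; rewrite /ptset dist_refl //; lra.
have v1 : w [:: x1] = 0.
  have [d [d0 hd]] := w1 1%N; apply: hd => //.
  by exists x1; split=> [|z [<-|//]]; rewrite /ptset dist_refl.
have v2 : w [:: x2] = 1.
  have [d [d0 hd]] := w2 1%N; apply/eqP; rewrite -subr_eq0; apply/eqP; apply: (hd [:: x2]) => //.
  by exists x2; split=> [|z [<-|//]]; rewrite /ptset dist_refl.
have e1 := ev x1 (s1 _ (dist_refl _)); have e2 := ev x2 (s2 _ (dist_refl _)).
rewrite v1 mulr0 addr0 in e1; rewrite v2 e1 mulr1 add0r in e2; by [].
Qed.

(** Mayer-Vietoris for two acyclic pieces: as u has primitives n1 and n2 on them, it is the image of
    n1 - n2 under the connecting map, which raises the degree by one. Constants on the pieces agree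
    because the pieces meet. *)
Lemma suspension (A1 A2 : T -> Prop) j u n1 n2 : closed A1 -> closed A2 ->
  acyclic F A1 -> acyclic F A2 -> (exists t, A1 t /\ A2 t) ->
  (forall p, K A1 p (fsub u (cob n1))) -> (forall p, K A2 p (fsub u (cob n2))) ->
  deg1 (fun t => A1 t /\ A2 t) j (fsub n1 n2) ->
  deg1 (fun t => A1 t \/ A2 t) j.+1 u.
Proof.
move=> c1 c2 [_ ac1] [_ ac2] [t0 [t1 t2]] un1 un2 [sj ij].
set A := fun t => _ \/ _; set A12 := fun t => _ /\ _ in sj ij.
have s1 t : A1 t -> A t by left.
have s2 t : A2 t -> A t by right.
have m1 t : A12 t -> A1 t by case.
have m2 t : A12 t -> A2 t by case.
split=> [[|p] x zx|p a b jp hb].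
- by exists 0, 0, (@fzero F _); exact: K_0.
- have [c1' [y1 h1]] := ac1 _ _ (Z_mono s1 zx); have [c2' [y2 h2]] := ac2 _ _ (Z_mono s2 zx).
  have ec : c1' = c2'.
    apply/eqP; rewrite -subr_eq0; apply/eqP.
    have A0 : A12 t0 by [].
    apply: (pt_inj A0 (ltn0Sn p)); exists (fsub y2 y1); rewrite cob_sub.
    have := K_sub (K_mono m2 h2) (K_mono m1 h1); congr K; fe.
  rewrite -{}ec {c2'} in h2; set c := c1' in h1 h2.
  have zy : Zc A12 p (fsub y1 y2).
    rewrite /Zc cob_sub; have := K_sub (K_mono m2 h2) (K_mono m1 h1); congr K; fe.
  have [a [b [chi hchi]]] := sj _ _ zy.
  have [k [k1 k2]] := K_I c1 c2 hchi.
  have one q B : K B q (cob (@cone F T)) by apply: K_le (Z_one char2 B q).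
  exists c, b, (fsub (fsub (fsub y1 (fscale b n1)) (fscale a (@cone F T))) k).
  rewrite !cob_sub !cob_scale; apply: K_U.
    have := K_add (K_sub h1 (K_scale b (un1 p.+1))) (K_add (K_scale a (one p.+1 A1)) (K_d k1)).
    by congr K; fe.
  have := K_sub (K_sub h2 (K_scale b (un2 p.+1))) (K_d k2).
  by rewrite !cob_sub cob_cob // !cob_add !cob_scale !cob_sub; congr K; fe.
- have u1 : Bc A1 p u by exists n1.
  have a0 : a = 0.
    have p0 : (0 < p)%N by lia.
    apply: (pt_inj t1 p0).
    have := B_sub (B_mono s1 hb) (B_scale b u1); congr Bc; fe.
  split=> //; case: p jp hb u1 => [|p] jp [y hy] u1; first by lia.
  have k1 : Zc A1 p (fsub (fscale b n1) y).
    rewrite /Zc cob_sub cob_scale.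
    have := K_sub (K_mono s1 hy) (K_scale b (un1 p.+1)); congr K; rewrite a0; fe.
  have k2 : Zc A2 p (fsub (fscale b n2) y).
    rewrite /Zc cob_sub cob_scale.
    have := K_sub (K_mono s2 hy) (K_scale b (un2 p.+1)); congr K; rewrite a0; fe.
  have [d1 h1] := ac1 _ _ k1; have [d2 h2] := ac2 _ _ k2.
  have [] := ij p (d2 - d1) b _ _ => //.
  have := B_sub (B_mono m1 h1) (B_mono m2 h2); congr Bc; fe.
Qed.
End Suspension.

End LerayHirsch.

(** * Intervals, products and covers *)

Section Intervals.

Lemma Rabs_eq_0 x : Rabs x = 0%Re -> x = 0%Re.
Proof. by move=> h; apply: NNPP => /Rabs_no_R0. Qed.

(** A supremum argument, used both for the compactness of the interval and for gluing cohomology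
    along it. *)
Lemma interval_ind (P : R -> R -> Prop) (a b : R) : (a <= b)%Re ->
  (forall x, (a <= x <= b)%Re -> exists e, (0 < e)%Re /\
     forall u v, (a <= u)%Re -> (u <= v)%Re -> (v <= b)%Re -> (x - e < u)%Re -> (v < x + e)%Re -> P u v) ->
  (forall u w v, (a <= u)%Re -> (u <= w)%Re -> (w <= v)%Re -> (v <= b)%Re -> P u w -> P w v -> P u v) ->
  P a b.
Proof.
move=> ab loc tr.
pose E v := (a <= v <= b)%Re /\ P a v.
have Ea : E a.
  split; first lra.
  by have [|e [e0 he]] := loc a; [lra|apply: he; lra].
have [|s [ub lub]] := completeness E _ (ex_intro _ a Ea).
  by exists b => v [[]].
have as_ : (a <= s)%Re by exact: ub.
have sb : (s <= b)%Re by apply: lub => v [[]].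
have [|e [e0 he]] := loc s; first lra.
have [v [[[av vb] Pav] hv]] : exists v, E v /\ (s - e < v)%Re.
  apply: NNPP => n; have : (s <= s - e)%Re.
    apply: lub => v Ev; apply: Rnot_lt_le => h; apply: n; by exists v.
  lra.
have vs : (v <= s)%Re by apply: ub.
pose s' := Rmin b (s + e / 2)%Re.
have m1 := Rmin_l b (s + e / 2)%Re; have m2 := Rmin_r b (s + e / 2)%Re.
have s's : (v <= s')%Re by apply: Rmin_glb; lra.
have Ps' : P a s'.
  apply: (tr a v s') => //; first lra.
  by apply: he => //; rewrite /s'; lra.
have s'E : E s' by split=> //; split=> //; lra.
have := ub s' s'E; rewrite /s'; move: Ps'; rewrite /s' /Rmin; case: Rle_dec => // h1 _ h2; lra.
Qed.

(** This retraction makes all of R a model of [-1, 1], so that real functions are maps into a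
    compact space without subtypes. *)
Definition clamp (x : R) : R := Rmax (-1) (Rmin x 1).

Lemma clamp_bd x : (-1 <= clamp x <= 1)%Re.
Proof.
rewrite /clamp; split; first exact: Rmax_l.
by apply: Rmax_lub; [lra|exact: Rmin_r].
Qed.

Lemma clamp_id x : (-1 <= x <= 1)%Re -> clamp x = x.
Proof. by move=> h; rewrite /clamp Rmin_left ?Rmax_right //; lra. Qed.

Lemma clamp_cases x : (x <= -1 /\ clamp x = -1 \/ 1 <= x /\ clamp x = 1 \/ -1 <= x <= 1 /\ clamp x = x)%Re.
Proof.
case: (Rle_dec x (-1)) => h1; first by left; split=> //; rewrite /clamp Rmin_left ?Rmax_left //; lra.
case: (Rle_dec 1 x) => h2; first by right; left; split=> //; rewrite /clamp Rmin_right ?Rmax_right //; lra.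
by right; right; split; [lra|apply: clamp_id; lra].
Qed.

Lemma clamp_lip x y : (Rabs (clamp x - clamp y) <= Rabs (x - y))%Re.
Proof.
case: (clamp_cases x) => [[? ->]|[[? ->]|[? ->]]]; case: (clamp_cases y) => [[? ->]|[[? ->]|[? ->]]];
  split_Rabs; lra.
Qed.

Lemma clamp_cpm_compact (r : R -> R) : (forall x, (0 < r x)%Re) ->
  exists s : list R, forall y, exists x, List.In x s /\ (Rabs (clamp x - clamp y) < r x)%Re.
Proof.
move=> r0.
pose P u v := exists s : list R, forall y, (u <= y <= v)%Re ->
  exists x, List.In x s /\ (Rabs (clamp x - y) < r x)%Re.
have [|||s hs] := @interval_ind P (-1) 1; first lra.
- move=> x hx; exists (r x); split=> // u v h1 h2 h3 h4 h5; exists [:: x] => y hy.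
  exists x; split; first by left.
  by rewrite clamp_id //; apply: Rabs_def1; lra.
- move=> u w v h1 h2 h3 h4 [s1 hs1] [s2 hs2]; exists (s1 ++ s2) => y hy.
  case: (Rle_dec y w) => h.
    by have [|x [xs hx]] := hs1 y; [lra|exists x; split=> //; apply: List.in_or_app; left].
  by have [|x [xs hx]] := hs2 y; [lra|exists x; split=> //; apply: List.in_or_app; right].
by exists s => y; have [|x hx] := hs (clamp y); [exact: clamp_bd|exists x].
Qed.

Definition clampR : cpm.
Proof.
refine (@Cpm R (fun x y => Rabs (clamp x - clamp y)) _ _ _ clamp_cpm_compact).
- by move=> x; rewrite Rminus_diag Rabs_R0.
- by move=> x y; exact: Rabs_minus_sym.
- move=> x y z; have := Rabs_triang (clamp x - clamp y) (clamp y - clamp z).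
  by have -> : (clamp x - clamp y + (clamp y - clamp z) = clamp x - clamp z)%Re by lra.
Defined.

Definition Iv (u v : R) : clampR -> Prop := fun y => (u <= clamp y <= v)%Re.

Lemma closed_Iv u v : closed (Iv u v).
Proof.
move=> x nx; rewrite /Iv in nx.
case: (Rlt_dec (clamp x) u) => h.
  exists (u - clamp x)%Re; split; first lra.
  by move=> y /Rabs_def2 /=; rewrite /Iv; lra.
exists (clamp x - v)%Re; split; first lra.
by move=> y /Rabs_def2 /=; rewrite /Iv; lra.
Qed.

Variable F : fieldType.
Hypothesis char2 : forall x : F, x + x = 0.
Local Ltac fe := apply: functional_extensionality => ?; rewrite /fsub /fadd /fscale /fzero; ring.

(** Evaluation at a common point gives c1 = c2. The primitives then differ on the intersection by a
    cocycle, that is, by a constant plus a coboundary, and both are absorbed before gluing. *)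
Lemma glue_const (T : cpm) (A1 A2 : T -> Prop) p (x : seq T -> F) c1 c2 :
  closed A1 -> closed A2 -> acyclic F (fun t => A1 t /\ A2 t) ->
  Bc A1 p (fsub x (fscale c1 (@cone F T))) -> Bc A2 p (fsub x (fscale c2 (@cone F T))) ->
  exists c, Bc (fun t => A1 t \/ A2 t) p (fsub x (fscale c (@cone F T))).
Proof.
pose A12 := fun t => A1 t /\ A2 t.
move=> cl1 cl2 [[t0 At0] ac]; rewrite -/A12 in ac; have {}At0 : A12 t0 by [].
case: p => [|p] [y1 h1] [y2 h2]; first by exists 0, (@fzero F _); exact: K_0.
have m1 t : A12 t -> A1 t by case.
have m2 t : A12 t -> A2 t by case.
have ec : c1 = c2.
  apply/eqP; rewrite -subr_eq0; apply/eqP.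
  apply: (pt_inj At0 (ltn0Sn p)); exists (fsub y2 y1); rewrite cob_sub.
  have := K_sub (K_mono m2 h2) (K_mono m1 h1); congr K; fe.
rewrite -ec {c2 ec} in h2; exists c1.
have zy : Zc A12 p (fsub y1 y2).
  rewrite /Zc cob_sub; have := K_sub (K_mono m2 h2) (K_mono m1 h1); congr K; fe.
have [a [chi hchi]] := ac _ _ zy.
have [k [k1 k2]] := K_I cl1 cl2 hchi.
have one q B : K B q (cob (@cone F T)) by apply: K_le (Z_one char2 B q).
exists (fsub (fsub y1 (fscale a (@cone F T))) k).
rewrite !cob_sub !cob_scale; apply: K_U.
  have := K_add h1 (K_add (K_scale a (one p.+1 A1)) (K_d k1)).
  by congr K; fe.
have := K_sub h2 (K_d k2).
by rewrite !cob_sub cob_cob // !cob_scale; congr K; fe.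
Qed.

Lemma acyclic_Iv u v : (-1 <= u)%Re -> (u <= v)%Re -> (v <= 1)%Re -> acyclic F (Iv u v).
Proof.
move=> hu huv hv; split; first by exists u; rewrite /Iv clamp_id; lra.
move=> p x zx.
pose P a b := exists c, Bc (Iv a b) p (fsub x (fscale c (@cone F clampR))).
apply: (@interval_ind P u v) => // [w hw|a w b h1 h2 h3 h4 [c1 hc1] [c2 hc2]].
  have [|y [e [e0 he]]] := @pt_class F char2 clampR w p x.
    apply: Z_mono zx => t; rewrite /ptset /Iv /= => /Rabs_eq_0; rewrite (clamp_id (x := w)); lra.
  exists (e / 2)%Re; split; first lra.
  move=> a b h1 h2 h3 h4 h5; exists (x [:: w]), y; exists (e / 2)%Re; split; first lra.
  move=> s hs [t [ht hs']]; apply: he => //; exists w; split; first exact: dist_refl.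
  move=> z /hs' hz; have := dist_tri (w : clampR) t z.
  have : (dist (w : clampR) t < e / 2)%Re.
    by rewrite /=; apply: Rabs_def1; rewrite (clamp_id (x := w)) /Iv in ht *; lra.
  lra.
have [|c hc] := glue_const (@closed_Iv a w) (@closed_Iv w b) _ hc1 hc2.
  apply: (@acyclic_pt _ char2 clampR w) => t; rewrite /Iv /ptset /=.
  rewrite (clamp_id (x := w)); last lra.
  split; first by move=> h; rewrite (_ : (w - clamp t = 0)%Re) ?Rabs_R0 //; lra.
  by move/Rabs_eq_0; lra.
by exists c; apply: B_mono hc => t; rewrite /Iv; case: (Rle_dec (clamp t) w) => h; [left|right]; lra.
Qed.

End Intervals.

Section Products.

Definition rcont (T : cpm) (g : T -> R) := forall u e, (0 < e)%Re ->
  exists d, (0 < d)%Re /\ forall v, (dist u v < d)%Re -> (Rabs (g u - g v) < e)%Re.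

Lemma closed_le (T : cpm) (g : T -> R) c : rcont g -> closed (fun t => (g t <= c)%Re).
Proof.
move=> cg x /Rnot_le_lt h; have [|d [d0 hd]] := cg x (g x - c)%Re; first lra.
by exists d; split=> // y /hd /Rabs_def2; lra.
Qed.

Lemma closed_ge (T : cpm) (g : T -> R) c : rcont g -> closed (fun t => (c <= g t)%Re).
Proof.
move=> cg x /Rnot_le_lt h; have [|d [d0 hd]] := cg x (c - g x)%Re; first lra.
by exists d; split=> // y /hd /Rabs_def2; lra.
Qed.

Lemma closed_eq (T : cpm) (g : T -> R) c : rcont g -> closed (fun t => g t = c).
Proof.
move=> cg; apply: closed_ext (closedI (closed_le (c := c) cg) (closed_ge (c := c) cg)).
by move=> x; lra.
Qed.

Lemma rcont_clamp (T : cpm) (g : T -> R) : rcont g -> @cont clampR T g.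
Proof.
move=> cg u e e0; have [d [d0 hd]] := cg u e e0; exists d; split=> // v /hd h.
by apply: Rle_lt_trans h; exact: clamp_lip.
Qed.

(** Turns pointwise non-orthogonality into the uniform bound that the comparison of Chern classes
    requires. *)
Lemma rcont_lower (T : cpm) (Y : T -> Prop) (I : Type) (l : list I) (g : I -> T -> R) :
  (forall i, rcont (g i)) -> closed Y ->
  (forall y, Y y -> exists i, List.In i l /\ (0 < g i y)%Re) ->
  exists c, (0 < c)%Re /\ forall y, Y y -> exists i, List.In i l /\ (c <= g i y)%Re.
Proof.
move=> cg cY pos.
pose Q (A : T -> Prop) := exists c, (0 < c)%Re /\ forall y, A y -> exists i, List.In i l /\ (c <= g i y)%Re.
apply: (@compact_ind T Y Q cY).
- by move=> B B' h [c [c0 hc]]; exists c; split=> // y /h /hc.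
- by exists 1%Re; split; [lra|].
- move=> B B' _ _ _ _ [c [c0 hc]] [c' [c0' hc']]; exists (Rmin c c'); split; first exact: Rmin_glb_lt.
  move=> y [/hc|/hc'] [i [il hi]]; exists i; split=> //.
    by have := Rmin_l c c'; lra.
  by have := Rmin_r c c'; lra.
- move=> b /pos [i [il hi]]; have [|d [d0 hd]] := cg i b (g i b / 2)%Re; first lra.
  exists (d / 2)%Re; split; first lra.
  exists (g i b / 2)%Re; split; first lra.
  move=> y [_ hy]; exists i; split=> //.
  have /hd /Rabs_def2 : (dist b y < d)%Re by rewrite /cball in hy; lra.
  lra.
Qed.

Variables T U : cpm.

Lemma prod_compact (r : T * U -> R) : (forall x, (0 < r x)%Re) ->
  exists s : list (T * U), forall y, exists x, List.In x s /\
    (Rmax (dist x.1 y.1) (dist x.2 y.2) < r x)%Re.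
Proof.
move=> r0.
pose P t d := exists s : list U, forall v, exists u, List.In u s /\ (dist u v < r (t, u))%Re /\ (d <= r (t, u))%Re.
have [|l [d [hd hl]]] := @compact_choice T P.
  move=> t; have [|s hs] := @cpm_compact U (fun u => r (t, u)); first by [].
  have [d [d0 hd]] := @min_pos U (fun u => r (t, u)) s (fun u => r0 (t, u)).
  exists d; split=> //; exists s => v; have [u [us hu]] := hs v; exists u; do !split=> //; exact: hd.
have hP t : exists s : list U, forall v, exists u, List.In u s /\ (dist u v < r (t, u))%Re /\ (d t <= r (t, u))%Re.
  exact: (proj2 (hd t)).
pose s t := proj1_sig (constructive_indefinite_description _ (hP t)).
have hs t : forall v, exists u, List.In u (s t) /\ (dist u v < r (t, u))%Re /\ (d t <= r (t, u))%Re.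
  by rewrite /s; case: constructive_indefinite_description.
exists (List.flat_map (fun t => List.map (fun u => (t, u)) (s t)) l) => -[t' u'].
have [t [tl ht]] := hl t'; have [u [us [h1 h2]]] := hs t u'.
exists (t, u); split.
  by apply/List.in_flat_map; exists t; split=> //; apply: List.in_map.
by apply: Rmax_lub_lt => //=; lra.
Qed.

Definition prodc : cpm.
Proof.
refine (@Cpm (T * U)%type (fun x y => Rmax (dist x.1 y.1) (dist x.2 y.2)) _ _ _ prod_compact).
- by move=> x; rewrite !dist_refl Rmax_left //; lra.
- by move=> x y; rewrite (dist_sym x.1) (dist_sym x.2).
- move=> x y z; have h1 := dist_tri x.1 y.1 z.1; have h2 := dist_tri x.2 y.2 z.2.
  have m1 := Rmax_l (dist x.1 y.1) (dist x.2 y.2); have m2 := Rmax_r (dist x.1 y.1) (dist x.2 y.2).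
  have m3 := Rmax_l (dist y.1 z.1) (dist y.2 z.2); have m4 := Rmax_r (dist y.1 z.1) (dist y.2 z.2).
  apply: Rmax_lub; lra.
Defined.

Lemma cont_fst : @cont T prodc fst.
Proof. by move=> u e e0; exists e; split=> // v; apply: Rle_lt_trans; exact: Rmax_l. Qed.
Lemma cont_snd : @cont U prodc snd.
Proof. by move=> u e e0; exists e; split=> // v; apply: Rle_lt_trans; exact: Rmax_r. Qed.

End Products.

Lemma cont_id (T : cpm) : @cont T T id.
Proof. by move=> u e e0; exists e. Qed.

Lemma cont_pair (S T U : cpm) (f : U -> S) (g : U -> T) : cont f -> cont g -> @cont (prodc S T) U (fun u => (f u, g u)).
Proof.
move=> cf cg u e e0; have [d [d0 hd]] := cf u e e0; have [d' [d0' hd']] := cg u e e0.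
exists (Rmin d d'); split; first exact: Rmin_glb_lt.
move=> v hv; apply: Rmax_lub_lt; [apply: hd|apply: hd']; apply: Rlt_le_trans hv _; [exact: Rmin_l|exact: Rmin_r].
Qed.

Lemma cont_const (T U : cpm) (c : T) : @cont T U (fun _ => c).
Proof. by move=> u e e0; exists 1%Re; split; [lra|move=> v _; rewrite dist_refl]. Qed.

Lemma rcont_add (T : cpm) (f g : T -> R) : rcont f -> rcont g -> rcont (fun t => f t + g t)%Re.
Proof.
move=> cf cg u e e0; have [|d [d0 hd]] := cf u (e / 2)%Re; first lra.
have [|d' [d0' hd']] := cg u (e / 2)%Re; first lra.
exists (Rmin d d'); split; first exact: Rmin_glb_lt.
move=> v hv.
have /hd /Rabs_def2 h1 : (dist u v < d)%Re by apply: Rlt_le_trans hv _; exact: Rmin_l.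
have /hd' /Rabs_def2 h2 : (dist u v < d')%Re by apply: Rlt_le_trans hv _; exact: Rmin_r.
by apply: Rabs_def1; lra.
Qed.

Section CoverProducts.
Variable F : fieldType.
Hypothesis char2 : forall x : F, x + x = 0.
Variable T : cpm.

Definition cprod (l : seq (seq T -> F)) : seq T -> F := foldr (@cup F T) (@cone F T) l.

Lemma Z_cprod (A : T -> Prop) (l : seq (seq T -> F)) :
  (forall x, List.In x l -> forall q, K A q (cob x)) -> forall q, K A q (cob (cprod l)).
Proof.
elim: l => [|x l IH] h q; first by apply: K_le (Z_one char2 A q).
apply: (Z_cup char2); first by move=> q'; apply: h; left.
by apply: IH => y hy; apply: h; right.
Qed.

Lemma cprod_cover (I : Type) (l : seq I) (x : I -> seq T -> F) (A : T -> Prop) (C : I -> T -> Prop) p :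
  (forall i q, K A q (cob (x i))) ->
  (forall i, Bc (fun t => A t /\ C i t) p (x i)) ->
  (forall t, A t -> exists i, List.In i l /\ C i t) ->
  Bc A p (cprod (map x l)).
Proof.
elim: l A => [|i l IH] A zx bx cov.
  by apply: B_mono (B_K (K_emp p (cprod [::]))) => t /cov [i []].
apply: (@B_cup_cover F char2 T A (fun t => A t /\ C i t)
  (fun t => A t /\ exists j, List.In j l /\ C j t)).
- move=> t At; have [j [[<-|jl] hj]] := cov t At; first by left.
  by right; split=> //; exists j.
- exact: zx.
- by apply: Z_cprod => y /in_map_iff [j [<- _]]; exact: zx.
- exact: bx.
apply: IH => [j q|j|t [] //]; first by apply: K_mono (zx j q) => t [].
by apply: B_mono (bx j) => t [[]].
Qed.

End CoverProducts.

(** * Unit vectors and lines *)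

Section Hermitian.
Local Close Scope ring_scope.
Local Open Scope R_scope.
Variable m : nat.

Fixpoint hdotn (k : nat) (u v : cvec) : C :=
  match k with O => RtoC 0 | S p => Cplus (hdotn p u v) (Cmult (u p) (Cconj (v p))) end.
Definition hdot := hdotn m.
Notation N2 := (norm2 m).

Lemma Ceq (a b : C) : fst a = fst b -> snd a = snd b -> a = b.
Proof. by case: a => ? ?; case: b => ? ? /= -> ->. Qed.

Lemma hdot_addl u v w : hdot (vadd u v) w = (hdot u w + hdot v w)%C.
Proof.
rewrite /hdot; elim: m => [|k IH]; first by rewrite /= Cplus_0_l.
by rewrite /= IH /vadd -[Cadd _ _]/(Cplus _ _); sring.
Qed.

Lemma hdot_scalel c u w : hdot (vscale c u) w = (c * hdot u w)%C.
Proof.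
rewrite /hdot; elim: m => [|k IH]; first by rewrite /= Cmult_0_r.
by rewrite /= IH /vscale -[Cmul _ _]/(Cmult _ _); sring.
Qed.

Lemma hdot_conj u v : hdot u v = Cconj (hdot v u).
Proof.
rewrite /hdot; elim: m => [|k IH]; first by rewrite /=; apply: Ceq => /=; lra.
by rewrite /= IH Cplus_conj Cmult_conj Cconj_conj; sring.
Qed.

Lemma hdot_addr u v w : hdot w (vadd u v) = (hdot w u + hdot w v)%C.
Proof. by rewrite hdot_conj hdot_addl Cplus_conj -!hdot_conj. Qed.

Lemma hdot_scaler c u w : hdot w (vscale c u) = (Cconj c * hdot w u)%C.
Proof. by rewrite hdot_conj hdot_scalel Cmult_conj -hdot_conj. Qed.

Lemma hdot_self u : hdot u u = RtoC (N2 u).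
Proof.
rewrite /hdot; elim: m => [|k IH] //=.
by rewrite IH; apply: Ceq; rewrite /= /Cnorm2; sring.
Qed.

Lemma norm2_ge0 k u : 0 <= norm2 k u.
Proof.
elim: k => [|k IH] /=; first lra.
by have : 0 <= Cnorm2 (u k); [rewrite /Cnorm2; nra|lra].
Qed.

Lemma norm2E u : N2 u = fst (hdot u u).
Proof. by rewrite hdot_self. Qed.

Lemma Cnorm2_ge0 c : 0 <= Cnorm2 c.
Proof. by rewrite /Cnorm2; nra. Qed.

Lemma Cnorm2_mult a b : Cnorm2 (a * b)%C = Cnorm2 a * Cnorm2 b.
Proof. by rewrite /Cnorm2 /=; sring. Qed.

Lemma Cnorm2_conj a : Cnorm2 (Cconj a) = Cnorm2 a.
Proof. by rewrite /Cnorm2 /=; sring. Qed.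

Lemma Cmod_sqr c : Cmod c * Cmod c = Cnorm2 c.
Proof. by rewrite /Cmod sqrt_sqrt /Cnorm2; [sring|nra]. Qed.

Lemma Cnorm2_sym u v : Cnorm2 (hdot u v) = Cnorm2 (hdot v u).
Proof. by rewrite hdot_conj Cnorm2_conj. Qed.

Lemma norm2_comb u c v :
  N2 (vadd u (vscale c v)) = N2 u + Cnorm2 c * N2 v + 2 * fst (Cconj c * hdot u v)%C.
Proof.
rewrite !norm2E hdot_addl !hdot_addr hdot_scalel !hdot_scaler hdot_scalel.
by rewrite (hdot_conj v u) !hdot_self /Cnorm2 /=; sring.
Qed.

Lemma CS u v : Cnorm2 (hdot u v) <= N2 u * N2 v.
Proof.
have key x y : 0 <= N2 y * (N2 x * N2 y - Cnorm2 (hdot x y)).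
  have := norm2_ge0 m (vadd (vscale (RtoC (N2 y)) x) (vscale (- hdot x y)%C y)).
  rewrite norm2_comb hdot_scalel.
  have -> : N2 (vscale (RtoC (N2 y)) x) = N2 y * N2 y * N2 x.
    by rewrite norm2E hdot_scalel hdot_scaler hdot_self /=; sring.
  rewrite /Cnorm2 /=; set a := fst _; set b := snd _; set n := N2 y; set n' := N2 x.
  by move=> h; apply: Rle_trans h _; right; sring.
have h1 := key u v; have h2 := key v u; rewrite (Cnorm2_sym v u) in h2.
have n1 := norm2_ge0 m u; have n2 := norm2_ge0 m v.
case: (Req_dec (N2 v) 0) => [e|ne]; last by nra.
case: (Req_dec (N2 u) 0) => [e'|ne]; last by nra.
have := norm2_ge0 m (vadd u (vscale (- hdot u v)%C v)).
by rewrite norm2_comb e e' /Cnorm2 /=; nra.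
Qed.

Lemma vnorm_ge0 u : 0 <= vnorm m u.
Proof. exact: sqrt_pos. Qed.

Lemma vnorm_sqr u : vnorm m u * vnorm m u = N2 u.
Proof. by rewrite /vnorm sqrt_sqrt //; exact: norm2_ge0. Qed.

Lemma CSmod u v : Cmod (hdot u v) <= vnorm m u * vnorm m v.
Proof.
apply: Rsqr_incr_0_var; last by apply: Rmult_le_pos; exact: vnorm_ge0.
rewrite /Rsqr Cmod_sqr.
have -> : vnorm m u * vnorm m v * (vnorm m u * vnorm m v) = N2 u * N2 v.
  by rewrite -!vnorm_sqr; sring.
exact: CS.
Qed.

Lemma vnorm_comb u c v : vnorm m (vadd u (vscale c v)) <= vnorm m u + Cmod c * vnorm m v.
Proof.
have p1 := vnorm_ge0 u; have p2 := vnorm_ge0 v; have p3 := Cmod_ge_0 c.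
apply: Rsqr_incr_0_var; last by nra.
rewrite /Rsqr vnorm_sqr norm2_comb -Cmod_sqr -!vnorm_sqr.
have h : fst (Cconj c * hdot u v)%C <= Cmod c * (vnorm m u * vnorm m v).
  have h1 := Rle_abs (fst (Cconj c * hdot u v)%C).
  have h2 := re_le_Cmod (Cconj c * hdot u v)%C.
  rewrite Cmod_mult Cmod_conj /Complex.Re in h2.
  have h3 := Rmult_le_compat_l _ _ _ p3 (CSmod u v); lra.
have -> : (vnorm m u + Cmod c * vnorm m v) * (vnorm m u + Cmod c * vnorm m v) =
  vnorm m u * vnorm m u + Cmod c * Cmod c * (vnorm m v * vnorm m v) + 2 * (Cmod c * (vnorm m u * vnorm m v)).
  by sring.
lra.
Qed.

(** Coordinates of index at least m are unconstrained and invisible to [hdot]. A complex line is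
    represented by any of its unit vectors. *)
Definition uvec := {u : cvec | N2 u = 1}.
Definition uv (u : uvec) : cvec := proj1_sig u.
Definition ip (u v : uvec) : C := hdot (uv u) (uv v).
Definition ov (u v : uvec) : R := Cnorm2 (ip u v).

Lemma uv1 u : N2 (uv u) = 1.
Proof. by case: u. Qed.

Lemma uvn u : vnorm m (uv u) = 1.
Proof. by rewrite /vnorm uv1 sqrt_1. Qed.

Lemma ip_self u : ip u u = RtoC 1.
Proof. by rewrite /ip hdot_self uv1. Qed.

Lemma ip_conj u v : ip u v = Cconj (ip v u).
Proof. exact: hdot_conj. Qed.

Lemma ov_sym u v : ov u v = ov v u.
Proof. exact: Cnorm2_sym. Qed.

Lemma ov_bd u v : 0 <= ov u v <= 1.
Proof.
split; first exact: Cnorm2_ge0.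
by have := CS (uv u) (uv v); rewrite !uv1 Rmult_1_l.
Qed.

Lemma ov_self u : ov u u = 1.
Proof. by rewrite /ov ip_self /Cnorm2 /=; lra. Qed.

Lemma norm2_proj u c v : N2 (vadd (uv u) (vscale (- c)%C (uv v))) = 1 - ov u v + Cnorm2 (c - ip u v)%C.
Proof. by rewrite norm2_comb !uv1 /ov -/(ip u v) /Cnorm2 /=; sring. Qed.

(** The sine of the angle between two complex lines, equal to the distance from u to the line of v;
    it ignores phases. *)
Definition ldist (u v : uvec) : R := sqrt (1 - ov u v).

Lemma ldist_ge0 u v : 0 <= ldist u v.
Proof. exact: sqrt_pos. Qed.

Lemma ldist_sqr u v : ldist u v * ldist u v = 1 - ov u v.
Proof. by rewrite /ldist sqrt_sqrt //; have := ov_bd u v; lra. Qed.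

Lemma ldist_le u v c : ldist u v <= vnorm m (vadd (uv u) (vscale (- c)%C (uv v))).
Proof.
by apply: sqrt_le_1_alt; rewrite norm2_proj; have := Cnorm2_ge0 (c - ip u v)%C; lra.
Qed.

Lemma ldist_proj u v : ldist u v = vnorm m (vadd (uv u) (vscale (- ip u v)%C (uv v))).
Proof.
rewrite /vnorm norm2_proj /ldist; congr sqrt.
by rewrite /Cnorm2 /=; sring.
Qed.

Lemma Cmod_ip u v : Cmod (ip u v) <= 1.
Proof. by have := CSmod (uv u) (uv v); rewrite !uvn Rmult_1_l. Qed.

Lemma hdot_ext u v : (forall w, hdot u w = hdot v w) -> N2 u = N2 v.
Proof. by move=> h; rewrite !norm2E h hdot_conj h -hdot_conj. Qed.

(** The distance from u to the line of w is at most its distance to the point of that line obtained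
    by projecting first to v and then to w. *)
Lemma ldist_tri u v w : ldist u w <= ldist u v + ldist v w.
Proof.
set a := ip u v; set b := ip v w.
apply: Rle_trans (ldist_le u w (a * b)%C) _.
pose x := vadd (uv u) (vscale (- a)%C (uv v)).
pose y := vadd (uv v) (vscale (- b)%C (uv w)).
have -> : vnorm m (vadd (uv u) (vscale (- (a * b))%C (uv w))) = vnorm m (vadd x (vscale a y)).
  rewrite /vnorm; congr sqrt; apply: hdot_ext => t.
  by rewrite /x /y !(hdot_addl, hdot_scalel); sring.
apply: Rle_trans (vnorm_comb _ _ _) _.
rewrite /x /y -!ldist_proj; have := ldist_ge0 v w; have := Cmod_ip u v; rewrite -/a; nra.
Qed.

(** The best a is the phase of the inner product. If c is its modulus, the squared distance is 1 -
    c^2 + (1 - c)^2, and (1 - c)^2 <= 1 - c^2. For c = 0 any phase serves. *)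
Lemma align u v : exists a : C, Cnorm2 a = 1 /\ vnorm m (vadd (uv u) (vscale (- a)%C (uv v))) <= 2 * ldist u v.
Proof.
set i := ip u v; have [z|nz] := Req_dec (Cmod i) 0.
  exists (RtoC 1); split; first by rewrite /Cnorm2 /=; lra.
  have o0 : ov u v = 0 by rewrite /ov -/i -Cmod_sqr z; lra.
  rewrite /ldist o0 Rminus_0_r sqrt_1 /vnorm.
  have -> : 2 * 1 = sqrt (2 * 2) by rewrite sqrt_square; lra.
  apply: sqrt_le_1_alt; rewrite norm2_proj o0 -/i.
  have -> : i = RtoC 0 by exact: Cmod_eq_0.
  by rewrite /Cnorm2 /=; lra.
have p : 0 < Cmod i by have := Cmod_ge_0 i; lra.
exists (RtoC (/ Cmod i) * i)%C; split.
  rewrite Cnorm2_mult -(Cmod_sqr i) /Cnorm2 /=; sfield; lra.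
apply: Rsqr_incr_0_var; last by have := ldist_ge0 u v; lra.
rewrite /Rsqr vnorm_sqr norm2_proj -/i.
have -> : 2 * ldist u v * (2 * ldist u v) = 4 * (ldist u v * ldist u v) by sring.
rewrite ldist_sqr.
have -> : (RtoC (/ Cmod i) * i - i = RtoC (/ Cmod i - 1) * i)%C.
  by rewrite RtoC_minus; sring.
rewrite Cnorm2_mult -(Cmod_sqr i).
have -> : ov u v = Cmod i * Cmod i by rewrite Cmod_sqr.
have c1 : Cmod i <= 1 := Cmod_ip u v.
have -> : Cnorm2 (RtoC (/ Cmod i - 1)) * (Cmod i * Cmod i) = (1 - Cmod i) * (1 - Cmod i).
  by rewrite /Cnorm2 /=; sfield; lra.
nra.
Qed.

End Hermitian.

(** * Compactness of finite sequences and of projective space *)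

Section Sequences.
Variable X : cpm.

(** Total sequences are compared on their first N terms only. All N share one carrier, so forgetting
    terms is the identity function. *)
Fixpoint sdist (N : nat) (f g : nat -> X) : R :=
  if N is N'.+1 then Rmax (sdist N' f g) (dist (f N') (g N')) else 0%Re.

Lemma sdist_refl N f : sdist N f f = 0%Re.
Proof. by elim: N => [|N IH] //=; rewrite IH dist_refl Rmax_left //; lra. Qed.

Lemma sdist_sym N f g : sdist N f g = sdist N g f.
Proof. by elim: N => [|N IH] //=; rewrite IH dist_sym. Qed.

Lemma sdist_tri N f g h : (sdist N f h <= sdist N f g + sdist N g h)%Re.
Proof.
elim: N => [|N IH] /=; first lra.
have h1 := dist_tri (f N) (g N) (h N).
have m1 := Rmax_l (sdist N f g) (dist (f N) (g N)); have m2 := Rmax_r (sdist N f g) (dist (f N) (g N)).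
have m3 := Rmax_l (sdist N g h) (dist (g N) (h N)); have m4 := Rmax_r (sdist N g h) (dist (g N) (h N)).
apply: Rmax_lub; lra.
Qed.

Lemma sdist_coord N f g i : (i < N)%N -> (dist (f i) (g i) <= sdist N f g)%Re.
Proof.
elim: N => [//|N IH]; rewrite ltnS leq_eqVlt => /orP [/eqP ->|/IH h] /=; first exact: Rmax_r.
by apply: Rle_trans h _; exact: Rmax_l.
Qed.

Lemma sdist_lub N f g e : (0 < e)%Re -> (forall i, (i < N)%N -> (dist (f i) (g i) < e)%Re) -> (sdist N f g < e)%Re.
Proof.
move=> e0; elim: N => [//|N IH] h /=; apply: Rmax_lub_lt; last exact: h.
by apply: IH => i hi; apply: h; lia.
Qed.

Lemma sdist_lub0 N f g : (forall i, (i < N)%N -> dist (f i) (g i) = 0%Re) -> sdist N f g = 0%Re.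
Proof.
elim: N => [//|N IH] h /=; rewrite h // IH ?Rmax_left //; last by move=> i hi; apply: h; lia.
lra.
Qed.

Definition upd (f : nat -> X) (N : nat) (x : X) : nat -> X := fun i => if i == N then x else f i.

Lemma sdist_upd N f g x N' : (N <= N')%N -> sdist N (upd f N' x) g = sdist N f g.
Proof.
elim: N => [//|N IH] h /=; rewrite IH; last lia.
by rewrite /upd; case: eqP => [|//]; lia.
Qed.

Variable x0 : X.

Lemma seq_compact N (r : (nat -> X) -> R) : (forall x, (0 < r x)%Re) ->
  exists s : list (nat -> X), forall y, exists x, List.In x s /\ (sdist N x y < r x)%Re.
Proof.
elim: N r => [|N IH] r r0.
  by exists [:: fun _ => x0] => y; exists (fun _ => x0); split; [left|exact: r0].
pose S := @Cpm (nat -> X) (sdist N) (@sdist_refl N) (@sdist_sym N) (@sdist_tri N) IH.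
have [|s hs] := @prod_compact S X (fun fx => r (upd fx.1 N fx.2)); first by [].
exists (List.map (fun fx : S * X => upd fx.1 N fx.2) s) => y.
have [[f x] [fs hf]] := hs (y, y N); exists (upd f N x); split.
  by apply/List.in_map_iff; exists (f, x).
have -> : sdist N.+1 (upd f N x) y = Rmax (sdist N f y) (dist x (y N)).
  by rewrite /= sdist_upd // {1}/upd eqxx.
exact: hf.
Qed.

Definition seqc (N : nat) : cpm :=
  @Cpm (nat -> X) (sdist N) (@sdist_refl N) (@sdist_sym N) (@sdist_tri N) (@seq_compact N).

Lemma cont_coord N i : (i < N)%N -> @cont X (seqc N) (fun f => f i).
Proof.
move=> iN u e e0; exists e; split=> // v; apply: Rle_lt_trans; exact: sdist_coord.
Qed.

Lemma cont_trunc N N' : (N' <= N)%N -> @cont (seqc N') (seqc N) id.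
Proof.
move=> h u e e0; exists e; split=> // v hv; apply: sdist_lub => // i hi.
by apply: Rle_lt_trans (@sdist_coord N u v i _) hv; lia.
Qed.

End Sequences.

Section Lines.
Local Close Scope ring_scope.
Local Open Scope R_scope.
Variable m : nat.
Notation uvec := (uvec m).
Notation vn := (vnorm m).

Definition cube_vec (g : nat -> R) : cvec := fun i => (clamp (g i.*2), clamp (g i.*2.+1)).
Definition cube_of (u : cvec) : nat -> R := fun j => if odd j then snd (u j./2) else fst (u j./2).

Lemma coord_le k u i : (i < k)%nat -> Cnorm2 (u i) <= norm2 k u.
Proof.
elim: k => [|k IH]; first lia.
move=> h /=; have := Cnorm2_ge0 (u k); have := norm2_ge0 k u.
by case: (PeanoNat.Nat.eq_dec i k) => [->|ne]; [lra|have : Cnorm2 (u i) <= norm2 k u by apply: IH; lia]; lra.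
Qed.

Lemma norm2_small k (x y : cvec) r : 0 <= r ->
  (forall i, (i < k)%nat -> Rabs (fst (x i) - fst (y i)) <= r /\ Rabs (snd (x i) - snd (y i)) <= r) ->
  norm2 k (vadd x (vscale (- RtoC 1)%C y)) <= 2 * INR k * (r * r).
Proof.
move=> r0; elim: k => [|k IH] h; first by rewrite /=; lra.
rewrite S_INR [norm2 _ _]/=.
have h1 : norm2 k (vadd x (vscale (- RtoC 1)%C y)) <= 2 * INR k * (r * r) by apply: IH => i hi; apply: h; lia.
have [|h2 h3] := h k; first lia.
have sq t : Rabs t <= r -> t * t <= r * r by move=> ht; have := Rabs_pos t; split_Rabs; nra.
have {}h2 := sq _ h2; have {}h3 := sq _ h3.
have -> : Cnorm2 (vadd x (vscale (- RtoC 1)%C y) k) =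
  (fst (x k) - fst (y k)) * (fst (x k) - fst (y k)) + (snd (x k) - snd (y k)) * (snd (x k) - snd (y k)).
  by rewrite /Cnorm2 /vadd /vscale /Cadd /Cmul /=; sring.
lra.
Qed.

Lemma unit_coord (u : uvec) i : (i < m)%nat ->
  clamp (fst (uv u i)) = fst (uv u i) /\ clamp (snd (uv u i)) = snd (uv u i).
Proof.
move=> h; have := @coord_le m (uv u) i h; rewrite uv1 /Cnorm2 => h1.
by split; apply: clamp_id; nra.
Qed.

Lemma cube_close e : 0 < e -> exists r, 0 < r /\ forall g (u : uvec),
  sdist (X := clampR) m.*2 g (cube_of (uv u)) < r -> vn (vadd (cube_vec g) (vscale (- RtoC 1)%C (uv u))) < e.
Proof.
move=> e0; have im := pos_INR m.
exists (e / (2 * (INR m + 1))); split; first by apply: Rdiv_lt_0_compat; lra.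
set r := e / _ => g u hr.
have r0 : 0 < r by apply: Rdiv_lt_0_compat; lra.
have er : e = r * (2 * (INR m + 1)) by rewrite /r; sfield; lra.
apply: Rsqr_incrst_0; [|exact: vnorm_ge0|lra].
rewrite /Rsqr vnorm_sqr.
apply: Rle_lt_trans (@norm2_small m _ _ r _ _) _; first lra.
  move=> i hi; have [c1 c2] := unit_coord u hi.
  have := @sdist_coord clampR m.*2 g (cube_of (uv u)) i.*2.
  have := @sdist_coord clampR m.*2 g (cube_of (uv u)) i.*2.+1.
  rewrite /cube_of /= odd_double /= uphalf_double doubleK c1 c2 /cube_vec /= => h1 h2.
  rewrite -/(cube_of (uv u)) in h1 h2.
  have {}h1 := h1 _; have {}h2 := h2 _.
  have l1 : (i.*2 < m.*2)%nat by lia.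
  have l2 : (i.*2.+1 < m.*2)%nat by lia.
  by have := h1 l2; have := h2 l1; lra.
rewrite er; nra.
Qed.

Lemma Clin1 (a b : C) : (a + - RtoC 1 * b + RtoC 1 * b = a)%C.
Proof. by sring. Qed.

Lemma Clin2 (a b : C) : (a + - RtoC 1 * (a + - RtoC 1 * b) = b)%C.
Proof. by sring. Qed.

(** Unit vectors are read in the cube of their 2m real coordinates. A point of the cube is either
    itself a unit vector, which then covers its neighbours, or has norm different from 1 and a ball
    free of unit vectors. *)
Lemma line_compact (r : uvec -> R) : (forall x, 0 < r x) ->
  exists s : list uvec, forall y, exists x, List.In x s /\ ldist x y < r x.
Proof.
move=> r0.
pose U := seqc (X := clampR) (0 : R) m.*2.
pose P (g : U) d := (exists t : uvec, forall u : uvec, dist g (cube_of (uv u) : U) < d -> ldist t u < r t) \/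
   (forall u : uvec, ~ dist g (cube_of (uv u) : U) < d).
have [|l [d [hd hl]]] := @compact_choice U P.
  move=> g; case: (Req_dec (vn (cube_vec g)) 1) => h.
    have n1 : norm2 m (cube_vec g) = 1 by rewrite -vnorm_sqr h; lra.
    pose t : uvec := exist _ (cube_vec g) n1.
    have [e [e0 he]] := cube_close (r0 t); exists e; split=> //; left; exists t => u /he hu.
    by apply: Rle_lt_trans hu; exact: ldist_le.
  have p : 0 < Rabs (vn (cube_vec g) - 1) by apply: Rabs_pos_lt; lra.
  have [e [e0 he]] := cube_close p; exists e; split=> //; right=> u /he hu.
  have t1 := @vnorm_comb m (vadd (cube_vec g) (vscale (- RtoC 1)%C (uv u))) (RtoC 1) (uv u).
  have t2 := @vnorm_comb m (cube_vec g) (- RtoC 1)%C (vadd (cube_vec g) (vscale (- RtoC 1)%C (uv u))).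
  rewrite Cmod_opp Cmod_R Rabs_R1 in t2; rewrite Cmod_R Rabs_R1 uvn in t1.
  have e1 : vn (vadd (vadd (cube_vec g) (vscale (- RtoC 1)%C (uv u))) (vscale (RtoC 1) (uv u))) = vn (cube_vec g).
    rewrite /vnorm; congr sqrt; apply: hdot_ext => w; rewrite !hdot_addl !hdot_scalel; exact: Clin1.
  have e2 : vn (vadd (cube_vec g) (vscale (- RtoC 1)%C (vadd (cube_vec g) (vscale (- RtoC 1)%C (uv u))))) = 1.
    transitivity (vn (uv u)); last exact: uvn.
    rewrite /vnorm; congr sqrt; apply: hdot_ext => w.
    rewrite hdot_addl hdot_scalel hdot_addl hdot_scalel; exact: Clin2.
  rewrite e1 in t1; rewrite e2 in t2; move: hu; split_Rabs; lra.
pose pick (g : U) : list uvec :=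
  match excluded_middle_informative (exists t : uvec, forall u : uvec, dist g (cube_of (uv u) : U) < d g -> ldist t u < r t) with
  | left h => [:: proj1_sig (constructive_indefinite_description _ h)]
  | right _ => [::] end.
exists (List.flat_map pick l) => y; have [g [gl hg]] := hl (cube_of (uv y) : U).
have [_ [h|h]] := hd g; last by case: (h y).
have : exists x, List.In x (pick g) /\ ldist x y < r x.
  rewrite /pick; case: excluded_middle_informative => h'; last by case: h'.
  by case: constructive_indefinite_description => t ht; exists t; split; [left|exact: ht].
by move=> [x [hx hxy]]; exists x; split=> //; apply/List.in_flat_map; exists g.
Qed.

Lemma ldist_refl (u : uvec) : ldist u u = 0.
Proof. by rewrite /ldist ov_self Rminus_diag sqrt_0. Qed.

Lemma ldist_sym (u v : uvec) : ldist u v = ldist v u.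
Proof. by rewrite /ldist ov_sym. Qed.

Definition line : cpm := @Cpm uvec (@ldist m) ldist_refl ldist_sym (@ldist_tri m) line_compact.

(** A matrix entry of the orthogonal projector onto the line of u: a Lipschitz function of the line
    that does not depend on the phase of u. *)
Definition bil (u e f : uvec) : C := (ip u e * Cconj (ip u f))%C.

Lemma hdot_unit x (e : uvec) : Cmod (hdot m x (uv e)) <= vn x.
Proof. by have := CSmod m x (uv e); rewrite uvn Rmult_1_r. Qed.

Lemma Cmod_unit a : Cnorm2 a = 1 -> Cmod a = 1.
Proof. by rewrite -Cmod_sqr => h; have := Cmod_ge_0 a; nra. Qed.

Lemma bil_lip (u v e f : uvec) : Cmod (bil u e f - bil v e f)%C <= 4 * ldist u v.
Proof.
have [a [a1 ha]] := align u v; set d := vadd _ _ in ha.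
have E w : ip u w = (a * ip v w + hdot m d (uv w))%C.
  by rewrite /d /ip hdot_addl hdot_scalel; sring.
have aa : (a * Cconj a = RtoC 1)%C.
  by apply: Ceq; rewrite /= -?a1 /Cnorm2; sring.
have -> : (bil u e f - bil v e f = a * ip v e * Cconj (hdot m d (uv f)) + hdot m d (uv e) * Cconj (ip u f))%C.
  rewrite /bil {1}(E e) {1}(E f) Cplus_conj Cmult_conj.
  have -> : (ip v e * Cconj (ip v f) = (a * Cconj a) * (ip v e * Cconj (ip v f)))%C by rewrite aa; sring.
  by rewrite (E f) Cplus_conj Cmult_conj; sring.
have h1 := hdot_unit d e; have h2 := hdot_unit d f.
apply: Rle_trans (Cmod_triangle _ _) _.
rewrite !Cmod_mult !Cmod_conj (Cmod_unit a1).
have c1 := Cmod_ip v e; have c2 := Cmod_ip u f.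
have := Cmod_ge_0 (ip v e); have := Cmod_ge_0 (ip u f).
have := Cmod_ge_0 (hdot m d (uv e)); have := Cmod_ge_0 (hdot m d (uv f)).
nra.
Qed.

Lemma bil_ov u e : bil u e e = RtoC (ov u e).
Proof. by apply: Ceq; rewrite /bil /ov /Cnorm2 /=; sring. Qed.

Lemma ov_lip (u v e : uvec) : Rabs (ov u e - ov v e) <= 4 * ldist u v.
Proof.
have := bil_lip u v e e; rewrite !bil_ov -RtoC_minus Cmod_R; lra.
Qed.

Lemma rcont_ov (T : cpm) (f g : T -> line) : cont f -> cont g -> rcont (fun t => ov (f t) (g t)).
Proof.
move=> cf cg t e e0; have [|d [d0 hd]] := cf t (e / 8); first lra.
have [|d' [d0' hd']] := cg t (e / 8); first lra.
exists (Rmin d d'); split; first exact: Rmin_glb_lt.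
move=> s hs.
have h1 : ldist (f t) (f s) < e / 8 by apply: hd; apply: Rlt_le_trans hs _; exact: Rmin_l.
have h2 : ldist (g t) (g s) < e / 8 by apply: hd'; apply: Rlt_le_trans hs _; exact: Rmin_r.
have := ov_lip (f t) (f s) (g t); have := ov_lip (g t) (g s) (f s).
rewrite (ov_sym (g t)) (ov_sym (g s)); split_Rabs; lra.
Qed.

Lemma rcont_bil_re (e f : uvec) : @rcont line (fun u => fst (bil u e f)).
Proof.
move=> u x x0; exists (x / 4); split; first lra.
move=> v hv; have := bil_lip u v e f; have := re_le_Cmod (bil u e f - bil v e f)%C.
rewrite /Complex.Re /= in hv * => h1 h2; rewrite -/(fst (bil u e f) - fst (bil v e f)); move: h1; split_Rabs; lra.
Qed.

Lemma im_le_Cmod c : Rabs (snd c) <= Cmod c.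
Proof. by have := Rmax_Cmod c; have := Rmax_r (Rabs (fst c)) (Rabs (snd c)); lra. Qed.

Lemma rcont_bil_im (e f : uvec) : @rcont line (fun u => snd (bil u e f)).
Proof.
move=> u x x0; exists (x / 4); split; first lra.
move=> v hv; have := bil_lip u v e f; have := im_le_Cmod (bil u e f - bil v e f)%C.
rewrite /= in hv * => h1 h2; rewrite -/(snd (bil u e f) - snd (bil v e f)); move: h1; split_Rabs; lra.
Qed.

Lemma ip_approx (u v a b : uvec) (x y : C) d : Cnorm2 x = 1 -> Cnorm2 y = 1 ->
  vn (vadd (uv u) (vscale (- x)%C (uv a))) <= d -> vn (vadd (uv v) (vscale (- y)%C (uv b))) <= d ->
  Cmod (ip u v - x * Cconj y * ip a b)%C <= 2 * d.
Proof.
move=> x1 y1 hx hy; set p := vadd _ _ in hx; set q := vadd _ _ in hy.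
have -> : (ip u v - x * Cconj y * ip a b = hdot m p (uv v) + x * Cconj (hdot m q (uv a)))%C.
  rewrite /p /q /ip !hdot_addl !hdot_scalel Cplus_conj Cmult_conj -!hdot_conj Copp_conj.
  by sring.
have h1 := hdot_unit p v; have h2 := hdot_unit q a.
apply: Rle_trans (Cmod_triangle _ _) _; rewrite Cmod_mult Cmod_conj (Cmod_unit x1); lra.
Qed.

(** The open sector of arguments smaller than PI / 4 in absolute value. *)
Definition near1 (c : C) := Rabs (snd c) < fst c.

(* Bargmann invariant: close to |<a,b>|^2 when ux, uy are close to a and vx, vy to b. *)
Lemma bargmann (a b ux uy vx vy : uvec) e c : 0 < e -> 40 * e < c -> c <= ov a b ->
  ldist a ux < e -> ldist a uy < e -> ldist b vx < e -> ldist b vy < e ->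
  near1 (ip ux uy * ip uy vy * ip vy vx * ip vx ux)%C.
Proof.
move=> e0 ec cab h1 h2 h3 h4.
have al (u w : uvec) : ldist w u < e -> exists x, Cnorm2 x = 1 /\ vn (vadd (uv u) (vscale (- x)%C (uv w))) <= 2 * e.
  by move=> h; have [x [x1 hx]] := align u w; exists x; split=> //; rewrite ldist_sym in hx; lra.
have [p [p1 hp]] := al _ _ h1; have [q [q1 hq]] := al _ _ h2.
have [r [r1 hr]] := al _ _ h3; have [s [s1 hs]] := al _ _ h4.
have f1 := ip_approx p1 q1 hp hq; have f2 := ip_approx q1 s1 hq hs.
have f3 := ip_approx s1 r1 hs hr; have f4 := ip_approx r1 p1 hr hp.
rewrite !ip_self !Cmult_1_r in f1 f3.
have un x : Cnorm2 x = 1 -> (x * Cconj x = RtoC 1)%C.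
  by move=> h; apply: Ceq; rewrite /= -?h /Cnorm2; sring.
set P := (_ * _)%C.
have tgt : (p * Cconj q * (q * Cconj s * ip a b) * (s * Cconj r) * (r * Cconj p * ip b a) = RtoC (ov a b))%C.
  rewrite -bil_ov /bil -(ip_conj b a).
  transitivity ((p * Cconj p) * (q * Cconj q) * (r * Cconj r) * (s * Cconj s) * (ip a b * ip b a))%C; first by sring.
  by rewrite !un //; sring.
have cl (x y : C) : Cnorm2 x = 1 -> Cnorm2 y = 1 -> Cmod (x * Cconj y)%C = 1.
  by move=> h h'; rewrite Cmod_mult Cmod_conj !Cmod_unit //; lra.
have le1 (x y z : C) : Cnorm2 x = 1 -> Cnorm2 y = 1 -> Cmod z <= 1 -> Cmod (x * Cconj y * z)%C <= 1.
  by move=> h h' hz; rewrite Cmod_mult cl //; lra.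
have diff (x x' y y' : C) t t' : Cmod x <= 1 -> Cmod y' <= 1 -> Cmod (x - x')%C <= t -> Cmod (y - y')%C <= t' ->
    Cmod (x * y - x' * y')%C <= t + t'.
  move=> hx hy hxx hyy.
  have -> : (x * y - x' * y' = x * (y - y') + (x - x') * y')%C by sring.
  apply: Rle_trans (Cmod_triangle _ _) _; rewrite !Cmod_mult.
  have := Cmod_ge_0 x; have := Cmod_ge_0 y'; have := Cmod_ge_0 (x - x')%C; have := Cmod_ge_0 (y - y')%C; nra.
have m1 (x y : C) : Cmod x <= 1 -> Cmod y <= 1 -> Cmod (x * y)%C <= 1.
  by move=> hx hy; rewrite Cmod_mult; have := Cmod_ge_0 x; have := Cmod_ge_0 y; nra.
have g1 := diff _ _ _ _ _ _ (Cmod_ip ux uy) (le1 _ _ _ q1 s1 (Cmod_ip a b)) f1 f2.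
have g2 := diff _ _ _ _ _ _ (m1 _ _ (Cmod_ip ux uy) (Cmod_ip uy vy)) (Req_le _ _ (cl _ _ s1 r1)) g1 f3.
have g3 := diff _ _ _ _ _ _ (m1 _ _ (m1 _ _ (Cmod_ip ux uy) (Cmod_ip uy vy)) (Cmod_ip vy vx)) (le1 _ _ _ r1 p1 (Cmod_ip b a)) g2 f4.
rewrite tgt -/P in g3.
(* Each of the four factors is off by at most 4e, so the product is within 16e of [ov a b], which
   exceeds 40e. *)
have := re_le_Cmod (P - RtoC (ov a b))%C; have := im_le_Cmod (P - RtoC (ov a b))%C.
rewrite /Complex.Re /near1 /=; split_Rabs; lra.
Qed.

End Lines.

(** * The Chern class of the tautological line bundle *)

Section Phases.
Local Close Scope ring_scope.
Local Open Scope R_scope.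

Definition polar (c : C) (t : R) := c = (Cmod c * cos t, Cmod c * sin t).

Lemma polar_ex c : exists t, polar c t.
Proof.
have [z|nz] := Req_dec (Cmod c) 0.
  by exists 0; rewrite /polar z !Rmult_0_l; exact: Cmod_eq_0.
have p : 0 < Cmod c by have := Cmod_ge_0 c; lra.
have cc := Cmod_sqr c; rewrite /Cnorm2 in cc.
pose x := fst c / Cmod c; pose y := snd c / Cmod c.
have ex : fst c = Cmod c * x by rewrite /x; sfield.
have ey : snd c = Cmod c * y by rewrite /y; sfield.
have xy : x * x + y * y = 1.
  apply: (Rmult_eq_reg_l (Cmod c * Cmod c)); last by nra.
  by rewrite {2}cc ex ey; sring.
have xb : -1 <= x <= 1 by nra.
have s2 : sin (acos x) = Rabs y.
  by rewrite sin_acos // -sqrt_Rsqr_abs; congr sqrt; rewrite /Rsqr; lra.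
case: (Rle_dec 0 y) => hy.
  exists (acos x); apply: Ceq => /=; first by rewrite cos_acos.
  by rewrite s2 Rabs_right //; lra.
exists (- acos x); apply: Ceq => /=; first by rewrite cos_neg cos_acos.
by rewrite sin_neg s2 Rabs_left ?Ropp_involutive //; lra.
Qed.

(** The angle is an arbitrary choice, possibly discontinuous; normalising it at 1 makes the terms
    coming from a vector paired with itself vanish. *)
Lemma arg_ex c : exists t, polar c t /\ (c = RtoC 1 -> t = 0).
Proof.
case: (Ceq_dec c (RtoC 1)) => [->|n]; last by have [t ht] := polar_ex c; exists t.
by exists 0; split=> //; rewrite /polar Cmod_1 cos_0 sin_0 Rmult_1_l Rmult_0_r.
Qed.

Definition arg c := proj1_sig (constructive_indefinite_description _ (arg_ex c)).

Lemma argP c : polar c (arg c).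
Proof. by rewrite /arg; case: constructive_indefinite_description => t []. Qed.

Lemma arg1 : arg (RtoC 1) = 0.
Proof. by rewrite /arg; case: constructive_indefinite_description => t [a b]; exact: b. Qed.

Definition pmul (r t : R) : C := (r * cos t, r * sin t).

Lemma pmulM r t r' t' : (pmul r t * pmul r' t')%C = pmul (r * r') (t + t').
Proof. by apply: Ceq; rewrite /= ?cos_plus ?sin_plus; sring. Qed.

Lemma pmulV r t : Cconj (pmul r t) = pmul r (- t).
Proof. by apply: Ceq; rewrite /= ?cos_neg ?sin_neg; sring. Qed.

Lemma phase4 (c1 c2 c3 c4 : C) : exists r, 0 <= r /\
  (c1 * c2 * Cconj c3 * Cconj c4)%C = pmul r (arg c1 + arg c2 - arg c3 - arg c4).
Proof.
exists (Cmod c1 * Cmod c2 * Cmod c3 * Cmod c4).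
split; first by repeat apply: Rmult_le_pos; exact: Cmod_ge_0.
have E c : c = pmul (Cmod c) (arg c) by exact: argP.
by rewrite {1}(E c1) {1}(E c2) {1}(E c3) {1}(E c4) !pmulV !pmulM.
Qed.

Lemma IZR_small k : Rabs (2 * PI * IZR k) < 2 * PI -> k = Z0.
Proof.
have pi := PI_RGT_0 => h.
have {}h : Rabs (IZR k) < 1.
  by move: h; rewrite Rabs_mult (Rabs_right (2 * PI)); [nra|lra].
have [h1 h2] := Rabs_def2 _ _ h.
have l1 : (k < 1)%ZZ by apply: lt_IZR.
have l2 : (-1 < k)%ZZ by apply: lt_IZR; lra.
lia.
Qed.

Lemma turn_ex (t : R) : exists N : Z, - PI <= t - 2 * PI * IZR N <= PI.
Proof.
have pi := PI_RGT_0.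
pose x := t / (2 * PI) + / 2.
have [h1 h2] := archimed x; exists (up x - 1)%ZZ; rewrite minus_IZR.
have e : t = 2 * PI * (x - / 2) by rewrite /x; sfield; lra.
rewrite {}e; nra.
Qed.

Lemma trigZ s (N : Z) : cos (s + 2 * PI * IZR N) = cos s /\ sin (s + 2 * PI * IZR N) = sin s.
Proof.
have pos x (M : Z) : (0 <= M)%ZZ -> cos (x + 2 * PI * IZR M) = cos x /\ sin (x + 2 * PI * IZR M) = sin x.
  move=> M0; rewrite -(Z2Nat.id M M0) -INR_IZR_INZ.
  have -> : x + 2 * PI * INR (Z.to_nat M) = x + 2 * INR (Z.to_nat M) * PI by sring.
  by rewrite cos_period sin_period.
have [h|h] : (0 <= N)%ZZ \/ (0 <= - N)%ZZ by lia.
  exact: pos.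
have := pos (s + 2 * PI * IZR N) _ h; rewrite opp_IZR.
have -> : s + 2 * PI * IZR N + 2 * PI * - IZR N = s by sring.
by move=> [-> ->].
Qed.

Lemma turn_near r t : 0 <= r -> near1 (pmul r t) -> exists N : Z, Rabs (t - 2 * PI * IZR N) < PI / 4.
Proof.
move=> r0; rewrite /near1 /= => h; have pi := PI_RGT_0; have [N hN] := turn_ex t; exists N.
set s := t - _ in hN *.
have [ec es] := trigZ s N.
have e : s + 2 * PI * IZR N = t by rewrite /s; sring.
rewrite e in ec es; rewrite {}ec {}es in h.
have {}h : Rabs (sin s) < cos s.
  have rp : 0 < r.
    case: (Req_dec r 0) => [z|nz]; last lra.
    by move: h; rewrite z !Rmult_0_l Rabs_R0; lra.
  by apply: (Rmult_lt_reg_l r) => //; move: h; rewrite Rabs_mult (Rabs_right r) //; lra.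
have {h} : Rabs (sin (Rabs s)) < cos (Rabs s).
  move: h; rewrite /(Rabs s); case: Rcase_abs => _ //.
  by rewrite cos_neg sin_neg Rabs_Ropp.
have : 0 <= Rabs s <= PI by split_Rabs; lra.
move: (Rabs s) => x hx h; apply: Rnot_le_lt => hx4.
case: (Rle_dec (PI / 2) x) => hx2.
  have := cos_le_0 x; have := Rabs_pos (sin x); lra.
have h1 : cos x <= cos (PI / 4) by apply: cos_decr_1; lra.
have h2 : sin (PI / 4) <= sin x by apply: sin_incr_1; lra.
by move: h; rewrite sin_cos_PI4 in h2; have := Rle_abs (sin x); lra.
Qed.

(** The nearest whole number of turns, meaningful unless t is an odd multiple of PI. *)
Definition rd (t : R) : Z := epsilon (inhabits Z0) (fun N => Rabs (t - 2 * PI * IZR N) < PI).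

Lemma rd_uniq t N : Rabs (t - 2 * PI * IZR N) < PI -> rd t = N.
Proof.
move=> h; have h' : Rabs (t - 2 * PI * IZR (rd t)) < PI.
  by apply: (epsilon_spec (inhabits Z0) (fun N => Rabs (t - 2 * PI * IZR N) < PI)); exists N.
suff : (rd t - N)%ZZ = Z0 by lia.
apply: IZR_small; rewrite minus_IZR; move: h h'; set a := IZR N; set b := IZR (rd t).
have -> : 2 * PI * (b - a) = (t - 2 * PI * a) - (t - 2 * PI * b) by sring.
by split_Rabs; lra.
Qed.

Lemma rd_near r t : 0 <= r -> near1 (pmul r t) -> Rabs (t - 2 * PI * IZR (rd t)) < PI / 4.
Proof.
move=> r0 h; have [N hN] := turn_near r0 h; have pi := PI_RGT_0.
by rewrite (@rd_uniq t N) //; lra.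
Qed.

End Phases.

Section ChernCocycle.
Variable F : fieldType.
Hypothesis char2 : forall x : F, x + x = 0.

Definition pz (N : Z) : F := if Z.odd N then 1 else 0.

Lemma pzD a b : pz (a + b) = pz a + pz b.
Proof.
rewrite /pz Z.odd_add; case: (Z.odd a); case: (Z.odd b); rewrite /= ?addr0 ?add0r ?char2 //.
Qed.

Lemma pz0 : pz Z0 = 0.
Proof. by []. Qed.

Lemma pzN a : pz (- a) = pz a.
Proof. by rewrite /pz Z.odd_opp. Qed.

Lemma pzB a b : pz (a - b) = pz a + pz b.
Proof. by rewrite /Z.sub pzD pzN. Qed.

Variable m : nat.

(** The phase accumulated around the quadrilateral ux, uy, vy, vx, before reduction modulo 2 PI. For
    vx = ux it degenerates to a triangle, which gives [zeta]. *)
Definition turn4 (ux uy vx vy : uvec m) : R :=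
  (arg (ip ux uy) + arg (ip uy vy) - arg (ip vx vy) - arg (ip ux vx))%Re.

Lemma turn4P (a b ux uy vx vy : uvec m) e c : (0 < e)%Re -> (40 * e < c)%Re -> (c <= ov a b)%Re ->
  (ldist a ux < e)%Re -> (ldist a uy < e)%Re -> (ldist b vx < e)%Re -> (ldist b vy < e)%Re ->
  (Rabs (turn4 ux uy vx vy - 2 * PI * IZR (rd (turn4 ux uy vx vy))) < PI / 4)%Re.
Proof.
move=> e0 ec cab h1 h2 h3 h4; have := bargmann e0 ec cab h1 h2 h3 h4.
rewrite (ip_conj vy vx) (ip_conj vx ux).
have [r [r0 ->]] := phase4 (ip ux uy) (ip uy vy) (ip vx vy) (ip ux vx).
exact: rd_near.
Qed.

(* The first Chern class (mod 2) of the tautological line bundle: the coboundary of the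
   phases arg <u,v>, rounded to an integer number of turns. *)
Definition zeta (s : seq (uvec m)) : F :=
  if s is [:: u; v; w] then pz (rd (turn4 u v u w)) else 0.

Lemma zeta_pure : pure 2 zeta.
Proof. by move=> -[|u [|v [|w [|x s]]]]. Qed.

Lemma cob_pure T e (z : seq T -> F) s : pure e z -> size s <> e.+2 -> cob z s = 0.
Proof.
move=> pz_ hs; case: s hs => [|x [|y s]] hs //.
rewrite /cob; apply: faces_eq0 => s' _ sz; apply: pz_; rewrite sz /=.
by move=> h; apply: hs; rewrite /= h.
Qed.

(** The phases of the four faces of a tetrahedron cancel with signs, and each is within PI / 4 of
    its rounding; the signed sum of the rounded turns is therefore below one turn, hence 0. The
    radius 1/100 meets the factor 40 of [turn4P] at overlap 1. *)
Lemma zeta_cocycle (A : line m -> Prop) p : K A p (cob zeta).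
Proof.
exists (/ 100)%Re; split; first lra.
move=> s _ [a [_ ha]].
have [sz|/(cob_pure zeta_pure) //] := PeanoNat.Nat.eq_dec (size s) 4.
case: s sz ha => [|x0 [|x1 [|x2 [|x3 [|? ?]]]]] // _ ha.
have o1 : (1 <= ov a a)%Re by rewrite ov_self; lra.
have ha0 : (ldist a x0 < / 100)%Re by apply: ha; rewrite /=; tauto.
have ha1 : (ldist a x1 < / 100)%Re by apply: ha; rewrite /=; tauto.
have ha2 : (ldist a x2 < / 100)%Re by apply: ha; rewrite /=; tauto.
have ha3 : (ldist a x3 < / 100)%Re by apply: ha; rewrite /=; tauto.
have T4 u v w x h1 h2 h3 h4 := @turn4P a a u v w x (/ 100)%Re 1%Re ltac:(lra) ltac:(lra) o1 h1 h2 h3 h4.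
have t1 := T4 x1 x2 x1 x3 ha1 ha2 ha1 ha3; have t2 := T4 x0 x2 x0 x3 ha0 ha2 ha0 ha3.
have t3 := T4 x0 x1 x0 x3 ha0 ha1 ha0 ha3; have t4 := T4 x0 x1 x0 x2 ha0 ha1 ha0 ha2.
rewrite /cob /=; move: t1 t2 t3 t4; rewrite /turn4 !ip_self arg1.
set r1 := rd _; set r2 := rd _; set r3 := rd _; set r4 := rd _ => t1 t2 t3 t4.
have pi := PI_RGT_0.
have e0 : (r1 - r2 + r3 - r4)%ZZ = Z0.
  apply: IZR_small; rewrite minus_IZR plus_IZR minus_IZR.
  by move: t1 t2 t3 t4; split_Rabs; lra.
have := congr1 pz e0; rewrite pzB pzD pzB pz0 => h.
by transitivity (pz r1 + pz r2 + pz r3 + pz r4); [ring|].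
Qed.

Definition gauge (T : Type) (U V : T -> uvec m) (s : seq T) : F :=
  if s is [:: x; y] then pz (rd (turn4 (U x) (U y) (V x) (V y))) else 0.

Lemma gauge_pure T (U V : T -> uvec m) : pure 1 (gauge U V).
Proof. by move=> -[|u [|v [|w s]]]. Qed.

(** Orthogonal projection identifies two line bundles that are nowhere orthogonal, and [gauge]
    records its phase along an edge. Two triangles and three quadrilaterals cancel, with total
    rounding error below 5 PI / 4. *)
Lemma zeta_gauge (T : cpm) (U V : T -> line m) (A : T -> Prop) c p : cont U -> cont V ->
  (0 < c)%Re -> (forall t, A t -> (c <= ov (U t) (V t))%Re) ->
  K A p (fsub (fsub (pull U zeta) (pull V zeta)) (cob (gauge U V))).
Proof.
move=> cU cV c0 hc; have c1 : (Rmin c 1 <= 1)%Re by exact: Rmin_r.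
have c2 : (Rmin c 1 <= c)%Re by exact: Rmin_l.
have c3 : (0 < Rmin c 1)%Re by apply: Rmin_glb_lt; lra.
pose e := (Rmin c 1 / 100)%Re; have e0 : (0 < e)%Re by rewrite /e; lra.
have [d [d0 hd]] := cont_unif cU e0; have [d' [d0' hd']] := cont_unif cV e0.
exists (Rmin d d'); split; first exact: Rmin_glb_lt.
move=> s _ [a [Aa ha]].
have [sz|nsz] := PeanoNat.Nat.eq_dec (size s) 3; last first.
  by rewrite /fsub /pull (cob_pure (@gauge_pure _ U V)) // !zeta_pure ?size_map // !subr0.
case: s sz ha => [|x0 [|x1 [|x2 [|? ?]]]] // _ ha.
have au x : List.In x [:: x0; x1; x2] -> (ldist (U a) (U x) < e)%Re.
  by move/ha => h; apply: hd; apply: Rlt_le_trans h _; exact: Rmin_l.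
have av x : List.In x [:: x0; x1; x2] -> (ldist (V a) (V x) < e)%Re.
  by move/ha => h; apply: hd'; apply: Rlt_le_trans h _; exact: Rmin_r.
have i0 : List.In x0 [:: x0; x1; x2] by rewrite /=; tauto.
have i1 : List.In x1 [:: x0; x1; x2] by rewrite /=; tauto.
have i2 : List.In x2 [:: x0; x1; x2] by rewrite /=; tauto.
have o1 : (Rmin c 1 <= ov (U a) (U a))%Re by rewrite ov_self; lra.
have o2 : (Rmin c 1 <= ov (V a) (V a))%Re by rewrite ov_self; lra.
have o3 : (Rmin c 1 <= ov (U a) (V a))%Re by have := hc a Aa; lra.
have ec : (40 * e < Rmin c 1)%Re by rewrite /e; lra.
have t1 := turn4P e0 ec o1 (au _ i0) (au _ i1) (au _ i0) (au _ i2).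
have t2 := turn4P e0 ec o2 (av _ i0) (av _ i1) (av _ i0) (av _ i2).
have g1 := turn4P e0 ec o3 (au _ i0) (au _ i1) (av _ i0) (av _ i1).
have g2 := turn4P e0 ec o3 (au _ i1) (au _ i2) (av _ i1) (av _ i2).
have g3 := turn4P e0 ec o3 (au _ i0) (au _ i2) (av _ i0) (av _ i2).
rewrite /fsub /pull /cob /=; move: t1 t2 g1 g2 g3; rewrite /turn4 !ip_self arg1.
set r1 := rd _; set r2 := rd _; set r3 := rd _; set r4 := rd _; set r5 := rd _ => t1 t2 g1 g2 g3.
have pi := PI_RGT_0.
have E : (r1 - r2 - (r3 + r4 - r5))%ZZ = Z0.
  apply: IZR_small; rewrite !minus_IZR plus_IZR.
  by move: t1 t2 g1 g2 g3; split_Rabs; lra.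
have := congr1 pz E; rewrite !pzB pzD pz0 => h.
by rewrite !(oppF char2); transitivity (pz r1 + pz r2 + (pz r3 + pz r4 + pz r5)); [ring|].
Qed.

Lemma zeta_null (T : cpm) (U V : T -> line m) (A : T -> Prop) c p : cont U -> cont V ->
  (0 < c)%Re -> (forall t, A t -> (c <= ov (U t) (V t))%Re) ->
  Bc A p (fsub (pull U zeta) (pull V zeta)).
Proof. by move=> cU cV c0 hc; exists (gauge U V); exact: zeta_gauge hc. Qed.

Lemma zeta_const T (e : uvec m) s : pull (fun _ : T => e) zeta s = 0.
Proof.
have [sz|nsz] := PeanoNat.Nat.eq_dec (size s) 3; last by rewrite /pull zeta_pure ?size_map.
case: s sz => [|x0 [|x1 [|x2 [|? ?]]]] // _; rewrite /pull /= /turn4 !ip_self arg1.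
rewrite (@rd_uniq _ Z0) //; have pi := PI_RGT_0.
by rewrite Rmult_0_r !Rminus_0_r Rplus_0_r Rabs_R0.
Qed.

End ChernCocycle.

(** * The projective line *)

Section ProjectiveLine.
Variable F : fieldType.
Hypothesis char2 : forall x : F, x + x = 0.
Variable m : nat.
Notation uvec := (uvec m).

(** Vietoris-Begle over an interval; it replaces homotopies in the proofs that discs and arcs are
    acyclic. *)
Lemma acyclic_by (T : cpm) (A : T -> Prop) (g : T -> R) lo hi : closed A -> rcont g ->
  (-1 <= lo)%Re -> (lo <= hi)%Re -> (hi <= 1)%Re -> (forall u, A u -> (lo <= g u <= hi)%Re) ->
  (forall r, (lo <= r <= hi)%Re -> acyclic F (fun u => A u /\ g u = r)) -> acyclic F A.
Proof.
move=> cA cg h1 h2 h3 hA fib.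
have gc u : A u -> clamp (g u) = g u by move/hA => h; apply: clamp_id; lra.
have := @VB_acyclic F char2 clampR T g A (Iv lo hi) (rcont_clamp cg) cA (@closed_Iv lo hi) _ (acyclic_Iv char2 h1 h2 h3).
move=> H; apply: acyclic_ext (H _) => [t|b hb].
  by split=> [[]//|At]; split=> //; rewrite /Iv gc //; exact: hA.
apply: acyclic_ext (fib (clamp b) hb) => t; rewrite /ptset /=.
split=> -[At e]; split=> //.
  by rewrite gc // e Rminus_diag Rabs_R0.
by move/Rabs_eq_0: e; rewrite gc //; lra.
Qed.

Lemma deg1_ext (T : cpm) (A B : T -> Prop) j (w : seq T -> F) : (forall t, A t <-> B t) -> deg1 A j w -> deg1 B j w.
Proof.
move=> AB [h1 h2]; split=> [p x zx|p a b jp hb].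
  have [|a [b hab]] := h1 p x; first by apply: Z_mono zx => t /AB.
  by exists a, b; apply: B_mono hab => t /AB.
by apply: h2 jp _; apply: B_mono hb => t /AB.
Qed.

Section Pair.
Local Close Scope ring_scope.
Local Open Scope R_scope.
Variables e f : uvec.
Hypothesis ef : ip e f = RtoC 0.

Definition PV2 (u : line m) := ov u e + ov u f = 1.
(** On the hemisphere around e of the projective line of e and f, this off-diagonal projector entry
    is a chart onto the disc of radius 1/2. *)
Definition rho (u : line m) : C := bil u f e.

Lemma closed_PV2 : closed PV2.
Proof.
apply: (@closed_eq (line m) (fun u => ov u e + ov u f)).
by apply: rcont_add; apply: (@rcont_ov m (line m)); [exact: cont_id|exact: cont_const|exact: cont_id|exact: cont_const].
Qed.

Lemma fe0 : ip f e = RtoC 0.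
Proof. by rewrite ip_conj ef; apply: Ceq => /=; lra. Qed.

Lemma PV2_expand u w : PV2 u -> ip u w = (ip u e * ip e w + ip u f * ip f w)%C.
Proof.
move=> h.
pose d := vadd (vadd (uv u) (vscale (- ip u e)%C (uv e))) (vscale (- ip u f)%C (uv f)).
have n0 : norm2 m d = 0.
  rewrite /d norm2_comb norm2_proj hdot_addl hdot_scalel !uv1 -/(ip u f) -/(ip e f) ef.
  by move: h; rewrite /PV2 /ov /Cnorm2 /=; lra.
have d0 : hdot m d (uv w) = RtoC 0.
  apply: Cmod_eq_0; have := CSmod m d (uv w); rewrite /vnorm n0 sqrt_0 Rmult_0_l.
  by have := Cmod_ge_0 (hdot m d (uv w)); lra.
move: d0; rewrite /d !hdot_addl !hdot_scalel -/(ip u w) -/(ip e w) -/(ip f w) => d0.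
have -> : ip u w = (ip u w + - ip u e * ip e w + - ip u f * ip f w + (ip u e * ip e w + ip u f * ip f w))%C by sring.
by rewrite d0; sring.
Qed.

Lemma pair_ex (a b : C) : Cnorm2 a + Cnorm2 b = 1 -> exists u : uvec, ip u e = a /\ ip u f = b.
Proof.
move=> h; pose x := vadd (vscale a (uv e)) (vscale b (uv f)).
have xe : hdot m x (uv e) = a.
  by rewrite /x hdot_addl !hdot_scalel -/(ip e e) -/(ip f e) ip_self fe0; sring.
have xf : hdot m x (uv f) = b.
  by rewrite /x hdot_addl !hdot_scalel -/(ip f f) -/(ip e f) ip_self ef; sring.
have n1 : norm2 m x = 1.
  rewrite norm2E {2}/x hdot_addr !hdot_scaler xe xf -h /Cnorm2 /=; sring.
by exists (exist _ x n1).
Qed.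

Lemma rho_norm u : Cnorm2 (rho u) = ov u e * ov u f.
Proof. by rewrite /rho /bil Cnorm2_mult Cnorm2_conj Rmult_comm. Qed.

Lemma ptfib x r s : / 2 <= x <= 1 -> x * (1 - x) = r * r + s * s ->
  exists u0, ov u0 e = x /\ fst (rho u0) = r /\ snd (rho u0) = s /\
  forall u, (PV2 u /\ ov u e = x /\ fst (rho u) = r /\ snd (rho u) = s) <-> @ptset (line m) u0 u.
Proof.
move=> hx xrs; have sx : 0 < sqrt x by apply: sqrt_lt_R0; lra.
have ssx : sqrt x * sqrt x = x by apply: sqrt_sqrt; lra.
(* The representative whose e-coordinate is positive real; x >= 1/2 allows the division. *)
have [|u0 [ue uf]] := @pair_ex (RtoC (sqrt x)) (RtoC (/ sqrt x) * (r, s))%C.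
  rewrite Cnorm2_mult /Cnorm2 /= -xrs.
  transitivity (sqrt x * sqrt x + / sqrt x * / sqrt x * (x * (1 - x))); first by sring.
  have -> : / sqrt x * / sqrt x = / x by rewrite -[in RHS]ssx Rinv_mult.
  by rewrite ssx; sfield; lra.
have rh : rho u0 = (r, s).
  by rewrite /rho /bil uf ue; apply: Ceq => /=; sfield; lra.
have oe : ov u0 e = x by rewrite /ov ue /Cnorm2 /=; lra.
have pv : PV2 u0.
  have : x * ov u0 f = x * (1 - x) by rewrite -{1}oe -rho_norm rh /Cnorm2 /= xrs.
  by rewrite /PV2 oe => h; apply: (Rmult_eq_reg_l x); nra.
exists u0; rewrite rh; split=> //; split=> //; split=> // u; split; last first.
  move=> h; pose S u := PV2 u /\ ov u e = x /\ fst (rho u) = r /\ snd (rho u) = s.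
  have cS : @closed (line m) S.
    apply: closedI closed_PV2 _; apply: closedI.
      by apply: (@closed_eq (line m) (fun u => ov u e)); apply: (@rcont_ov m (line m)); [exact: cont_id|exact: cont_const].
    apply: closedI; first by apply: closed_eq; exact: rcont_bil_re.
    by apply: closed_eq; exact: rcont_bil_im.
  have S0 : S u0 by rewrite /S rh.
  exact: (closed_pt_sub cS S0 h).
case=> pu [oeu [ru su]].
have o1 : ov u0 u = 1.
  rewrite ov_sym /ov (PV2_expand u0 pu) (ip_conj e u0) (ip_conj f u0).
  have rhu : rho u = (r, s) by rewrite (surjective_pairing (rho u)) ru su.
  have E1 : Cnorm2 (ip u e) = x by [].
  have E2 : Cnorm2 (ip u f) = 1 - x by move: pu; rewrite /PV2 oeu /ov; lra.
  have E3 : Cnorm2 (ip u0 e) = x by [].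
  have E4 : Cnorm2 (ip u0 f) = 1 - x by move: pv; rewrite /PV2 oe /ov; lra.
  have E5 : (ip u f * Cconj (ip u e) = ip u0 f * Cconj (ip u0 e))%C.
    by rewrite -/(bil u f e) -/(bil u0 f e) -/(rho u) -/(rho u0) rhu rh.
  have E6 : Cnorm2 (rho u0) = x * (1 - x) by rewrite rh /Cnorm2 xrs.
  move: E1 E2 E3 E4 E5 E6; rewrite /rho /bil.
  case: (ip u e) => a1 a2; case: (ip u f) => b1 b2; case: (ip u0 e) => c1 c2; case: (ip u0 f) => d1 d2.
  rewrite /Cnorm2 /= => E1 E2 E3 E4 [E5 E5'] E6.
  set p := b1 * a1 - b2 * - a2 in E5; set p' := b1 * - a2 + b2 * a1 in E5'.
  set q := d1 * c1 - d2 * - c2 in E5 E6; set q' := d1 * - c2 + d2 * c1 in E5' E6.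
  transitivity ((a1 * a1 + a2 * a2) * (c1 * c1 + c2 * c2) + (b1 * b1 + b2 * b2) * (d1 * d1 + d2 * d2)
     + 2 * (p * q + p' * q')); first by rewrite /p /q /p' /q'; sring.
  rewrite E5 E5' E1 E2 E3 E4.
  transitivity (x * x + (1 - x) * (1 - x) + 2 * (q * q + q' * q')); first by sring.
  by rewrite E6; sring.
by rewrite /ptset /= /ldist o1 Rminus_diag sqrt_0.
Qed.

Definition disc (u : line m) := PV2 u /\ / 2 <= ov u e.

Lemma closed_disc : closed disc.
Proof.
apply: closedI closed_PV2 _; apply: (@closed_ge (line m) (fun u => ov u e)).
by apply: (@rcont_ov m (line m)); [exact: cont_id|exact: cont_const].
Qed.

Lemma disc_root u : disc u -> fst (rho u) * fst (rho u) + snd (rho u) * snd (rho u) <= / 4 /\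
  ov u e * (1 - ov u e) = fst (rho u) * fst (rho u) + snd (rho u) * snd (rho u).
Proof.
move=> [pu hu]; have := rho_norm u; rewrite /Cnorm2 => ->.
have -> : ov u f = 1 - ov u e by rewrite /PV2 in pu; lra.
by split=> //; have := ov_bd u e; nra.
Qed.

Lemma root_ex t : 0 <= t <= / 4 -> exists x, / 2 <= x <= 1 /\ x * (1 - x) = t /\
  forall y, / 2 <= y -> y * (1 - y) = t -> y = x.
Proof.
move=> ht; pose d := sqrt (/ 4 - t).
have dd : d * d = / 4 - t by apply: sqrt_sqrt; lra.
have d0 : 0 <= d by exact: sqrt_pos.
exists (/ 2 + d); split; first by nra.
split; first by nra.
move=> y hy h; have : (y - / 2 - d) * (y - / 2 + d) = 0 by nra.
by move/Rmult_integral; lra.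
Qed.

(** The disc is fibred by the real part of [rho], each slice by the imaginary part. What remains is
    one line, since [ov u e] is the larger root of x (1 - x) = |rho|^2. *)
Lemma acyclic_disc : acyclic F disc.
Proof.
apply: (@acyclic_by (line m) disc (fun u => fst (rho u)) (- / 2) (/ 2) closed_disc); try lra.
- exact: rcont_bil_re.
- by move=> u /disc_root [h _]; nra.
move=> r hr; pose s := sqrt (/ 4 - r * r).
have ss : s * s = / 4 - r * r by apply: sqrt_sqrt; nra.
have s0 : 0 <= s by exact: sqrt_pos.
apply: (@acyclic_by (line m) _ (fun u => snd (rho u)) (- s) s); try nra.
- apply: closedI closed_disc _; apply: closed_eq; exact: rcont_bil_re.
- exact: rcont_bil_im.
- by move=> u [/disc_root [h _] e1]; rewrite e1 in h; nra.
move=> t ht; have [|x [hx [xx xu]]] := @root_ex (r * r + t * t); first by nra.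
have [u0 [h1 [h2 [h3 h4]]]] := ptfib hx xx.
apply: (acyclic_pt char2 (b := u0 : line m)) => u; rewrite -h4; split.
  move=> [[du ru] tu]; do !split=> //; first by case: du.
  by apply: xu; [case: du|have [_ ->] := disc_root du; rewrite ru tu].
by move=> [pu [xu' [ru tu]]]; do !split=> //; lra.
Qed.

End Pair.

Section Circle.
Local Close Scope ring_scope.
Local Open Scope R_scope.
Variables e f : uvec.
Hypothesis ef : ip e f = RtoC 0.
Notation rho := (rho e f).

Definition circ (u : line m) := PV2 e f u /\ ov u e = / 2.
Definition arcp (u : line m) := circ u /\ 0 <= fst (rho u).
Definition arcn (u : line m) := circ u /\ fst (rho u) <= 0.

Lemma closed_circ : closed circ.
Proof.
apply: (@closedI (line m) (PV2 e f) (fun u => ov u e = / 2)); first exact: closed_PV2.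
apply: (@closed_eq (line m) (fun u => ov u e)).
by apply: (@rcont_ov m (line m)); [exact: cont_id|exact: cont_const].
Qed.

Lemma circ_norm u : circ u -> fst (rho u) * fst (rho u) + snd (rho u) * snd (rho u) = / 4.
Proof.
move=> [pu hu]; have := rho_norm e f u; rewrite /Cnorm2 => ->.
by rewrite /PV2 in pu; rewrite hu (_ : ov u f = / 2); lra.
Qed.

Lemma closed_arcp : closed arcp.
Proof. by apply: closedI closed_circ _; apply: closed_ge; exact: rcont_bil_re. Qed.
Lemma closed_arcn : closed arcn.
Proof. by apply: closedI closed_circ _; apply: closed_le; exact: rcont_bil_re. Qed.

Lemma circ_pt r s : r * r + s * s = / 4 -> exists u0,
  forall u, (circ u /\ fst (rho u) = r /\ snd (rho u) = s) <-> @ptset (line m) u0 u.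
Proof.
move=> h; have [||u0 [_ [_ [_ h4]]]] := @ptfib e f ef (/ 2) r s; [lra|lra|].
by exists u0 => u; rewrite -h4 /circ; tauto.
Qed.

Lemma acyclic_arc (sg : R) (A : line m -> Prop) : closed A -> (sg = 1 \/ sg = -1) ->
  (forall u, A u <-> circ u /\ 0 <= sg * fst (rho u)) -> acyclic F A.
Proof.
move=> cA hsg hA.
have bd u : A u -> fst (rho u) * fst (rho u) + snd (rho u) * snd (rho u) = / 4.
  by move/hA => [/circ_norm].
apply: (@acyclic_by (line m) A (fun u => snd (rho u)) (- / 2) (/ 2) cA); try lra.
- exact: rcont_bil_im.
- by move=> u /bd; nra.
move=> s hs; pose d := sqrt (/ 4 - s * s).
have dd : d * d = / 4 - s * s by apply: sqrt_sqrt; nra.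
have d0 : 0 <= d by exact: sqrt_pos.
have [|u0 h0] := @circ_pt (sg * d) s; first by case: hsg => ->; lra.
apply: (acyclic_pt char2 (b := u0 : line m)) => u; rewrite -h0; split.
  move=> [Au su]; have b := bd u Au; move/hA: Au => [cu pu]; do !split=> //.
  have : (fst (rho u) - sg * d) * (fst (rho u) + sg * d) = 0 by case: hsg => E; rewrite E in pu *; rewrite su in b; nra.
  move/Rmult_integral => [|q]; first lra.
  have q' : sg * fst (rho u) = - d by case: hsg => E; rewrite E in pu q *; lra.
  have z : d = 0 by lra.
  by rewrite z Rmult_0_r in q *; lra.
move=> [cu [ru su]]; split=> //; apply/hA; split=> //; rewrite ru.
by case: hsg => ->; lra.
Qed.

Lemma acyclic_arcp : acyclic F arcp.
Proof.
apply: (@acyclic_arc 1 arcp closed_arcp); first by left.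
by move=> u; rewrite /arcp Rmult_1_l.
Qed.

Lemma acyclic_arcn : acyclic F arcn.
Proof.
apply: (@acyclic_arc (-1) arcn closed_arcn); first by right.
move=> u; rewrite /arcn; split=> -[cu h]; split=> //; lra.
Qed.

(** The angular coordinate on the equator, up to whole turns: [rho] has argument -beta. *)
Definition beta (u : uvec) : R := arg (ip u e) - arg (ip u f).

Lemma rho_beta u : exists r, 0 <= r /\ r * r = ov u e * ov u f /\
  fst (rho u) = r * cos (beta u) /\ snd (rho u) = - (r * sin (beta u)).
Proof.
exists (Cmod (ip u e) * Cmod (ip u f)); split; first by apply: Rmult_le_pos; exact: Cmod_ge_0.
split; first by rewrite /ov -!Cmod_sqr; sring.
have E c : c = pmul (Cmod c) (arg c) by exact: argP.
have -> : rho u = Cconj (ip u e * Cconj (ip u f))%C.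
  have -> : rho u = (ip u f * Cconj (ip u e))%C by [].
  by rewrite Cmult_conj Cconj_conj Cmult_comm.
have -> : (ip u e * Cconj (ip u f))%C = pmul (Cmod (ip u e) * Cmod (ip u f)) (beta u).
  by rewrite {1}(E (ip u e)) {1}(E (ip u f)) pmulV pmulM.
by split.
Qed.

Lemma beta_rd (t : R) : - / 2 < cos t -> Rabs (t - 2 * PI * IZR (rd t)) < 3 * PI / 4.
Proof.
move=> h; have pi := PI_RGT_0; have [N hN] := turn_ex t.
set s := t - _ in hN.
have es : s + 2 * PI * IZR N = t by rewrite /s; sring.
have [ec _] := trigZ s N; rewrite es in ec; rewrite ec in h.
have hs : Rabs s < 3 * PI / 4.
  have {h} : - / 2 < cos (Rabs s) by move: h; rewrite /(Rabs s); case: Rcase_abs => _ //; rewrite cos_neg.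
  have : 0 <= Rabs s <= PI by split_Rabs; lra.
  move: (Rabs s) => x hx h; apply: Rnot_le_lt => hx4.
  have h1 : cos x <= cos (3 * (PI / 4)) by apply: cos_decr_1; lra.
  rewrite cos_3PI4 in h1.
  have q2 : 0 < sqrt 2 by apply: sqrt_lt_R0; lra.
  have qq : sqrt 2 * sqrt 2 = 2 by apply: sqrt_sqrt; lra.
  have : sqrt 2 * (-1 / sqrt 2) = -1 by sfield; lra.
  nra.
by rewrite (@rd_uniq t N) -/s; lra.
Qed.

(** [n1] and [n2] trivialise [zeta] on the two hemispheres, so [w] is the clutching cocycle on the
    equator. [k1] and [k2] are its primitives on the arcs where cos beta is nonnegative,
    respectively nonpositive; the shift by PI moves the cut of the rounding away from the second
    arc. *)
Let n1 : seq (line m) -> F := gauge F id (fun _ => e).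
Let n2 : seq (line m) -> F := gauge F id (fun _ => f).
Let w := fsub n1 n2.
Let k1 (s : seq (line m)) : F := if s is [:: x] then pz F (rd (beta x)) else 0%R.
Let k2 (s : seq (line m)) : F := if s is [:: x] then pz F (rd (beta x - PI)) else 0%R.

Let k1_pure : pure 0 k1.
Proof. by move=> -[|x [|y s]]. Qed.
Let k2_pure : pure 0 k2.
Proof. by move=> -[|x [|y s]]. Qed.

Lemma circ_near a x : circ a -> ldist a x < / 100 ->
  / 4 <= ov x e /\ / 4 <= ov x f /\ Rabs (fst (rho a) - fst (rho x)) < / 20 /\
  Rabs (snd (rho a) - snd (rho x)) < / 20.
Proof.
move=> [pa ha] hx; have h1 := ov_lip a x e; have h2 := ov_lip a x f.
have b := bil_lip a x f e.
have h3 := re_le_Cmod (bil a f e - bil x f e)%C; have h4 := im_le_Cmod (bil a f e - bil x f e)%C.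
rewrite /PV2 ha in pa; rewrite ha in h1.
have p2 : ov a f = / 2 by lra.
rewrite p2 in h2.
have e3 : Rabs (fst (rho a) - fst (rho x)) <= 4 * ldist a x.
  by apply: Rle_trans b; exact: h3.
have e4 : Rabs (snd (rho a) - snd (rho x)) <= 4 * ldist a x.
  by apply: Rle_trans b; exact: h4.
by move: h1 h2 e3 e4; split_Rabs; lra.
Qed.

Lemma near_beta a x : circ a -> ldist a x < / 100 ->
  (0 <= fst (rho a) -> Rabs (beta x - 2 * PI * IZR (rd (beta x))) < 3 * PI / 4) /\
  (fst (rho a) <= 0 -> Rabs (beta x - PI - 2 * PI * IZR (rd (beta x - PI))) < 3 * PI / 4).
Proof.
move=> ca hx; have [o1 [o2 [d _]]] := circ_near ca hx.
have [r [r0 [rr [er _]]]] := rho_beta x.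
have r4 : / 4 <= r by nra.
rewrite er in d; split=> h; apply: beta_rd.
  by move: d; split_Rabs; nra.
have -> : cos (beta x - PI) = - cos (beta x) by rewrite cos_minus cos_PI sin_PI; lra.
by move: d; split_Rabs; nra.
Qed.

Lemma w_arc a x y : circ a -> ldist a x < / 100 -> ldist a y < / 100 ->
  let S1 := turn4 x y e e in let S2 := turn4 x y f f in
  Rabs (S1 - 2 * PI * IZR (rd S1)) < PI / 4 /\ Rabs (S2 - 2 * PI * IZR (rd S2)) < PI / 4 /\
  S1 - S2 = beta y - beta x.
Proof.
move=> [pa ha] hx hy S1 S2.
have d0 u : ldist u u < / 100 by rewrite ldist_refl; lra.
have oe : / 2 <= ov a e by lra.
have of_ : / 2 <= ov a f by rewrite /PV2 in pa; lra.
split; first by apply: (@turn4P m a e x y e e (/ 100) (/ 2)) => //; lra.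
split; first by apply: (@turn4P m a f x y f f (/ 100) (/ 2)) => //; lra.
by rewrite /S1 /S2 /turn4 /beta !ip_self; lra.
Qed.

Let K_arcp p : K arcp p (fsub w (cob k1)).
Proof.
exists (/ 100); split; first lra.
move=> s _ [a [[ca pa] ha]].
have [sz|nsz] := PeanoNat.Nat.eq_dec (size s) 2; last first.
  by rewrite /fsub (cob_pure k1_pure) // /w /fsub /n1 /n2 !gauge_pure // !subr0.
case: s sz ha => [|x [|y [|? ?]]] // _ ha.
have hx : ldist a x < / 100 by apply: ha; left.
have hy : ldist a y < / 100 by apply: ha; right; left.
have [bx _] := near_beta ca hx; have {}bx := bx pa.
have [by_ _] := near_beta ca hy; have {}by_ := by_ pa.
have [t1 [t2 t3]] := w_arc ca hx hy.
rewrite /fsub /w /fsub /cob /= /n1 /n2 /=.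
move: t1 t2 t3 bx by_; set r1 := rd (turn4 _ _ e e); set r2 := rd (turn4 _ _ f f); set r3 := rd (beta x); set r4 := rd (beta y).
move=> t1 t2 t3 bx by_; have pi := PI_RGT_0.
(* Rounding errors below PI/4, PI/4, 3PI/4 and 3PI/4 add up to less than one turn. *)
have E : (r1 - r2 - (r4 - r3))%ZZ = Z0.
  apply: IZR_small; rewrite !minus_IZR.
  by move: t1 t2 t3 bx by_; split_Rabs; lra.
have := congr1 (pz F) E; rewrite !(pzB char2) pz0 => h.
by rewrite !(oppF char2) addr0 -[RHS]h.
Qed.

Let K_arcn p : K arcn p (fsub w (cob k2)).
Proof.
exists (/ 100); split; first lra.
move=> s _ [a [[ca pa] ha]].
have [sz|nsz] := PeanoNat.Nat.eq_dec (size s) 2; last first.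
  by rewrite /fsub (cob_pure k2_pure) // /w /fsub /n1 /n2 !gauge_pure // !subr0.
case: s sz ha => [|x [|y [|? ?]]] // _ ha.
have hx : ldist a x < / 100 by apply: ha; left.
have hy : ldist a y < / 100 by apply: ha; right; left.
have [_ bx] := near_beta ca hx; have {}bx := bx pa.
have [_ by_] := near_beta ca hy; have {}by_ := by_ pa.
have [t1 [t2 t3]] := w_arc ca hx hy.
rewrite /fsub /w /fsub /cob /= /n1 /n2 /=.
move: t1 t2 t3 bx by_; set r1 := rd (turn4 _ _ e e); set r2 := rd (turn4 _ _ f f); set r3 := rd (beta x - PI); set r4 := rd (beta y - PI).
move=> t1 t2 t3 bx by_; have pi := PI_RGT_0.
have E : (r1 - r2 - (r4 - r3))%ZZ = Z0.
  apply: IZR_small; rewrite !minus_IZR.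
  by move: t1 t2 t3 bx by_; split_Rabs; lra.
have := congr1 (pz F) E; rewrite !(pzB char2) pz0 => h.
by rewrite !(oppF char2) addr0 -[RHS]h.
Qed.

(** The two roundings agree at one common point of the arcs and differ by 1 at the other: the
    clutching function has winding number one. *)
Lemma poles_rd a x : circ a -> ldist a x < / 100 -> fst (rho a) = 0 ->
  (snd (rho a) = - / 2 -> rd (beta x) = rd (beta x - PI)) /\
  (snd (rho a) = / 2 -> rd (beta x) = (rd (beta x - PI) + 1)%ZZ).
Proof.
move=> ca hx ra; have [_ [_ [_ d]]] := circ_near ca hx.
have [b _] := near_beta ca hx; have {}b : Rabs (beta x - 2 * PI * IZR (rd (beta x))) < 3 * PI / 4 by apply: b; lra.
have pi := PI_RGT_0; have [r [r0 [_ [_ er]]]] := rho_beta x.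
set N := rd (beta x) in b *; set s := beta x - _ in b.
have es : s + 2 * PI * IZR N = beta x by rewrite /s; sring.
have [_ esn] := trigZ s N; rewrite es in esn; rewrite esn in er; rewrite er in d.
split=> sa; rewrite sa in d.
  have sp : 0 < s.
    apply: Rnot_le_lt => sn; have : sin s <= 0.
      by have := sin_ge_0 (- s); rewrite sin_neg; split_Rabs; lra.
    by move: d; split_Rabs; nra.
  by apply/esym/rd_uniq; rewrite -/N; move: b; rewrite /s; split_Rabs; lra.
have sn : s < 0.
  apply: Rnot_le_lt => sp; have : 0 <= sin s by apply: sin_ge_0; split_Rabs; lra.
  by move: d; split_Rabs; nra.
have -> : rd (beta x - PI) = (N - 1)%ZZ.
  by apply: rd_uniq; rewrite minus_IZR; move: b sn; rewrite /s; split_Rabs; lra.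
lia.
Qed.

Lemma circ_deg1 : deg1 circ 1 w.
Proof.
have [|x1 h1] := @circ_pt 0 (- / 2); first lra.
have [|x2 h2] := @circ_pt 0 (/ 2); first lra.
have [c1 [r1 s1]] : circ x1 /\ fst (rho x1) = 0 /\ snd (rho x1) = - / 2 by apply/h1; exact: dist_refl.
have [c2 [r2 s2]] : circ x2 /\ fst (rho x2) = 0 /\ snd (rho x2) = / 2 by apply/h2; exact: dist_refl.
have E12 t : (ptset x1 t \/ ptset x2 t) <-> (arcp t /\ arcn t).
  rewrite -h1 -h2; split.
    by case=> -[ct [rt st]]; do !split=> //; try (by case: ct); rewrite rt; lra.
  move=> [[ct p1] [_ p2]]; have rt : fst (rho t) = 0 by lra.
  have := circ_norm ct; rewrite rt => n.
  have : (snd (rho t) - / 2) * (snd (rho t) + / 2) = 0 by lra.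
  by move/Rmult_integral => [q|q]; [right|left]; do !split=> //; try (by case: ct); lra.
have dp : deg1 (fun t => arcp t /\ arcn t) 0 (fsub k1 k2).
  apply: deg1_ext E12 _; apply: (two_points char2).
  - apply: Rnot_le_lt => d; have z : ldist x1 x2 = 0 by have := ldist_ge0 x1 x2; rewrite /= in d; lra.
    have [|_ [_ [_]]] := @circ_near x1 x2 c1; first by rewrite z; lra.
    by rewrite s1 s2; split_Rabs; lra.
  - move=> p; exists (/ 100); split; first lra.
    move=> s _ [a [/h1 [ca [ra sa]] ha]]; case: s ha => [|x [|y s]] ha; rewrite /fsub /= ?subr0 //.
    have hx : ldist a x < / 100 by apply: ha; left.
    by have [-> //] := poles_rd ca hx ra; rewrite subrr.
  - move=> p; exists (/ 100); split; first lra.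
    move=> s _ [a [/h2 [ca [ra sa]] ha]]; case: s ha => [|x [|y s]] ha; rewrite /fsub /= ?subr0 //.
    have hx : ldist a x < / 100 by apply: ha; left.
    have [_ -> //] := poles_rd ca hx ra; rewrite (pzD char2).
    have -> : pz F 1 = 1%R by [].
    by ring.
have := suspension char2 closed_arcp closed_arcn acyclic_arcp acyclic_arcn _ K_arcp K_arcn dp.
move=> H; apply: deg1_ext (H _).
  move=> t; split; first by case=> -[].
  by move=> ct; case: (Rle_dec 0 (fst (rho t))) => h; [left|right]; split=> //; lra.
by exists x1; apply/E12; left; exact: dist_refl.
Qed.

(** The projective line is the suspension of its equator, which is the suspension of two points; the
    connecting maps take [k1 - k2] to [w] and [w] to [zeta]. *)
Lemma P1_deg1 : deg1 (PV2 e f) 2 (zeta F (m := m)).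
Proof.
have fe' := fe0 ef.
have E12 t : circ t <-> (disc e f t /\ disc f e t).
  rewrite /circ /disc /PV2; lra.
have pidz : pull (fun t : line m => t) (zeta F (m := m)) = zeta F (m := m).
  by apply: functional_extensionality => s; rewrite /pull map_id.
have kz (g : uvec) (A : line m -> Prop) p : (forall t, A t -> / 2 <= ov t g) -> K A p (fsub (zeta F (m := m)) (cob (gauge F id (fun _ => g)))).
  move=> hA; have i2 : 0 < / 2 by lra.
  have := @zeta_gauge F char2 m (line m) id (fun _ => g) A (/ 2) p (@cont_id _) (@cont_const _ _ _) i2 hA.
  by rewrite pidz; apply: K_ext => s _; rewrite /fsub zeta_const subr0.
have := suspension char2 (@closed_disc e f) (@closed_disc f e) (acyclic_disc ef) (acyclic_disc fe') _
   (fun p => kz e _ p (fun t h => proj2 h)) (fun p => kz f _ p (fun t h => proj2 h)) (deg1_ext E12 circ_deg1).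
move=> H; apply: deg1_ext (H _).
  move=> t; rewrite /disc /PV2; split; first by case; lra.
  by move=> pt; case: (Rle_dec (/ 2) (ov t e)) => h; [left|right]; lra.
have [|x1 h1] := @circ_pt 0 (- / 2); first lra.
exists x1; apply/E12.
suff : circ x1 /\ fst (rho x1) = 0 /\ snd (rho x1) = - / 2 by case.
apply/h1; exact: dist_refl.
Qed.

End Circle.
End ProjectiveLine.

(** * Projective spaces and projective bundles *)

Section Powers.
Variable F : fieldType.
Hypothesis char2 : forall x : F, x + x = 0.
Local Ltac fe := apply: functional_extensionality => ?; rewrite /fsub /fadd /fscale /fzero; ring.

Fixpoint cpow (T : Type) (z : seq T -> F) (i : nat) : seq T -> F :=
  if i is i'.+1 then cup (cpow z i') z else @cone F T.

Lemma cup_pure T (x z : seq T -> F) d e : pure d x -> pure e z -> pure (d + e) (cup x z).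
Proof.
move=> px pz s hs; apply: cup_eq0 => s1 s2 _ _ p1 p2 sz.
have [E|n] := eqVneq (size s1) d.+1; last by rewrite px ?mul0r //; exact/eqP.
by rewrite pz ?mulr0 // => E2; apply: hs; lia.
Qed.

Lemma cpow_pure T (z : seq T -> F) i : pure 2 z -> pure i.*2 (cpow z i).
Proof.
move=> pz; elim: i => [|i IH] /=; first by move=> -[|x [|y s]].
by have := cup_pure IH pz; rewrite addn2.
Qed.

Lemma cpow_pull T U (q : U -> T) (z : seq T -> F) i : pull q (cpow z i) = cpow (pull q z) i.
Proof. by elim: i => [|i IH] /=; rewrite ?pull_cone // pull_cup IH. Qed.

Lemma cpow_coc (T : cpm) (A : T -> Prop) (z : seq T -> F) i : (forall q, K A q (cob z)) -> forall q, K A q (cob (cpow z i)).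
Proof.
move=> hz; elim: i => [|i IH] q /=; first by apply: K_le (Z_one char2 A q).
exact: (Z_cup char2).
Qed.

Lemma B_cup_pure (T : cpm) (A : T -> Prop) p e (x z : seq T -> F) : pure e z -> (forall q, K A q (cob z)) ->
  Bc A (p - e) x -> Bc A p (cup x z).
Proof.
move=> pz cz [y hy]; exists (cup y z).
have := K_sub (K_cup_pure pz hy) (K_cupr y (cz p)); congr K.
by rewrite cob_cup // cup_subl; fe.
Qed.

Lemma K_pure (T : cpm) (A : T -> Prop) p e (z : seq T -> F) : pure e z -> (p <= e)%N -> K A p z.
Proof. by move=> pz h; exists 1%Re; split; [lra|move=> s hs _; apply: pz; lia]. Qed.

Definition lcomb T (r : nat) (c : nat -> F) (z : seq T -> F) : seq T -> F :=
  fun s => \sum_(i < r) c i * cpow z i s.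

Lemma lcomb_coc (T : cpm) (A : T -> Prop) r c (z : seq T -> F) : (forall q, K A q (cob z)) -> forall q, K A q (cob (lcomb r c z)).
Proof.
move=> hz q; have h (i : 'I_r) : Zc A q (fscale (c i) (cpow z i)).
  by apply: Z_scale; exact: cpow_coc.
by have := @Z_sum F T A q _ (index_enum 'I_r) (fun i => fscale (c i) (cpow z i)) h; exact: K_le.
Qed.

Lemma lcomb_pull T U (q : U -> T) r c (z : seq T -> F) : pull q (lcomb r c z) = lcomb r c (pull q z).
Proof.
apply: functional_extensionality => s; rewrite /pull /lcomb; apply: eq_bigr => i _.
by rewrite -(cpow_pull q).
Qed.

(* The powers 1, z, ..., z^(r-1) of the degree 2 class z form a basis of the cohomology of A. *)
Definition projT (T : cpm) (A : T -> Prop) (r : nat) (z : seq T -> F) :=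
  (forall p x, Zc A p x -> exists c, Bc A p (fsub x (lcomb r c z))) /\
  (forall p c, Bc A p (lcomb r c z) -> forall i, (i < r)%N -> (i.*2 < p)%N -> c i = 0).

Lemma projT_VB (T U : cpm) (q : U -> T) (W : U -> Prop) (B : T -> Prop) r (z : seq T -> F) :
  cont q -> closed W -> closed B -> (forall u, W u -> B (q u)) ->
  (forall b, B b -> acyclic F (fun u => W u /\ ptset b (q u))) -> (forall p, K B p (cob z)) ->
  projT B r z -> projT W r (pull q z).
Proof.
move=> cq cW cB WB fib cz [sj ij].
have E t : (W t /\ B (q t)) <-> W t by split=> [[]//|h]; split=> //; exact: WB.
split=> [p y zy|p c hc].
  have [|x [zx bx]] := VB_surj char2 cq cW cB fib (p := p) (y := y); first by apply: Z_mono zy => t /E.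
  have [c hc] := sj p x zx; exists c; apply: B_trans (B_mono (fun t => proj2 (E t)) bx) _.
  by have := B_pull cq WB hc; rewrite -lcomb_pull.
apply: ij; apply: (VB_inj char2 cq cW cB fib); first by exact: lcomb_coc.
by rewrite lcomb_pull; apply: B_mono hc => t /E.
Qed.

Lemma projT1 (T : cpm) (A : T -> Prop) (z : seq T -> F) : acyclic F A -> projT A 1 z.
Proof.
move=> [[a Aa] h]; split=> [p x /h [c hc]|p c hc [|//] _ p0].
  by exists (fun _ => c); apply: B_ext hc => s _; rewrite /fsub /lcomb big_ord_recl big_ord0 addr0.
apply: (pt_inj Aa p0); apply: B_ext hc => s _; by rewrite /fscale /lcomb big_ord_recl big_ord0 addr0.
Qed.

Lemma projT2 (T : cpm) (A : T -> Prop) (z : seq T -> F) : pure 2 z -> (exists a, A a) -> deg1 A 2 z -> projT A 2 z.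
Proof.
move=> pz [t0 At0] [sj ij].
have E a b s : (0 < size s)%N -> fadd (fscale a (@cone F T)) (fscale b z) s = lcomb 2 (fun i => if i is 0%N then a else b) z s.
  move=> hs; rewrite /lcomb !big_ord_recl big_ord0 addr0 /= cup1l //; by case: s hs.
split=> [p x /sj [a [b hab]]|p c hc].
  exists (fun i => if i is 0%N then a else b); apply: B_ext hab => s hs; by rewrite /fsub E.
have {}hc : Bc A p (fadd (fscale (c 0%N) (@cone F T)) (fscale (c 1%N) z)).
  apply: B_ext hc => s hs; rewrite E // /lcomb !big_ord_recl !big_ord0 //.
case: (ltnP 2 p) => hp.
  by have [c0 c1] := ij p _ _ hp hc => -[|[|]].
move=> [|[|//]] _; last by lia.
move=> p0; apply: (pt_inj At0 p0).
have k2 : K A p z by exact: K_pure pz hp.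
have := B_sub hc (B_scale (c 1%N) (B_K k2)); congr Bc; fe.
Qed.

End Powers.

(** * Mapping cones and a relative Vietoris-Begle theorem *)

Section Cone.
Variable F : fieldType.
Hypothesis char2 : forall x : F, x + x = 0.
Variables (T U : cpm) (q : U -> T) (W : U -> Prop) (D : T -> Prop).
Hypotheses (cq : cont q) (cW : closed W) (cD : closed D).
Local Ltac fe := apply: functional_extensionality => ?; rewrite /fsub /fadd /fscale /fzero; ring.

Let E := fun u => W u /\ D (q u).
Let cE : closed E.
Proof. by apply: closedI => //; exact: closed_pre. Qed.

Let O1 := over_mvt char2 cq cW.
Let O2 := over_mvt char2 (@cont_id T) cD.
Let O3 := over_mvt char2 cq cE.

Definition coneX := (seq U + (seq T + seq U))%type.
Definition c1 (x : coneX -> F) := fun s => x (inl s).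
Definition c2 (x : coneX -> F) := fun s => x (inr (inl s)).
Definition c3 (x : coneX -> F) := fun s => x (inr (inr s)).
Definition mk3 (a : seq U -> F) (b : seq T -> F) (c : seq U -> F) : coneX -> F := fun i =>
  match i with inl s => a s | inr (inl s) => b s | inr (inr s) => c s end.
(** In a mapping cone the component on [E] sits one degree lower, hence [p.-1]. *)
Definition coneK (A : T -> Prop) p (x : coneX -> F) :=
  K (fun u => W u /\ A (q u)) p (c1 x) /\ K (fun t => D t /\ A t) p (c2 x) /\
  K (fun u => E u /\ A (q u)) p.-1 (c3 x).
Definition coned (x : coneX -> F) : coneX -> F :=
  mk3 (cob (c1 x)) (cob (c2 x)) (fsub (fsub (c1 x) (pull q (c2 x))) (cob (c3 x))).

(* Mapping cone of C(W) + C(D) -> C(E), where E is the part of W over D. *)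
Definition cone_mvt : mvt F T.
Proof.
refine (@Mvt F T coneX coneK coned _ _ _ _ _ _ _ _ _ _ _).
- move=> a b; apply: functional_extensionality => -[s|[s|s]] /=.
  + by rewrite (_ : c1 (fsub a b) = fsub (c1 a) (c1 b)) // cob_sub.
  + by rewrite (_ : c2 (fsub a b) = fsub (c2 a) (c2 b)) // cob_sub.
  + rewrite (_ : c3 (fsub a b) = fsub (c3 a) (c3 b)) // cob_sub /fsub /coned /= /fsub /pull /c1 /c2; ring.
- move=> x; apply: functional_extensionality => -[s|[s|s]] /=.
  + by rewrite /fzero (_ : c1 (coned x) = cob (c1 x)) // cob_cob.
  + by rewrite /fzero (_ : c2 (coned x) = cob (c2 x)) // cob_cob.
  + rewrite (_ : c1 (coned x) = cob (c1 x)) // (_ : c2 (coned x) = cob (c2 x)) //.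
    rewrite (_ : c3 (coned x) = (fsub (fsub (c1 x) (pull q (c2 x))) (cob (c3 x)))) //.
    by rewrite !cob_sub pull_cob cob_cob // /fsub /fzero; ring.
- by move=> A x; do !split; exact: K_0.
- by move=> A p; do !split; exact: K_z.
- by move=> A p x y [a [b c]] [a' [b' c']]; do !split; exact: K_sub.
- move=> A A' p x h [a [b c]]; split; first by apply: K_mono a => u [? /h].
  by split; [apply: K_mono b => u [? /h]|apply: K_mono c => u [? /h]].
- move=> A p x [a [b c]]; split; first exact: K_d.
  split; first exact: K_d.
  apply: K_sub.
    apply: K_sub; first by apply: K_mono a => u [[]].
    by apply: K_pull b => // u [[]].
  by apply: K_le (K_d c); lia.
- move=> p x; do !split; by apply: K_mono (K_emp _ _) => t [].
- move=> A A' p x [a [b c]] [a' [b' c']].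
  by split; [|split]; [apply: K_mono (K_U a a')|apply: K_mono (K_U b b')|apply: K_mono (K_U c c')] => t [? [|]] ?; tauto.
- move=> A A' p x cA cA' [a [b c]].
  have [y1 [h1 h1']] := @mK_I _ _ O1 A A' p (c1 x) cA cA' a.
  have [y2 [h2 h2']] := @mK_I _ _ O2 A A' p (c2 x) cA cA' b.
  have [y3 [h3 h3']] := @mK_I _ _ O3 A A' p.-1 (c3 x) cA cA' c.
  by exists (mk3 y1 y2 y3).
- move=> b p x [k1 [k2 k3]].
  have [d1 [p1 h1]] := @mK_loc _ _ O1 b p (c1 x) k1.
  have [d2 [p2 h2]] := @mK_loc _ _ O2 b p (c2 x) k2.
  have [d3 [p3 h3]] := @mK_loc _ _ O3 b p.-1 (c3 x) k3.
  have m1 := Rmin_l d1 (Rmin d2 d3); have m2 := Rmin_r d1 (Rmin d2 d3).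
  have m3 := Rmin_l d2 d3; have m4 := Rmin_r d2 d3.
  exists (Rmin d1 (Rmin d2 d3)); split; first by do !apply: Rmin_glb_lt.
  split; [|split]; [apply: K_mono h1|apply: K_mono h2|apply: K_mono h3] => t [?]; rewrite /cball => ?; split=> //; rewrite /=; lra.
Defined.

Let cT : @closed T (fun _ => True).
Proof. by move=> x nx; case: nx. Qed.
Let M := over_mvt char2 (@cont_id T) cT.
Let th (x : mX M -> F) : mX cone_mvt -> F := mk3 (pull q x) x (@fzero F _).

Variable B : T -> Prop.
Hypothesis cB : closed B.
Hypothesis fibD : forall b, B b -> D b \/ (~ D b /\ acyclic F (fun u => W u /\ ptset b (q u))).

(** The cohomology of the base is compared with that of the cone. Over a point of [D] the parts on
    [W] and [E] coincide and cancel; off [D] only the acyclic fibre of [W] remains. Hence a class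
    vanishes once it bounds on [W] and on [D] with primitives compatible over [E]. *)
Lemma cone_compare p (x : seq T -> F) : Zc B p x ->
  (exists y1 y2 y3, K (fun u => W u /\ B (q u)) p (fsub (pull q x) (cob y1)) /\
     K (fun t => D t /\ B t) p (fsub x (cob y2)) /\
     K (fun u => E u /\ B (q u)) p.-1 (fsub (fsub y1 (pull q y2)) (cob y3))) -> Bc B p x.
Proof.
have th_sub a b : th (fsub a b) = fsub (th a) (th b).
  by apply: functional_extensionality => -[s|[s|s]] //=; rewrite /fsub /fzero /= subr0.
have th_K A r a : mK A r a -> mK A r (th a).
  move=> h; split; first by apply: K_pull h => // u [].
  by split; [apply: K_mono h => t []|exact: K_z].
have th_d r a : mK B r (fsub (th (md a)) (md (th a))).
  have -> : fsub (th (md a)) (md (th a)) = @fzero F _.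
    apply: functional_extensionality => -[s|[s|s]] /=; rewrite /fsub /fzero /=.
    + by rewrite (_ : c1 (th a) = pull q a) // -pull_cob subrr.
    + by rewrite (_ : c2 (th a) = a) // subrr.
    + rewrite (_ : c1 (th a) = pull q a) // (_ : c2 (th a) = a) // (_ : c3 (th a) = @fzero F _) //.
      by rewrite /fsub cob_eq0 // !subrr.
  exact: mK_z.
have C := @comparison F T M cone_mvt B th th_sub th_K th_d cB.
have pts b r : B b -> minj th (ptset b) r /\ msurj th (ptset b) r.
  move=> Bb; case: (fibD Bb) => [Db|[nDb [[w [Ww pw]] ac]]].
    have pD := closed_pt_sub cD Db; split.
      move=> a za [y [_ [h2 _]]]; exists (c2 y).
      by apply: K_mono h2 => t [_ pt]; split=> //; exact: pD.
    move=> y [h1 [h2 h3]]; exists (c2 y); split.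
      by apply: K_mono h2 => t [_ pt]; split=> //; exact: pD.
    exists (mk3 (c3 y) (@fzero F _) (@fzero F _)).
    have e3 : K (fun u => W u /\ ptset b (q u)) r (fsub (fsub (c1 y) (pull q (c2 y))) (cob (c3 y))).
      by apply: K_mono h3 => u [wu pu]; split=> //; split=> //; exact: pD.
    split; first by move: e3; congr K; fe.
    split.
      by apply: K_ext (K_z F _ r) => s _; rewrite /c2 /fsub /= /fsub cob_eq0 // !subrr.
    apply: K_ext (K_z F _ r.-1) => s _; rewrite /c3 /fsub /= /fsub /fzero /pull /c1 /c2 /=.
    by rewrite cob_eq0 // !subr0 subrr.
  have none t : D t -> ~ ptset b t.
    move=> Dt pt; apply: nDb; apply: (closed_pt_sub cD Dt); by rewrite /ptset dist_sym.
  split.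
    move=> a za [y [h1 _]]; have [y' hy'] := pt_class char2 (b := b) (p := r) (x := a) (K_mono (fun t pt => conj I pt) za).
    case: r za h1 hy' => [|r] za h1 hy'; first by exists (@fzero F _); exact: K_0.
    have z : a [:: b] = 0.
      apply: (@pt_inj F U w (fun u => W u /\ ptset b (q u)) r.+1 _ (conj Ww pw)) => //.
      exists (fsub (c1 y) (pull q y')).
      have k := K_pull cq (fun u (h : W u /\ ptset b (q u)) => proj2 h) hy'.
      have := K_sub h1 k; rewrite cob_sub -pull_cob; apply: K_ext => s _.
      by rewrite /c1 /fsub /= /fsub /pull /fscale -(pull_cone F q) /pull; ring.
    exists y'; apply: (@K_mono _ _ (ptset b)); first by move=> t [].
    by apply: K_ext hy' => s _; rewrite /fsub /fscale z mul0r subr0.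
  move=> y [h1 _]; have [c [y' hc]] := ac r (c1 y) h1.
  exists (fscale c (@cone F T)); split; first by apply: Z_scale; exact: Z_one.
  exists (mk3 y' (@fzero F _) (@fzero F _)); split.
    move: hc; congr K; apply: functional_extensionality => s.
    by rewrite /c1 /fsub /= /fsub /pull /fscale -(pull_cone F q).
  by split; apply: K_mono (K_emp _ _) => t [h]; [|case: h => _ h]; apply: none.
move=> zx [y1 [y2 [y3 [h1 [h2 h3]]]]].
have [ij _] := C pts p.
have [] := ij x.
- by apply: K_mono zx => t [].
- exists (mk3 y1 y2 y3); split; first exact: h1.
  split; first exact: h2.
  by apply: K_ext (K_sub (K_z F _ p.-1) h3) => s _.
by move=> y hy; exists y; apply: K_mono hy.
Qed.

End Cone.

(** * Orthonormal frames and the blow-up of a point *)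

Section Frames.
Local Close Scope ring_scope.
Local Open Scope R_scope.
Variable m : nat.
Notation uvec := (uvec m).
Implicit Types (e : nat -> uvec) (u w : uvec).

Definition onf (r : nat) e := forall i j, (i < r)%nat -> (j < r)%nat -> i <> j -> ip (e i) (e j) = RtoC 0.

Fixpoint osum (r : nat) e u : R := match r with O => 0 | S p => osum p e u + ov u (e p) end.
Fixpoint csum (r : nat) (f : nat -> C) : C := match r with O => RtoC 0 | S p => (csum p f + f p)%C end.
Fixpoint resid (r : nat) e u : cvec :=
  match r with O => uv u | S p => vadd (resid p e u) (vscale (- ip u (e p))%C (uv (e p))) end.

Lemma csum0 r f : (forall i, (i < r)%nat -> f i = RtoC 0) -> csum r f = RtoC 0.
Proof.
elim: r => [//|r IH] h /=; rewrite IH ?h; [by sring|lia|].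
by move=> i hi; apply: h; lia.
Qed.

Lemma resid_dot r e u x : hdot m (resid r e u) x = (hdot m (uv u) x - csum r (fun i => ip u (e i) * hdot m (uv (e i)) x))%C.
Proof.
elim: r => [|r IH] /=; first by sring.
by rewrite hdot_addl hdot_scalel IH; sring.
Qed.

Lemma resid_norm r e u : onf r e -> norm2 m (resid r e u) = 1 - osum r e u.
Proof.
elim: r => [|r IH] h /=; first by rewrite uv1; lra.
have hr : onf r e by move=> i j hi hj; apply: h; lia.
rewrite norm2_comb uv1 (IH hr) resid_dot csum0 => [|i hi]; last first.
  by rewrite -/(ip (e i) (e r)) h; [sring|lia|lia|lia].
by rewrite -/(ip u (e r)) /ov /Cnorm2 /=; sring.
Qed.

Lemma bessel r e u : onf r e -> osum r e u <= 1.
Proof. by move=> h; have := resid_norm u h; have := norm2_ge0 m (resid r e u); lra. Qed.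

Lemma expand r e u x : onf r e -> osum r e u = 1 ->
  hdot m (uv u) x = csum r (fun i => ip u (e i) * hdot m (uv (e i)) x)%C.
Proof.
move=> h h1; have n0 : norm2 m (resid r e u) = 0 by rewrite resid_norm // h1; lra.
have d0 : hdot m (resid r e u) x = RtoC 0.
  apply: Cmod_eq_0; have := CSmod m (resid r e u) x; rewrite /vnorm n0 sqrt_0 Rmult_0_l.
  by have := Cmod_ge_0 (hdot m (resid r e u) x); lra.
rewrite resid_dot in d0; set a := hdot _ _ _ in d0 *; set b := csum _ _ in d0 *.
have -> : a = (a - b + b)%C by sring.
by rewrite d0; sring.
Qed.

Lemma osum_orth r e u : onf r.+1 e -> osum r e u = 1 -> ip u (e r) = RtoC 0.
Proof.
move=> h h1; have /= := bessel u h; rewrite h1 => b.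
have o0 : ov u (e r) = 0 by have := ov_bd u (e r); lra.
by apply: Cmod_eq_0; have := Cmod_sqr (ip u (e r)); rewrite -/(ov u (e r)) o0; have := Cmod_ge_0 (ip u (e r)); nra.
Qed.

Lemma rcont_osum (T : cpm) r e (g : T -> line m) : cont g -> rcont (fun t => osum r e (g t)).
Proof.
move=> cg; elim: r => [|r IH] /=; first by move=> t x x0; exists 1; split; [lra|move=> v _; rewrite Rminus_diag Rabs_R0].
by apply: rcont_add => //; apply: rcont_ov => //; exact: cont_const.
Qed.

(** Equality in Bessel's inequality: the lines lying in the span of the frame, as a closed condition
    without linear combinations. *)
Definition PV (r : nat) e : line m -> Prop := fun u => osum r e u = 1.

Lemma closed_PV r e : closed (PV r e).
Proof. by apply: (@closed_eq (line m) (fun u => osum r e u)); apply: rcont_osum; exact: cont_id. Qed.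

Lemma osum_scale r e (u w : uvec) c : (forall i, (i < r)%nat -> ip u (e i) = (c * ip w (e i))%C) ->
  osum r e u = Cnorm2 c * osum r e w.
Proof.
elim: r => [|r IH] h /=; first by lra.
rewrite IH => [|i hi]; last by apply: h; lia.
by rewrite /ov h; [rewrite Cnorm2_mult; sring|lia].
Qed.

Lemma osum_basis r e i : onf r e -> (i < r)%nat -> osum r e (e i) = 1.
Proof.
move=> h hi.
have z k : (k <= i)%nat -> osum k e (e i) = 0.
  elim: k => [//|k IH] hk /=; rewrite IH; last lia.
  by rewrite /ov h /Cnorm2 /=; [lra|lia|lia|lia].
have z' k : (i < k)%nat -> (k <= r)%nat -> osum k e (e i) = 1.
  elim: k => [|k IH] hk hr; first lia.
  rewrite /=; case: (PeanoNat.Nat.eq_dec k i) => [->|n]; first by rewrite z // ov_self; lra.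
  by rewrite IH; [|lia|lia]; rewrite /ov h /Cnorm2 /=; [lra|lia|lia|lia].
by apply: z'; lia.
Qed.

(* The incidence variety {(L,M) : M in P(e_0..e_(r-1)), L in P(M + e_r)}. *)
Definition blow r e (x : prodc (line m) (line m)) := PV r e x.2 /\ ov x.1 (e r) + ov x.1 x.2 = 1.

Lemma closed_blow r e : closed (blow r e).
Proof.
have c1 := @cont_fst (line m) (line m); have c2 := @cont_snd (line m) (line m).
apply: closedI; first exact: (closed_pre c2 (@closed_PV r e)).
apply: (@closed_eq (prodc (line m) (line m)) (fun x => ov x.1 (e r) + ov x.1 x.2)).
by apply: rcont_add; apply: rcont_ov => //; exact: cont_const.
Qed.

Section Step.
Variables (r : nat) (e : nat -> uvec).
Hypothesis he : onf r.+1 e.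
Let he' : onf r e.
Proof. by move=> i j hi hj; apply: he; lia. Qed.

Lemma PV_orth w : PV r e w -> ip (e r) w = RtoC 0.
Proof.
by move=> h; rewrite ip_conj (osum_orth he h); apply: Ceq => /=; lra.
Qed.

Lemma blow_PV L w : blow r e (L, w) -> PV r.+1 e L.
Proof.
move=> [/= hw h]; have o := PV_orth hw.
rewrite /PV /= (@osum_scale r e L w (ip L w)).
  by rewrite hw Rmult_1_r -/(ov L w); lra.
move=> i hi; have p2 : PV2 (e r) w L by rewrite /PV2.
rewrite (PV2_expand o (e i) p2) he; [|lia|lia|lia]; sring.
Qed.

Lemma blow_ex L : PV r.+1 e L -> ov L (e r) < 1 -> exists w, blow r e (L, w).
Proof.
move=> hL lt; rewrite /PV /= in hL; set c := ip L (e r).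
have o0 : 0 < 1 - ov L (e r) by lra.
pose d := sqrt (1 - ov L (e r)).
have d0 : 0 < d by exact: sqrt_lt_R0.
have dd : d * d = 1 - ov L (e r) by apply: sqrt_sqrt; lra.
pose x := vscale (RtoC (/ d)) (vadd (uv L) (vscale (- c)%C (uv (e r)))).
have n1 : norm2 m x = 1.
  rewrite norm2E /x hdot_scalel hdot_scaler hdot_self norm2_proj -/c.
  have -> : (c - c = RtoC 0)%C by sring.
  transitivity (/ d * / d * (d * d)); first by rewrite dd /Cnorm2 /=; sring.
  by sfield; lra.
pose w : uvec := exist _ x n1.
have dw y : ip w y = (RtoC (/ d) * (ip L y - c * ip (e r) y))%C.
  by rewrite /ip /= /x hdot_scalel hdot_addl hdot_scalel; sring.
have hw : osum r e w = 1.
  rewrite (@osum_scale r e w L (RtoC (/ d))).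
    transitivity (/ d * / d * (d * d)); last by sfield; lra.
    have eo : osum r e L = 1 - ov L (e r) by lra.
    by rewrite dd eo /Cnorm2 /=; sring.
  by move=> i hi; rewrite dw he; [sring|lia|lia|lia].
exists w; split=> //=.
rewrite (ov_sym L w) {2}/ov (dw L) ip_self.
have -> : (c * ip (e r) L = RtoC (ov L (e r)))%C.
  by rewrite ip_conj /c /ov; apply: Ceq => /=; rewrite /Cnorm2; sring.
rewrite -RtoC_minus -dd -RtoC_mult.
have -> : / d * (d * d) = d by sfield; lra.
have -> : Cnorm2 (RtoC d) = d * d by rewrite /Cnorm2 /=; sring.
by rewrite -/(ov L (e r)) dd; lra.
Qed.

Lemma blow_uniq L w w' : ov L (e r) < 1 -> blow r e (L, w) -> blow r e (L, w') -> ldist w w' = 0.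
Proof.
move=> lt [/= hw h] [/= hw' h'].
have o := PV_orth hw; have o' := PV_orth hw'.
have p2 : PV2 (e r) w L by rewrite /PV2.
have E := PV2_expand o w' p2; rewrite o' in E.
have {}E : ip L w' = (ip L w * ip w w')%C by rewrite E; sring.
have : ov L w' = ov L w * ov w w' by rewrite /ov E Cnorm2_mult.
have e1 : ov L w = 1 - ov L (e r) by lra.
have e2 : ov L w' = 1 - ov L (e r) by lra.
rewrite e1 e2 => h1; have o1 : ov w w' = 1 by apply: (Rmult_eq_reg_l (1 - ov L (e r))); lra.
by rewrite /ldist o1 Rminus_diag sqrt_0.
Qed.

Variable F : fieldType.
Hypothesis char2 : (forall x : F, x + x = 0)%R.
Notation U := (prodc (line m) (line m)).

Lemma blow_fibre (L : line m) : PV r.+1 e L -> ov L (e r) < 1 ->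
  acyclic F (fun x : U => blow r e x /\ @ptset (line m) L x.1).
Proof.
move=> hL lt; have [w hw] := blow_ex hL lt.
apply: (acyclic_pt char2 (b := (L, w) : U)) => -[L' w'] /=.
have cb := @closed_blow r e.
split.
  move=> [hb pL].
  have hb' : blow r e (L, w').
    apply: (closed_pt_sub cb hb); rewrite /ptset /= ldist_refl; rewrite /ptset /= in pL.
    by rewrite ldist_sym pL Rmax_left; lra.
  have d := blow_uniq lt hw hb'.
  by rewrite /ptset /= in pL *; rewrite pL d Rmax_left; lra.
move=> h; split; first exact: (closed_pt_sub cb hw h).
move: h; rewrite /ptset /=; have := Rmax_l (ldist L L') (ldist w w'); have := ldist_ge0 L L'; lra.
Qed.

Lemma blow_fibre2 (L w : line m) : PV r e w -> PV2 (e r) w L ->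
  acyclic F (fun x : U => (blow r e x /\ @ptset (line m) w x.2) /\ @ptset (line m) L x.1).
Proof.
move=> hw hL; apply: (acyclic_pt char2 (b := (L, w) : U)) => -[L' w'] /=.
have cb := @closed_blow r e; have hb : blow r e (L, w) by [].
rewrite /ptset /=; split.
  by move=> [[_ ->] ->]; rewrite Rmax_left; lra.
move=> h; have h' : @ptset U (L, w) (L', w') := h.
have m1 := Rmax_l (ldist L L') (ldist w w'); have m2 := Rmax_r (ldist L L') (ldist w w').
have g1 := ldist_ge0 L L'; have g2 := ldist_ge0 w w'.
by split; [split; [exact: (closed_pt_sub cb hb h')|lra]|lra].
Qed.

Lemma exceptional_fibre (w : line m) : PV r e w ->
  acyclic F (fun x : U => (blow r e x /\ @ptset (line m) (e r) x.1) /\ @ptset (line m) w x.2).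
Proof.
move=> hw; have o := PV_orth hw.
have p2 : PV2 (e r) w (e r : line m).
  by rewrite /PV2 ov_self /ov o /Cnorm2 /=; lra.
by apply: acyclic_ext (blow_fibre2 hw p2) => t; tauto.
Qed.

End Step.
End Frames.

(** * Cohomology of projective spaces, by blowing up a point *)

Section ProjectiveBundle.
Variable F : fieldType.
Hypothesis char2 : forall x : F, x + x = 0.
Local Ltac fe := apply: functional_extensionality => ?; rewrite /fsub /fadd /fscale /fzero; ring.

Definition extn (A : Type) (a0 : A) r (c : 'I_r -> A) : nat -> A := fun i => oapp c a0 (insub i).

Lemma extnE (A : Type) (a0 : A) r (c : 'I_r -> A) (i : 'I_r) : extn a0 c i = c i.
Proof. by rewrite /extn valK. Qed.

Lemma cup_ext T (x x' y y' : seq T -> F) : (forall u, (0 < size u)%N -> x u = x' u) ->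
  (forall u, (0 < size u)%N -> y u = y' u) -> cup x y = cup x' y'.
Proof.
move=> hx hy; apply: functional_extensionality => s.
transitivity (cup x' y s); apply/eqP; rewrite -subr_eq0; apply/eqP.
  rewrite -/(fsub (cup x y) (cup x' y) s) -cup_subl.
  by apply: cup_eq0 => s1 s2 _ _ h1 _ _; rewrite /fsub hx // subrr mul0r.
rewrite -/(fsub (cup x' y) (cup x' y') s) -cup_subr.
by apply: cup_eq0 => s1 s2 _ _ _ h2 _; rewrite /fsub hy // subrr mulr0.
Qed.

Section PBT.
Variables (T U : cpm) (q : U -> T) (W : U -> Prop) (B : T -> Prop) (r : nat) (z : seq U -> F).
Hypotheses (cq : cont q) (cW : closed W) (cB : closed B).
Hypothesis zpure : pure 2 z.
Hypothesis zcoc : forall p, K W p (cob z).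
Hypothesis fib : forall b, B b -> projT (fun u => W u /\ ptset b (q u)) r z.
Let WB := fun u => W u /\ B (q u).
Let e (i : 'I_r) := i.*2.
Let zz (i : 'I_r) := cpow z i.

Let zp i : pure (e i) (zz i).
Proof. exact: cpow_pure. Qed.
Let zc i p : K W p (cob (zz i)).
Proof. exact: cpow_coc. Qed.
Let fs b p y : B b -> Zc (fun u => W u /\ ptset b (q u)) p y ->
  exists c : 'I_r -> F, Bc (fun u => W u /\ ptset b (q u)) p (fsub y (fun s => \sum_(i < r) c i * zz i s)).
Proof. by move=> Bb /(proj1 (fib Bb)) [c hc]; exists (fun i => c i). Qed.
Let fi b p (c : 'I_r -> F) : B b -> Bc (fun u => W u /\ ptset b (q u)) p (fun s => \sum_(i < r) c i * zz i s) ->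
  forall i, (e i < p)%N -> c i = 0.
Proof.
move=> Bb h i hi; rewrite -(extnE 0 c i).
apply: (proj2 (fib Bb) p (extn 0 c)) => //; apply: B_ext h => s _.
by apply: eq_bigr => j _; rewrite extnE.
Qed.

Lemma PBT_inj p (x : nat -> seq T -> F) : (forall i, (i < r)%N -> K B (p.+1 - i.*2) (cob (x i))) ->
  Bc WB p (fun s => \sum_(i < r) cup (pull q (x i)) (cpow z i) s) ->
  forall i, (i < r)%N -> Bc B (p - i.*2) (x i).
Proof.
move=> zx bx i hi.
have := @LH_inj F char2 T U q W B r e zz cq cW cB zp zc fs fi p (fun i => x i) _ bx (Ordinal hi).
by apply=> j; exact: zx.
Qed.

Lemma PBT_surj p (y : seq U -> F) : Zc WB p y -> exists x : nat -> seq T -> F,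
  (forall i, (i < r)%N -> K B (p.+1 - i.*2) (cob (x i))) /\
  Bc WB p (fsub y (fun s => \sum_(i < r) cup (pull q (x i)) (cpow z i) s)).
Proof.
move=> /(LH_surj char2 cq cW cB zp zc fs fi) [x [zx bx]].
exists (extn (@fzero F _) x); split.
  by move=> i hi; rewrite -[i]/(val (Ordinal hi)) extnE; exact: zx.
by apply: B_ext bx => s _; rewrite /fsub; congr (_ - _); apply: eq_bigr => i _; rewrite extnE.
Qed.
End PBT.

Section Step.
Variables (m r : nat) (e : nat -> uvec m).
Hypothesis he : onf r.+1 e.
Notation U := (prodc (line m) (line m)).
Notation z := (zeta F (m := m)).
Notation B := (PV r.+1 e).
Notation V := (PV r e).
Notation W := (blow r e).
Hypothesis IH : projT V r z.
Let zL : seq U -> F := pull fst z.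
Let h : seq U -> F := pull snd z.
Let D : line m -> Prop := ptset (e r : line m).

Let c1 := @cont_fst (line m) (line m).
Let c2 := @cont_snd (line m) (line m).
Let cW := @closed_blow m r e.
Let cV := @closed_PV m r e.
Let cB := @closed_PV m r.+1 e.
Let cD : closed D := @closed_pt (line m) (e r).

Let zcoc (A : line m -> Prop) p : K A p (cob z).
Proof. exact: zeta_cocycle. Qed.
Let zLcoc (A : U -> Prop) p : K A p (cob zL).
Proof. by rewrite /zL -pull_cob; apply: (K_pull (B := fun _ => True) c1) => //; exact: zcoc. Qed.
Let hcoc (A : U -> Prop) p : K A p (cob h).
Proof. by rewrite /h -pull_cob; apply: (K_pull (B := fun _ => True) c2) => //; exact: zcoc. Qed.
Let zLpure : pure 2 zL.
Proof. by move=> s hs; rewrite /zL /pull zeta_pure // size_map. Qed.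

Let WB u : W u -> B u.1.
Proof. by case: u => L w; exact: blow_PV. Qed.

Let fib2 w : V w -> projT (fun u : U => W u /\ ptset w u.2) 2 zL.
Proof.
move=> hw; have o := PV_orth he hw.
have cS : closed (fun u : U => W u /\ ptset w u.2).
  by apply: closedI => //; apply: (closed_pre c2); exact: closed_pt.
apply: (@projT_VB F char2 (line m) U fst _ (PV2 (e r) w)) => //.
- exact: closed_PV2.
- move=> [L w'] [hb pw] /=.
  have hd : @ptset U (L, w') (L, w).
    rewrite /ptset /= ldist_refl Rmax_right; first by rewrite ldist_sym.
    by rewrite ldist_sym; rewrite /ptset /= in pw; rewrite pw; lra.
  by case: (closed_pt_sub cW hb hd).
- by move=> L hL; exact: (blow_fibre2 (e := e)).
- apply: projT2; [exact: zeta_pure| |exact: (P1_deg1 char2 o)].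
  by exists (e r); rewrite /PV2 ov_self /ov o /Cnorm2 /=; lra.
Qed.

(** The line L lies in the plane of w and e_r, so it has overlap at least 1/2 with one of them: in
    the first case zL = h, in the second zL = 0. *)
Let relation p : Bc W p (fsub (cup h zL) (cup zL zL)).
Proof.
have i4 : (0 < / 2)%Re by lra.
have n1 : Bc (fun u : U => (/ 2 <= ov u.2 u.1)%Re) p (fsub h zL).
  exact: (zeta_null char2 p c2 c1 i4).
have n2 : Bc (fun u : U => (/ 2 <= ov u.1 (e r))%Re) p zL.
  have := @zeta_null F char2 m U fst (fun _ => e r) (fun u : U => (/ 2 <= ov u.1 (e r))%Re) _ p c1 (@cont_const _ _ _) i4 (fun t h => h).
  by apply: B_ext => s _; rewrite /fsub zeta_const subr0.
rewrite -cup_subl; apply: (B_cup_cover char2 _ _ _ n1 n2).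
- move=> [L w] [_ /= hL]; rewrite (ov_sym w L).
  by case: (Rle_dec (/ 2) (ov L w)) => d; [left|right]; lra.
- by move=> p'; rewrite cob_sub; apply: K_sub.
- by [].
Qed.

Let hz_pow i p : Bc W p (fsub (cup (cpow h i) zL) (cpow zL i.+1)).
Proof.
elim: i p => [|i IHi] p /=; first by apply: B_K; apply: K_ext (K_z F W p) => s _; rewrite /fsub subrr.
rewrite -cup_assoc.
have s1 : Bc W p (fsub (cup (cpow h i) (cup h zL)) (cup (cpow h i) (cup zL zL))).
  by rewrite -cup_subr; apply: (B_cupr char2) => // p'; exact: cpow_coc.
apply: B_trans s1 _; rewrite cup_assoc.
by rewrite -cup_subl; apply: (B_cupl char2).
Qed.

Let lcomb_shift b p : Bc W p (fsub (cup (lcomb r b h) zL) (fun s => \sum_(i < r) b i * cpow zL i.+1 s)).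
Proof.
have := @B_sum F U W p _ (index_enum 'I_r) (fun i => fscale (b i) (fsub (cup (cpow h i) zL) (cpow zL i.+1))) (fun i => B_scale (b i) (hz_pow i p)).
apply: B_ext => s _; rewrite [RHS]/fsub.
have -> : cup (lcomb r b h) zL s = \sum_(i < r) b i * cup (cpow h i) zL s.
  rewrite /lcomb; elim: (index_enum 'I_r) => [|i l IHl].
    by rewrite big_nil cup_eq0 // => s1 s2 _ _ _ _ _; rewrite big_nil mul0r.
  rewrite big_cons -IHl.
  have -> : (fun s0 => \sum_(j <- i :: l) b j * cpow h j s0) = fadd (fscale (b i) (cpow h i)) (fun s0 => \sum_(j <- l) b j * cpow h j s0).
    by apply: functional_extensionality => u; rewrite big_cons.
  by rewrite cup_addl // cup_scalel.
by rewrite -sumrB; apply: eq_bigr => i _; rewrite /fscale /fsub mulrBr.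
Qed.

Let zD p : Bc D p z.
Proof.
have i4 : (0 < / 2)%Re by lra.
have := @zeta_null F char2 m (line m) id (fun _ => e r) D _ p (@cont_id _) (@cont_const _ _ _) i4 _.
move=> H; have {}H := H _; have := H.
have pidz : pull (fun t : line m => t) z = z.
  by apply: functional_extensionality => s; rewrite /pull map_id.
rewrite pidz => {}H.
have : Bc D p (fsub z (pull (fun _ : line m => e r) z)).
  apply: H => t; rewrite /D /ptset /= /ldist => hd.
  have o := ov_bd (e r) t; have : (1 - ov (e r) t = 0)%Re by apply: sqrt_eq_0 hd; lra.
  by rewrite /= (ov_sym t); lra.
by apply: B_ext => s _; rewrite /fsub zeta_const subr0.
Qed.

Let zDpow i p : Bc D p (cpow z i.+1).
Proof. by apply: (B_cupr char2) => // p'; exact: cpow_coc. Qed.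

Let zconst i s : pull (fun _ : line m => e r) (cpow z i.+1) s = 0.
Proof. by rewrite /= pull_cup; apply: cup_eq0 => s1 s2 _ _ _ _ _; rewrite zeta_const mulr0. Qed.

Let j (w : line m) : U := (e r : line m, w).
Let cj : cont j.
Proof. by apply: cont_pair; [exact: cont_const|exact: cont_id]. Qed.
Let jW w : V w -> W (j w).
Proof.
move=> hw; split=> //=; rewrite ov_self.
by rewrite /ov (PV_orth he hw) /Cnorm2 /=; lra.
Qed.

(** Restriction to the point e_r gives the constant term. On the blow-up, a projective line bundle
    over the smaller space, the remainder is a polynomial in h times zL, whose coefficients vanish
    by induction. *)
Let step_inj p c : Bc B p (lcomb r.+1 c z) -> forall i, (i < r.+1)%N -> (i.*2 < p)%N -> c i = 0.
Proof.
move=> hc.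
have Der : B (e r) by rewrite /PV; apply: osum_basis => //; lia.
have c0 : (0 < p)%N -> c 0%N = 0.
  move=> p0; apply: (@pt_inj F (line m) (e r) B p (c 0%N) Der p0).
  have := @B_pull F (line m) (line m) (fun _ : line m => e r) B B p _ (@cont_const (line m) (line m) (e r)) (fun u _ => Der) hc.
  apply: B_ext => s _; rewrite /pull /lcomb big_ord_recl big1 ?addr0 => [|i _].
    by rewrite /fscale /=; case: s => [|? [|? ?]].
  by have := zconst i s; rewrite /pull lift0 => ->; rewrite mulr0.
case: (posnP p) => [->|p0]; first by move=> i _; lia.
have {}c0 := c0 p0.
have b1 : Bc W p (fun s => \sum_(i < r) c i.+1 * cpow zL i.+1 s).
  have := B_pull c1 WB hc; apply: B_ext => s _.
  by rewrite lcomb_pull /lcomb big_ord_recl c0 mul0r add0r.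
have b2 := B_congr (lcomb_shift (fun i => c i.+1) p) b1.
have E u : (W u /\ V u.2) <-> W u by split=> [[]//|hu]; split=> //; case: hu.
pose x i := if i is 0%N then @fzero F _ else lcomb r (fun i => c i.+1) z.
have := @PBT_inj (line m) U snd W V 2 zL c2 cW cV zLpure (@zLcoc W) fib2 p x _ _ 1%N isT.
move=> H; have {}H : Bc V (p - 2) (lcomb r (fun i => c i.+1) z).
  apply: H.
    move=> [|i] _ /=; last exact: lcomb_coc.
    by apply: K_ext (K_z F V _) => s _; rewrite cob_eq0.
  apply: (B_mono (fun t => proj1 (E t))); apply: B_ext b2 => s hs.
  rewrite !big_ord_recl big_ord0 addr0 /= /x.
  have -> : cup (pull snd (@fzero F (seq (line m)))) (cone F (T := U)) s = 0.
    by apply: cup_eq0 => *; rewrite mul0r.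
  rewrite add0r lcomb_pull; congr (_ s); apply: cup_ext => // u hu.
  by rewrite cup1l //; case: u hu.
move=> [|i] hi hp //; apply: (proj2 IH _ _ H); lia.
Qed.

(** After removal of the value at e_r, the pullback of x to the blow-up has the form a(h) + b(h) zL.
    The first term dies on the exceptional divisor and the second is the pullback of a polynomial S
    in z. The difference x' - S bounds on the blow-up and near e_r, which [cone_compare] converts
    into bounding below. *)
Let step_surj p x : Zc B p x -> exists c, Bc B p (fsub x (lcomb r.+1 c z)).
Proof.
move=> zx.
have Der : B (e r) by rewrite /PV; apply: osum_basis => //; lia.
have DB : forall t, D t -> B t by exact: closed_pt_sub.
pose c0 := x [:: e r]; pose x' := fsub x (fscale c0 (@cone F (line m))).
have zx' : Zc B p x' by apply: Z_sub => //; apply: Z_scale; exact: Z_one.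
have [k0 hk0] : Bc D p x' by apply: (pt_class char2); exact: Z_mono zx.
pose Y : seq U -> F := pull fst x'.
have zY : Zc W p Y by exact: Z_pull WB zx'.
have E u : (W u /\ V u.2) <-> W u by split=> [[]//|hu]; split=> //; case: hu.
have [|ab [zab bab]] := @PBT_surj (line m) U snd W V 2 zL c2 cW cV zLpure (@zLcoc W) fib2 p Y.
  by apply: Z_mono zY => t [].
have [ca hca] : exists ca, Bc V p (fsub (ab 0%N) (lcomb r ca z)).
  by apply: (proj1 IH); have := zab 0%N isT; rewrite subn0.
have [cb hcb] : exists cb, Bc V (p - 2) (fsub (ab 1%N) (lcomb r cb z)).
  case: (ltnP p 2) => p2; first by exists (fun _ => 0), (@fzero F _); have -> : (p - 2 = 0)%N by [lia]; exact: K_0.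
  apply: (proj1 IH); have := zab 1%N isT; rewrite /Zc; congr K; lia.
have WV u : W u -> V u.2 by case.
pose S : seq (line m) -> F := fun s => \sum_(i < r) cb i * cpow z i.+1 s.
have pS : pull fst S = (fun s : seq U => \sum_(i < r) cb i * cpow zL i.+1 s).
  apply: functional_extensionality => s; rewrite /pull /S; apply: eq_bigr => i _.
  by rewrite -(cpow_pull fst).
have b3 : Bc W p (fsub Y (fadd (lcomb r ca h) (pull fst S))).
  have t0 : Bc W p (fsub (pull snd (ab 0%N)) (lcomb r ca h)).
    by have := B_pull c2 WV hca; rewrite -lcomb_pull.
  have t1 : Bc W p (fsub (cup (pull snd (ab 1%N)) zL) (pull fst S)).
    have a1 : Bc W (p - 2) (fsub (pull snd (ab 1%N)) (lcomb r cb h)).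
      by have := B_pull c2 WV hcb; rewrite -lcomb_pull.
    have := B_cup_pure char2 zLpure (@zLcoc W) a1; rewrite cup_subl => a2.
    by rewrite pS; apply: B_trans a2 (lcomb_shift cb p).
  have := B_add (B_mono (fun t => proj2 (E t)) bab) (B_add t0 t1).
  apply: B_ext => s hs; rewrite /fadd /fsub !big_ord_recl big_ord0 addr0 /= cup1r; last by case: s hs.
  have -> : cup (pull snd (ab 1%N)) (cup (cone F (T := U)) zL) s = cup (pull snd (ab 1%N)) zL s.
    by congr (_ s); apply: cup_ext => // u hu; rewrite cup1l //; case: u hu.
  by rewrite -/zL; ring.
(* Along the exceptional section j the line L is constantly e_r: zL and the pullback of x' vanish
   there while h becomes z. *)
have ca0 i : (i < r)%N -> (i.*2 < p)%N -> ca i = 0.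
  apply: (proj2 IH p ca).
  have q1 := B_pull cj jW b3.
  have q2 : Bc V p (pull (fun _ : line m => e r : line m) x').
    by apply: (@B_pull F (line m) (line m) _ V D p x' (@cont_const (line m) (line m) (e r))); [move=> u _; exact: dist_refl|exists k0].
  have := B_sub q2 q1; apply: B_ext => s _; rewrite /fsub /fadd /pull.
  have -> : Y (map j s) = x' (map (fun _ => e r : line m) s) by rewrite /Y /pull -map_comp.
  have -> : lcomb r ca h (map j s) = lcomb r ca z s.
    by rewrite -[LHS]/(pull j (lcomb r ca h) s) lcomb_pull /h /pull; congr (lcomb r ca _ s); apply: functional_extensionality => t; rewrite -map_comp map_id.
  have -> : S (map fst (map j s)) = 0.
    rewrite /S big1 // => i2 _; rewrite -map_comp.
    by have := zconst i2 s; rewrite /pull => ->; rewrite mulr0.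
  by ring.
have kh : K W p (lcomb r ca h).
  have hp : pure 2 h by move=> s hs; rewrite /h /pull zeta_pure // size_map.
  apply: K_sum => i; case: (ltnP i.*2 p) => ip.
    by apply: K_ext (K_z F W p) => s _; rewrite ca0 ?mul0r.
  by apply: (K_scale (ca i)); apply: (@K_pure F U W p i.*2) => //; exact: cpow_pure.
have b4 : Bc W p (pull fst (fsub x' S)).
  have := B_add b3 (B_K kh); congr Bc; rewrite /Y; apply: functional_extensionality => s.
  by rewrite /pull /fadd /fsub; ring.
have zS : Zc B p S.
  have := @Z_sum F (line m) B p _ (index_enum 'I_r) (fun i => fscale (cb i) (cpow z i.+1)) _; apply => i.
  by apply: Z_scale; exact: (cpow_coc char2).
have zchi : Zc B p (fsub x' S) by exact: Z_sub.
have [k hk] : Bc D p (fsub x' S).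
  apply: B_sub; first by exists k0.
  exact: (@B_sum F (line m) D p _ (index_enum 'I_r) (fun i => fscale (cb i) (cpow z i.+1)) (fun i => B_scale (cb i) (zDpow i p))).
have [psi hpsi] := b4.
suff [c hc] : exists c : unit, Bc B p (fsub x' S).
  exists (fun i => if i is i'.+1 then cb i' else c0); apply: B_ext hc => s _.
  rewrite /x' /fsub /lcomb big_ord_recl /= /S /fscale opprD addrA.
  by congr (_ - _ - _); apply: eq_bigr => i _.
exists tt.
have fibD b : B b -> D b \/ (~ D b /\ acyclic F (fun u : U => W u /\ ptset b u.1)).
  move=> Bb; have o := ov_bd b (e r); case: (Rlt_dec (ov b (e r)) 1) => lt.
    right; split; last exact: blow_fibre.
    rewrite /D /ptset /= /ldist => hd.
    by have : (1 - ov (e r) b = 0)%Re by [apply: sqrt_eq_0 hd; rewrite ov_sym; lra]; rewrite ov_sym; lra.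
  by left; rewrite /D /ptset /= /ldist (ov_sym (e r)) (_ : ov b (e r) = 1%Re) ?Rminus_diag ?sqrt_0 //; lra.
apply: (cone_compare char2 c1 cW cD cB fibD zchi).
case: p {zx zx' hk0 zY zab bab hca hcb b3 ca0 kh b4 zS} zchi hk hpsi => [|p] zchi hk hpsi.
  by exists (@fzero F _), (@fzero F _), (@fzero F _); do !split; exact: K_0.
pose E' := fun u : U => W u /\ D u.1.
have cE : closed E' by apply: closedI => //; exact: (closed_pre c1 cD).
have zE : Zc E' p (fsub psi (pull fst k)).
  rewrite /Zc cob_sub -pull_cob.
  have k1 : K E' p.+1 (fsub (pull fst (fsub x' S)) (cob psi)) by apply: K_mono hpsi => t [].
  have k2 : K E' p.+1 (pull fst (fsub (fsub x' S) (cob k))) by apply: (K_pull c1 _ hk) => u [].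
  have := K_sub k2 k1; congr K; apply: functional_extensionality => s.
  by rewrite /fsub /pull; ring.
have EV t : (E' t /\ V t.2) <-> E' t by split=> [[]//|ht]; split=> //; case: ht => -[].
have fibE w : V w -> acyclic F (fun u : U => E' u /\ ptset w u.2) by exact: (exceptional_fibre he).
have [|g [zg bg]] := VB_surj char2 c2 cE cV fibE (p := p) (y := fsub psi (pull fst k)).
  by apply: Z_mono zE => t [].
have [gc hgc] := proj1 IH p g zg.
have [y3 hy3] : Bc E' p (fsub (fsub psi (pull fst k)) (lcomb r gc h)).
  apply: B_trans (B_mono (fun t => proj2 (EV t)) bg) _.
  have EV' u : E' u -> V u.2 by case=> -[].
  by have := B_pull c2 EV' hgc; rewrite -lcomb_pull.
(* The two primitives differ over the exceptional divisor by a polynomial in h; this is a cocycle on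
   the whole blow-up and may be subtracted there. *)
exists (fsub psi (lcomb r gc h)), k, y3; split.
  rewrite cob_sub; have lc : K W p.+1 (cob (lcomb r gc h)) by apply: lcomb_coc => //; exact: hcoc.
  apply: (@K_mono F U W); first by move=> t [].
  by have := K_add hpsi lc; congr K; fe.
split; first by apply: K_mono hk => t [].
apply: (@K_mono F U E'); first by move=> t [[]].
by move: hy3; congr K; fe.
Qed.

Lemma projective_step : projT B r.+1 z.
Proof. by split; [exact: step_surj|exact: step_inj]. Qed.

End Step.

Theorem projective_space m r (e : nat -> uvec m) : (0 < r)%N -> onf r e -> projT (PV r e) r (zeta F (m := m)).
Proof.
elim: r => [//|[|r] IH] _ he; last by apply: projective_step => //; apply: IH => // i j hi hj; apply: he; lia.
apply: projT1; apply: (acyclic_pt char2 (b := e 0%N : line m)) => t.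
rewrite /PV /ptset /= /ldist ov_sym; have o := ov_bd (e 0%N) t; split.
  by move=> h; rewrite (_ : (1 - ov (e 0%N) t = 0)%Re) ?sqrt_0 //; lra.
by move=> h; have : (1 - ov (e 0%N) t = 0)%Re by [apply: sqrt_eq_0 h; lra]; lra.
Qed.

End ProjectiveBundle.

(** * Changes of orthonormal frame *)

Section FrameChange.
Local Close Scope ring_scope.
Local Open Scope R_scope.
Variable m : nat.
Notation uvec := (uvec m).

Lemma osum_ext r (e e' : nat -> uvec) u : (forall i, (i < r)%nat -> e i = e' i) -> osum r e u = osum r e' u.
Proof.
elim: r => [//|r IH] h /=; rewrite IH => [|i hi]; last by apply: h; lia.
by rewrite h //; lia.
Qed.

Lemma ov1_eq (u v w : uvec) : ov u v = 1 -> ov u w = ov v w.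
Proof.
move=> h; have := ov_lip u v w; rewrite /ldist h Rminus_diag sqrt_0 Rmult_0_r.
split_Rabs; lra.
Qed.

Lemma ov0_ip (u v : uvec) : ov u v = 0 -> ip u v = RtoC 0.
Proof.
move=> h; apply: Cmod_eq_0; have := Cmod_sqr (ip u v); rewrite -/(ov u v) h.
by have := Cmod_ge_0 (ip u v); nra.
Qed.

Lemma rotate2 (a b p q : C) : Cnorm2 a + Cnorm2 b = 1 ->
  Cnorm2 (Cconj a * p + - Cconj b * q)%C + Cnorm2 (b * p + a * q)%C = Cnorm2 q + Cnorm2 p.
Proof.
case: a => a1 a2; case: b => b1 b2; case: p => p1 p2; case: q => q1 q2; rewrite /Cnorm2 /= => h.
transitivity ((a1 * a1 + a2 * a2 + (b1 * b1 + b2 * b2)) * (q1 * q1 + q2 * q2 + (p1 * p1 + p2 * p2))); first by sring.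
by rewrite h; sring.
Qed.

(** Induction: the part of u orthogonal to the last vector is first made a frame vector of the
    smaller span, and a unitary rotation of the plane of these two then takes the last vector to
    u. *)
Lemma frame_rotate r (e : nat -> uvec) (u : uvec) : onf r.+1 e -> osum r.+1 e u = 1 ->
  exists e', onf r.+1 e' /\ (forall w, osum r.+1 e' w = osum r.+1 e w) /\ ov u (e' r) = 1.
Proof.
elim: r u => [|r IH] u he hu.
  by exists e; do !split=> //; move: hu => /=; lra.
have o := ov_bd u (e r.+1).
case: (Req_dec (ov u (e r.+1)) 1) => [o1|n1]; first by exists e.
have lt : ov u (e r.+1) < 1 by lra.
have [w1 [/= hw1 hsum]] := blow_ex he hu lt.
have he' : onf r.+1 e by move=> i j hi hj; apply: he; lia.
have [e2 [on2 [os2 o2]]] := IH w1 he' hw1.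
set x := e2 r in o2; pose y := e r.+1.
have ux : ov u x = ov u w1 by rewrite !(ov_sym u); apply/esym; exact: ov1_eq.
pose a := ip u x; pose b := ip u y.
have ab : Cnorm2 a + Cnorm2 b = 1 by rewrite -/(ov u x) -/(ov u y) ux /y; lra.
have inspan i : (i < r.+1)%nat -> ip (e2 i) y = RtoC 0.
  move=> hi; apply: (osum_orth he); rewrite -os2; exact: osum_basis.
have yx : ip y x = RtoC 0.
  by rewrite ip_conj inspan; [apply: Ceq => /=; lra|lia].
have [|v [vy vx]] := @pair_ex m y x yx (Cconj a) (- Cconj b)%C.
  by rewrite -ab /Cnorm2 /=; sring.
have pu : PV2 y x u by rewrite /PV2 ux /y; lra.
have pv : PV2 y x v by rewrite /PV2 /ov vy vx -ab /Cnorm2 /=; sring.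
have eu w : ip u w = (b * ip y w + a * ip x w)%C by exact: PV2_expand.
have ev w : ip v w = (Cconj a * ip y w + - Cconj b * ip x w)%C by rewrite -vy -vx; exact: PV2_expand.
have vu : ip v u = RtoC 0.
  by rewrite ev (ip_conj y u) (ip_conj x u) -/a -/b; sring.
pose e' i := if i == r then v else if i == r.+1 then u else e2 i.
have er : e' r = v by rewrite /e' eqxx.
have er1 : e' r.+1 = u by rewrite /e' eqxx; case: eqP => [|//]; lia.
have ei i : (i < r)%nat -> e' i = e2 i.
  by move=> hi; rewrite /e'; case: eqP => [|_]; [lia|case: eqP => [|//]; lia].
have z1 i : (i < r)%nat -> ip v (e2 i) = RtoC 0 /\ ip u (e2 i) = RtoC 0.
  move=> hi.
  have h1 : ip y (e2 i) = RtoC 0 by rewrite ip_conj inspan; [apply: Ceq => /=; lra|lia].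
  have h2 : ip x (e2 i) = RtoC 0 by apply: on2; lia.
  by rewrite ev eu h1 h2; split; sring.
have cz : Cconj (RtoC 0) = RtoC 0 by apply: Ceq => /=; lra.
exists e'; split.
  have half i j : (i < j)%nat -> (j < r.+2)%nat -> ip (e' j) (e' i) = RtoC 0.
    move=> ij hj; case: (PeanoNat.Nat.eq_dec j r.+1) => [->|n1'].
      rewrite er1; case: (PeanoNat.Nat.eq_dec i r) => [->|n2]; first by rewrite er ip_conj vu.
      by rewrite ei; [apply: (proj2 (z1 i _))|]; lia.
    case: (PeanoNat.Nat.eq_dec j r) => [->|n2].
      by rewrite er ei; [apply: (proj1 (z1 i _))|]; lia.
    by rewrite !ei; [apply: on2|..]; lia.
  move=> i j hi hj ij; have [l|l] : (i < j)%nat \/ (j < i)%nat by lia.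
    by rewrite ip_conj half.
  exact: half.
split; last by rewrite er1 ov_self.
move=> w; have E1 : osum r.+2 e' w = osum r e2 w + ov w v + ov w u.
  by rewrite /= er er1 (@osum_ext r e' e2).
have E2 : osum r.+2 e w = osum r e2 w + ov w x + ov w y by rewrite -[_ + ov w x]/(osum r.+1 e2 w) os2.
change (osum r.+2 e' w = osum r.+2 e w); rewrite E1 E2.
have R := rotate2 (ip y w) (ip x w) ab.
have : ov w v + ov w u = ov w x + ov w y.
  by rewrite !(ov_sym w) /ov ev eu.
lra.
Qed.

Lemma frame_orth r (e : nat -> uvec) (u : uvec) : onf r.+1 e -> osum r.+1 e u = 1 ->
  exists e', onf r e' /\ forall w, (osum r.+1 e w = 1 /\ ip w u = RtoC 0) <-> osum r e' w = 1.
Proof.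
move=> he hu; have [e' [on' [os' o']]] := frame_rotate he hu.
have on2 : onf r e' by move=> i j hi hj; apply: on'; lia.
exists e'; split=> // w.
have ow : ov w u = ov w (e' r) by rewrite !(ov_sym w); exact: ov1_eq.
rewrite -os' /=; split.
  by move=> [h1 h2]; move: h1; rewrite -ow /ov h2 /Cnorm2 /=; lra.
move=> h; have /= b := bessel w on'.
have o0 : ov w (e' r) = 0 by have := ov_bd w (e' r); lra.
by split; [lra|apply: ov0_ip; lra].
Qed.

End FrameChange.

Section Commutativity.
Variable F : fieldType.
Hypothesis char2 : forall x : F, x + x = 0.

(* Steenrod's cup-1 product of two 2-cochains. *)
Definition cup1p (T : Type) (t s : seq T -> F) (l : seq T) : F :=
  if l is [:: a; b; c; d] then t [:: a; c; d] * s [:: a; b; c] + t [:: a; b; d] * s [:: b; c; d] else 0.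

(** The coboundary of the cup-1 product is the commutator, up to multiples of five instances of the
    cocycle conditions for t and s. *)
Lemma cup_comm2 (T : cpm) (A : T -> Prop) (t s : seq T -> F) p : pure 2 t -> pure 2 s ->
  (forall q, K A q (cob t)) -> (forall q, K A q (cob s)) -> Bc A p (fsub (cup t s) (cup s t)).
Proof.
move=> pt ps ct cs; exists (cup1p t s).
have [e [e0 he]] := ct 4%N; have [e' [e0' he']] := cs 4%N.
exists (Rmin e e'); split; first exact: Rmin_glb_lt.
move=> l _ sm.
have c1p : pure 3 (cup1p t s) by move=> -[|a [|b [|c [|d [|? ?]]]]].
have [sz|nsz] := PeanoNat.Nat.eq_dec (size l) 5; last first.
  by rewrite /fsub (cob_pure c1p) // (cup_pure pt ps) // (cup_pure ps pt) // !subr0.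
case: l sz sm => [|x0 [|x1 [|x2 [|x3 [|x4 [|? ?]]]]]] // _ sm.
have dt a b c d : (forall z, List.In z [:: a; b; c; d] -> List.In z [:: x0; x1; x2; x3; x4]) ->
    t [:: b; c; d] + (t [:: a; c; d] + (t [:: a; b; d] + (t [:: a; b; c] + 0))) = 0.
  move=> h; apply: (he [:: a; b; c; d]) => //.
  by apply: small_incl h _; apply: small_le sm; exact: Rmin_l.
have ds a b c d : (forall z, List.In z [:: a; b; c; d] -> List.In z [:: x0; x1; x2; x3; x4]) ->
    s [:: b; c; d] + (s [:: a; c; d] + (s [:: a; b; d] + (s [:: a; b; c] + 0))) = 0.
  move=> h; apply: (he' [:: a; b; c; d]) => //.
  by apply: small_incl h _; apply: small_le sm; exact: Rmin_r.
have t1 := dt x0 x1 x3 x4 ltac:(move=> z /=; tauto).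
have t2 := dt x0 x1 x2 x4 ltac:(move=> z /=; tauto).
have t3 := dt x0 x2 x3 x4 ltac:(move=> z /=; tauto).
have s1 := ds x0 x1 x2 x3 ltac:(move=> z /=; tauto).
have s2 := ds x1 x2 x3 x4 ltac:(move=> z /=; tauto).
have pz (f : seq T -> F) : pure 2 f -> (forall a, f [:: a] = 0) * (forall a b, f [:: a; b] = 0) *
   (forall a b c d, f [:: a; b; c; d] = 0) * (forall a b c d g, f [:: a; b; c; d; g] = 0).
  by move=> pf; do !split=> *; apply: pf.
rewrite /fsub /cob /= !(pz t pt) !(pz s ps) ?mul0r ?mulr0 ?add0r ?addr0.
rewrite !(oppF char2).
set X := (X in X = 0).
(* The products occurring twice in that combination; they are gathered here because [ring] does not
   use characteristic 2. *)
pose N := s [:: x1; x2; x3] * t [:: x0; x3; x4] + s [:: x1; x2; x3] * t [:: x0; x1; x4] +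
  s [:: x2; x3; x4] * t [:: x0; x1; x4] + t [:: x0; x3; x4] * s [:: x0; x1; x2].
rewrite -[RHS](char2 (X + N)).
transitivity (X + (s [:: x1; x2; x3] * (t [:: x1; x3; x4] + (t [:: x0; x3; x4] + (t [:: x0; x1; x4] + (t [:: x0; x1; x3] + 0)))) + s [:: x2; x3; x4] * (t [:: x1; x2; x4] + (t [:: x0; x2; x4] + (t [:: x0; x1; x4] + (t [:: x0; x1; x2] + 0)))) + t [:: x0; x3; x4] * (s [:: x1; x2; x3] + (s [:: x0; x2; x3] + (s [:: x0; x1; x3] + (s [:: x0; x1; x2] + 0)))) +
  t [:: x0; x1; x4] * (s [:: x2; x3; x4] + (s [:: x1; x3; x4] + (s [:: x1; x2; x4] + (s [:: x1; x2; x3] + 0)))) + s [:: x0; x1; x2] * (t [:: x2; x3; x4] + (t [:: x0; x3; x4] + (t [:: x0; x2; x4] + (t [:: x0; x2; x3] + 0)))))); first by rewrite t1 t2 s1 s2 t3; ring.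
by rewrite /X /N; ring.
Qed.

End Commutativity.

(** * Towers of projective bundles *)

Section NestedPolynomials.
Variable F : fieldType.

(* Polynomials in t_0, ..., t_(i-1), with t_(i-1) as the outermost variable. *)
Fixpoint NP (i : nat) : comNzRingType :=
  match i with O => (F : comNzRingType) | S i' => ({poly (NP i')} : comNzRingType) end.

Hypothesis char2 : forall x : F, x + x = 0.
Variables (m : nat) (x0 : uvec m).
Notation Zt := (nat -> line m).
Definition Zs (n : nat) : cpm := seqc (X := line m) x0 n.

Definition tl (j : nat) : seq Zt -> F := pull (fun f : Zt => f j) (zeta F (m := m)).

(** Cochains do not commute, so the variables are multiplied in one fixed order; the map is additive
    exactly, but multiplicative only up to coboundaries. *)
Fixpoint evc (i : nat) : NP i -> seq Zt -> F :=
  match i return NP i -> seq Zt -> F with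
  | O => fun c => fscale c (@cone F Zt)
  | S i' => fun p : {poly (NP i')} => fun s => \sum_(j < size p) cup (evc p`_j) (cpow (tl i') j) s
  end.

Lemma tl_pure j : pure 2 (tl j).
Proof. by move=> s hs; rewrite /tl /pull zeta_pure // size_map. Qed.

Lemma tl_coc n (A : Zs n -> Prop) j p : (j < n)%N -> K A p (cob (tl j)).
Proof.
move=> h; rewrite /tl -pull_cob.
apply: (@K_pull F (line m) (Zs n) (fun f : Zt => f j) A (fun _ => True)) => //; first exact: cont_coord.
exact: zeta_cocycle.
Qed.

Lemma cup_suml T (I : Type) (l : seq I) (f : I -> seq T -> F) (g : seq T -> F) s :
  cup (fun u => \sum_(j <- l) f j u) g s = \sum_(j <- l) cup (f j) g s.
Proof.
elim: l => [|j l IH].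
  by rewrite big_nil cup_eq0 // => s1 s2 _ _ _ _ _; rewrite big_nil mul0r.
rewrite big_cons -IH.
have -> : (fun u => \sum_(k <- j :: l) f k u) = fadd (f j) (fun u => \sum_(k <- l) f k u).
  by apply: functional_extensionality => u; rewrite big_cons.
by rewrite cup_addl.
Qed.

Lemma cup_sumr T (I : Type) (l : seq I) (f : I -> seq T -> F) (g : seq T -> F) s :
  cup g (fun u => \sum_(j <- l) f j u) s = \sum_(j <- l) cup g (f j) s.
Proof.
elim: l => [|j l IH].
  by rewrite big_nil cup_eq0 // => s1 s2 _ _ _ _ _; rewrite big_nil mulr0.
rewrite big_cons -IH.
have -> : (fun u => \sum_(k <- j :: l) f k u) = fsub (f j) (fscale (-1) (fun u => \sum_(k <- l) f k u)).
  by apply: functional_extensionality => u; rewrite big_cons /fsub /fscale; ring.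
by rewrite cup_subr cup_scaler /fsub /fscale; ring.
Qed.

Lemma evc0 i s : evc (0 : NP i) s = 0.
Proof. by case: i => [|i] /=; rewrite ?/fscale ?mul0r // size_poly0 big_ord0. Qed.

Lemma cup0l T (g : seq T -> F) f s : (forall u, f u = 0) -> cup f g s = 0.
Proof. by move=> h; apply: cup_eq0 => *; rewrite h mul0r. Qed.

Lemma evc_wide i (p : {poly (NP i)}) n s : (size p <= n)%N ->
  evc (p : NP i.+1) s = \sum_(j < n) cup (evc p`_j) (cpow (tl i) j) s.
Proof.
move=> h; rewrite /= (big_ord_widen n (fun j => cup (evc p`_j) (cpow (tl i) j) s) h) big_mkcond /=.
apply: eq_bigr => j _; case: ltnP => // hj; rewrite nth_default // cup0l // => u; exact: evc0.
Qed.

Lemma evcD i (p q : NP i) s : evc (p + q) s = evc p s + evc q s.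
Proof.
elim: i p q s => [|i IH] p q s /=; first by rewrite /fscale; exact: mulrDl.
pose n := maxn (size (p : {poly NP i})) (size (q : {poly NP i})).
have e1 := @evc_wide i p n s (leq_maxl _ _); have e2 := @evc_wide i q n s (leq_maxr _ _).
have e3 := @evc_wide i (p + q) n s (size_polyD _ _).
rewrite /= in e1 e2 e3; rewrite e1 e2 e3 -big_split /=; apply: eq_bigr => j _.
rewrite coefD.
have -> : evc ((p : {poly NP i})`_j + (q : {poly NP i})`_j) = fadd (evc (p : {poly NP i})`_j) (evc (q : {poly NP i})`_j).
  by apply: functional_extensionality => u; rewrite IH.
by rewrite cup_addl.
Qed.

Lemma evcB i (p q : NP i) s : evc (p - q) s = evc p s - evc q s.
Proof. by have := evcD (p - q) q s; rewrite subrK => ->; rewrite addrK. Qed.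

Lemma evcC i (c : NP i) s : (0 < size s)%N -> evc (c%:P : NP i.+1) s = evc c s.
Proof.
move=> hs; rewrite (@evc_wide i c%:P 1 s) ?size_polyC_leq1 // big_ord_recl big_ord0 addr0 /= coefC /=.
by rewrite cup1r //; case: s hs.
Qed.

Lemma evc_mulX i (p : {poly (NP i)}) s : evc (p * 'X : NP i.+1) s = cup (evc (p : NP i.+1)) (tl i) s.
Proof.
have le : (size (p * 'X)%R <= (size p).+1)%N.
  by apply: leq_trans (size_polyMleq _ _) _; rewrite size_polyX addn2.
rewrite (@evc_wide i (p * 'X) (size p).+1 s le) big_ord_recl coefMX /= cup0l ?add0r; last by move=> u; exact: evc0.
rewrite cup_suml; apply: eq_bigr => j _.
by rewrite coefMX /= cup_assoc.
Qed.

Lemma evc1 i s : (0 < size s)%N -> evc (1 : NP i) s = cone F s.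
Proof.
by elim: i s => [|i IH] s hs; [rewrite /= /fscale mul1r|rewrite -polyC1 evcC // IH].
Qed.

Lemma evcX i s : (0 < size s)%N -> evc ('X : NP i.+1) s = tl i s.
Proof.
move=> hs; rewrite -['X]mul1r evc_mulX.
rewrite (cup_ext (x' := @cone F _) (y' := tl i)) //; last by move=> u hu; exact: evc1.
by rewrite cup1l //; case: s hs.
Qed.

Section Space.
Variables (n : nat) (A : Zs n -> Prop).
Notation coc x := (forall q, K A q (cob x)).
Definition comm (x y : seq Zt -> F) := forall p, Bc A p (fsub (cup x y) (cup y x)).

Lemma evc_coc i (P : NP i) : (i <= n)%N -> coc (evc P).
Proof.
elim: i P => [|i IH] P h q; first by apply: K_le (Z_scale P (Z_one char2 A q)).
have H : Zc A q (evc P).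
  apply: (@Z_sum F (Zs n) A q) => j.
  have hz : coc (cup (evc (P : {poly NP i})`_j) (cpow (tl i) j)).
    apply: (Z_cup char2); first by apply: IH; lia.
    by apply: (cpow_coc char2) => q'; exact: tl_coc.
  exact: hz.
exact: K_le H.
Qed.

Lemma comm_cup a b t : coc a -> coc b -> coc t -> comm a t -> comm b t -> comm (cup a b) t.
Proof.
move=> ca cb ct ca' cb' p; rewrite -cup_assoc.
have s1 : Bc A p (fsub (cup a (cup b t)) (cup a (cup t b))) by rewrite -cup_subr; apply: (B_cupr char2).
apply: B_trans s1 _; rewrite !cup_assoc -cup_subl; exact: (B_cupl char2).
Qed.

Lemma comm_one c t : comm (fscale c (@cone F Zt)) t.
Proof.
move=> p; apply: B_K; apply: K_ext (K_z F A p) => s hs.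
have ne : s <> [::] by case: s hs.
by rewrite /fsub cup_scalel cup_scaler /fscale cup1l // cup1r // subrr.
Qed.

Lemma comm_pow t u j : coc t -> coc u -> comm t u -> comm (cpow t j) u.
Proof.
move=> ct cu h; elim: j => [|j IH] /=.
  move=> p; have := @comm_one 1 u p; congr Bc.
  by have -> : fscale 1 (@cone F Zt) = @cone F Zt by apply: functional_extensionality => s; rewrite /fscale mul1r.
by apply: comm_cup => //; exact: cpow_coc.
Qed.

Lemma comm_tl i j : (i < n)%N -> (j < n)%N -> comm (tl i) (tl j).
Proof.
by move=> hi hj p; apply: (@cup_comm2 F char2 (Zs n) A (tl i) (tl j) p); [exact: tl_pure|exact: tl_pure| |] => q; exact: tl_coc.
Qed.

Lemma comm_evc i (P : NP i) j : (i <= n)%N -> (j < n)%N -> comm (evc P) (tl j).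
Proof.
move=> hi hj; elim: i P hi => [|i IH] P hi; first exact: comm_one.
move=> p; have h k : Bc A p (fsub (cup (cup (evc (P : {poly NP i})`_k) (cpow (tl i) k)) (tl j)) (cup (tl j) (cup (evc (P : {poly NP i})`_k) (cpow (tl i) k)))).
  apply: comm_cup; [by apply: evc_coc; lia|by apply: (cpow_coc char2) => q; exact: tl_coc|by move=> q; exact: tl_coc|by apply: IH; lia|].
  by apply: comm_pow; [by move=> q; exact: tl_coc|by move=> q; exact: tl_coc|exact: comm_tl].
have := @B_sum F (Zs n) A p _ (index_enum 'I_(size (P : {poly NP i}))) _ (fun k : 'I_(size (P : {poly NP i})) => h k).
apply: B_ext => s _; rewrite /fsub sumrB /= cup_suml cup_sumr //.
Qed.

(** Horner induction on P: multiplication by the outer variable is exact on the right, so the only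
    move needed is to carry t_i past [evc Q], by [comm_evc]. *)
Lemma evcM i (P Q : NP i) p : (i <= n)%N -> Bc A p (fsub (evc (P * Q)) (cup (evc P) (evc Q))).
Proof.
elim: i P Q p => [|i IH] P Q p hi.
  apply: B_K; apply: K_ext (K_z F A p) => s hs.
  rewrite /fsub /= cup_scalel cup_scaler /fscale cup1l ?mulrA ?subrr //; by case: s hs.
have hi' : (i <= n)%N by lia.
have ct : coc (tl i) by move=> q; exact: tl_coc.
have mC (c : NP i) (q : {poly NP i}) p' : Bc A p' (fsub (evc (c%:P * q : NP i.+1)) (cup (evc c) (evc (q : NP i.+1)))).
  have le : (size (c%:P * q)%R <= size q)%N by rewrite mul_polyC; exact: size_scale_leq.
  have h k : Bc A p' (fsub (cup (evc (c * q`_k)) (cpow (tl i) k)) (cup (cup (evc c) (evc q`_k)) (cpow (tl i) k))).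
    by rewrite -cup_subl; apply: (B_cupl char2); [exact: (cpow_coc char2)|exact: IH].
  have := @B_sum F (Zs n) A p' _ (index_enum 'I_(size q)) _ (fun k : 'I_(size q) => h k).
  apply: B_ext => s _; rewrite /fsub (@evc_wide i _ _ _ le) sumrB cup_sumr; congr (_ - _); apply: eq_bigr => k _.
    by rewrite mul_polyC coefZ.
  by rewrite cup_assoc.
move: P; rewrite -/({poly NP i}) => P.
elim/poly_ind: P p => [|P c IHP] p.
  apply: B_K; apply: K_ext (K_z F A p) => s hs.
  by rewrite /fsub mul0r evc0 cup0l ?subrr // => u; exact: evc0.
have e1 : Bc A p (fsub (evc (P * Q * 'X : NP i.+1)) (cup (evc (P * 'X : NP i.+1)) (evc Q))).
  have a1 : Bc A p (fsub (cup (evc (P * Q : NP i.+1)) (tl i)) (cup (cup (evc (P : NP i.+1)) (evc Q)) (tl i))).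
    by rewrite -cup_subl; apply: (B_cupl char2).
  have a2 : Bc A p (fsub (cup (cup (evc (P : NP i.+1)) (evc Q)) (tl i)) (cup (evc (P : NP i.+1)) (cup (tl i) (evc Q)))).
    by rewrite -cup_assoc -cup_subr; apply: (B_cupr char2); [exact: evc_coc|exact: comm_evc].
  have := B_trans a1 a2; apply: B_ext => s hs; rewrite /fsub evc_mulX; congr (_ - _).
  rewrite cup_assoc; congr (_ s); apply: cup_ext => // u hu; by rewrite evc_mulX.
have e2 := mC c Q p.
have := B_add e1 e2; apply: B_ext => s hs; rewrite /fadd /fsub.
have -> : (P * 'X + c%:P) * (Q : {poly NP i}) = P * (Q : {poly NP i}) * 'X + c%:P * (Q : {poly NP i}) by ring.
rewrite evcD.
have -> : cup (evc (P * 'X + c%:P : NP i.+1)) (evc Q) s = cup (evc (P * 'X : NP i.+1)) (evc Q) s + cup (evc c) (evc Q) s.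
  rewrite -/(fadd (cup (evc (P * 'X : NP i.+1)) (evc Q)) (cup (evc c) (evc Q)) s) -cup_addl //; congr (_ s).
  by apply: cup_ext => // u hu; rewrite evcD evcC.
by ring.
Qed.

(* The polynomial relations between the Chern classes of the coordinate lines on A. *)
Definition Jn i (P : NP i) := forall p, Bc A p (evc P).

Lemma Jn0 i : Jn (0 : NP i).
Proof. by move=> p; apply: B_ext (B_0 F A p) => s _; rewrite evc0. Qed.

Lemma JnD i (P Q : NP i) : Jn P -> Jn Q -> Jn (P + Q).
Proof. by move=> h1 h2 p; apply: B_ext (B_add (h1 p) (h2 p)) => s _; rewrite evcD. Qed.

Lemma JnB i (P Q : NP i) : Jn P -> Jn Q -> Jn (P - Q).
Proof. by move=> h1 h2 p; apply: B_ext (B_sub (h1 p) (h2 p)) => s _; rewrite evcB. Qed.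

Lemma JnM i (P Q : NP i) : (i <= n)%N -> Jn Q -> Jn (P * Q).
Proof.
move=> hi h p; apply: B_congr (evcM P Q p hi) _; apply: (B_cupr char2) => //; exact: evc_coc.
Qed.

Lemma JnMr i (P Q : NP i) : (i <= n)%N -> Jn P -> Jn (P * Q).
Proof. by move=> hi h; rewrite mulrC; exact: JnM. Qed.

Lemma Jn_sum i (I : Type) (l : seq I) (f : I -> NP i) : (forall j, Jn (f j)) -> Jn (\sum_(j <- l) f j).
Proof.
move=> h; elim: l => [|j l IH]; first by rewrite big_nil; exact: Jn0.
by rewrite big_cons; exact: JnD.
Qed.

Lemma JnC i (c : NP i) : Jn (c%:P : NP i.+1) <-> Jn c.
Proof. by split=> h p; apply: B_ext (h p) => s hs; rewrite evcC. Qed.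

End Space.
End NestedPolynomials.

Section Tower.
Variable F : fieldType.
Hypothesis char2 : forall x : F, x + x = 0.
Variables (m : nat) (x0 : uvec m).
Notation Zt := (nat -> line m).
Notation Zs := (Zs x0).
Notation ev := (@evc F m _).
Notation NP := (NP F).
Notation tl := (tl F (m := m)).

Definition restrict T (q : nat) (x : seq T -> F) : seq T -> F := fun s => if size s == q then x s else 0.

Lemma cup_restrict T (q e : nat) (x z : seq T -> F) s : pure e z ->
  cup (restrict q.+1 x) z s = if size s == (q + e).+1 then cup x z s else 0.
Proof.
move=> pz; case: eqP => h; last first.
  apply: cup_eq0 => s1 s2 _ _ p1 p2 sz; rewrite /restrict; case: eqP => h1; last by rewrite mul0r.
  by rewrite pz ?mulr0 //; lia.
apply/eqP; rewrite -subr_eq0; apply/eqP; rewrite -/(fsub (cup (restrict q.+1 x) z) (cup x z) s) -cup_subl.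
apply: cup_eq0 => s1 s2 _ _ p1 p2 sz; rewrite /fsub /restrict; case: eqP => h1; first by rewrite subrr mul0r.
by rewrite (pz s2) ?mulr0 //; lia.
Qed.

Lemma cob_restrict T (q : nat) (y : seq T -> F) s : cob (restrict q y) s = if size s == q.+1 then cob y s else 0.
Proof.
have E (f : seq T -> F) : (forall s', size s' = (size s).-1 -> (0 < size s')%N -> f s' = 0) -> cob f s = 0.
  by case: s => [|x [|x' s]] h //; rewrite /cob; apply: faces_eq0 => s' _ h2; apply: h => //; rewrite h2.
case: eqP => h.
  apply/eqP; rewrite -subr_eq0; apply/eqP; rewrite -/(fsub (cob (restrict q y)) (cob y) s) -cob_sub.
  by apply: E => s' sz ?; rewrite /fsub /restrict; case: eqP => [_|]; [rewrite subrr|lia].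
by apply: E => s' sz ?; rewrite /restrict; case: eqP => // ?; lia.
Qed.

(* The homogeneous component of degree d. *)
Fixpoint comp (i d : nat) : NP i -> NP i :=
  match i return NP i -> NP i with
  | O => fun c => if d == 0%N then c else 0
  | S i' => fun p : {poly (NP i')} => (\poly_(j < d.+1) (comp (d - j) p`_j) : {poly NP i'})
  end.

Lemma comp0 i d : @comp i d 0 = 0.
Proof.
elim: i d => [|i IH] d /=; first by case: ifP.
by apply/polyP => j; rewrite coef_poly !coef0 IH if_same.
Qed.

Lemma coef_comp i d (p : {poly NP i}) j : (@comp i.+1 d p : {poly NP i})`_j = if (j <= d)%N then comp (d - j) p`_j else 0.
Proof. by rewrite /= coef_poly ltnS. Qed.

Lemma comp01 i : @comp i 0 1 = 1.
Proof.
elim: i => [|i IH] //; apply/polyP => j; rewrite coef_comp leqn0.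
by case: j => [|j] /=; rewrite !coef1 //= IH.
Qed.

Lemma cup_degree T (e : nat) (x z : seq T -> F) s : pure e z -> (size s <= e)%N -> cup x z s = 0.
Proof.
by move=> pz hs; apply: cup_eq0 => s1 s2 _ _ p1 p2 sz; rewrite (pz s2) ?mulr0 //; lia.
Qed.

Lemma evc_comp i d (P : NP i) s : (0 < size s)%N -> ev (comp d P) s = restrict d.*2.+1 (ev P) s.
Proof.
elim: i d P s => [|i IH] d P s hs.
  rewrite /restrict /= /fscale /cone.
  case: s hs => [|a [|b s]] //= _; first by case: d => [|d] //=; rewrite ?eqxx ?mul0r //; case: eqP => // ; lia.
  by rewrite !mulr0; case: ifP.
set p := (P : {poly NP i}).
pose n := (d.+1 + size p)%N.
have s1 : (size p <= n)%N by rewrite /n; lia.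
have s2 : (size (@comp i.+1 d p : {poly NP i}) <= n)%N.
  by apply: leq_trans (size_poly _ _) _; rewrite /n; lia.
rewrite /restrict (@evc_wide F m i _ n s s1) (@evc_wide F m i _ n s s2).
case: eqP => sz; last first.
  apply: big1 => j _; rewrite coef_comp; case: leqP => hj; last by apply: cup0l => u; rewrite evc0.
  rewrite (@cup_ext F _ _ (restrict (d - j).*2.+1 (ev p`_j)) _ (cpow (tl i) j)) //; last by move=> u hu; exact: IH.
  rewrite (@cup_restrict _ _ j.*2); last by apply: cpow_pure; exact: tl_pure.
  by case: eqP => //; lia.
apply: eq_bigr => j _; rewrite coef_comp; case: leqP => hj.
  rewrite (@cup_ext F _ _ (restrict (d - j).*2.+1 (ev p`_j)) _ (cpow (tl i) j)) //; last by move=> u hu; exact: IH.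
  rewrite (@cup_restrict _ _ j.*2); last by apply: cpow_pure; exact: tl_pure.
  by case: eqP => //; lia.
rewrite cup0l; last by move=> u; rewrite evc0.
by rewrite (@cup_degree _ j.*2) //; [apply: cpow_pure; exact: tl_pure|lia].
Qed.

(** The component of weight d lives on lists of length 2d + 1. Cutting the primitive down to lists
    of length 2d leaves all other degrees zero, so a relation known up to degree 2d becomes valid
    for every p. *)
Lemma J_comp n (A : Zs n -> Prop) i d (P : NP i) : Bc A d.*2.+1 (ev P) -> Jn A (comp d P).
Proof.
move=> [y [e [e0 he]]] p; exists (restrict d.*2 y); exists e; split=> // s hs sm.
rewrite /fsub cob_restrict evc_comp; last by case/andP: hs.
rewrite /restrict; case: eqP => sz; last by rewrite subr0.
by apply: he => //; rewrite sz; lia.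
Qed.

(* A tower of projective bundles: the j-th line runs through the projective space
   of a vector space of dimension r j that depends on the previous lines. *)
Variables (N : nat) (P : nat -> Zt -> Prop) (r : nat -> nat).
Definition tow (i : nat) (f : Zt) := forall j, (j < i)%N -> P j f.
Hypothesis cY : forall i, (i <= N)%N -> @closed (Zs i) (tow i).
Hypothesis frY : forall i f, (i < N)%N -> tow i f ->
  exists e, onf (r i) e /\ forall u, P i (upd f i u) <-> PV (r i) e u.
Hypothesis rpos : forall i, (i < N)%N -> (0 < r i)%N.
Notation JY i := (@Jn F m x0 i (tow i) i).

Lemma tow_sub i f : tow i.+1 f -> tow i f.
Proof. by move=> h j hj; apply: h; lia. Qed.

Lemma tow_fibre i b : (i < N)%N -> tow i b ->
  projT (fun u : Zs i.+1 => tow i.+1 u /\ @ptset (Zs i) b u) (r i) (tl i).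
Proof.
move=> hi tb; have [e [he eP]] := frY hi tb.
have cU := cY hi; have cid := @cont_trunc (line m) x0 i.+1 i (leqnSn i).
have cS : @closed (Zs i.+1) (fun u => tow i.+1 u /\ @ptset (Zs i) b u).
  by apply: closedI => //; exact: (@closed_pre (Zs i) (Zs i.+1) id (@ptset (Zs i) b) cid (@closed_pt (Zs i) b)).
have up (u : Zt) : @ptset (Zs i) b u -> @ptset (Zs i.+1) (upd b i (u i)) u.
  move=> h; rewrite /ptset; apply: (@sdist_lub0 (line m) i.+1) => j hj; rewrite /upd; case: eqP => [->|n]; first exact: dist_refl.
  have := @sdist_coord (line m) i b u j; have := dist_ge0 (b j) (u j).
  by rewrite /ptset /= in h; rewrite h => h1 h2; have := h2 ltac:(lia); lra.
have toP (u : Zt) : tow i.+1 u -> @ptset (Zs i) b u -> PV (r i) e (u i).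
  move=> tu hb; apply/eP.
  have hd : @ptset (Zs i.+1) u (upd b i (u i)) by have := up u hb; rewrite /ptset dist_sym.
  exact: (closed_pt_sub cU tu hd).
have tob (L : line m) : PV (r i) e L -> tow i.+1 (upd b i L).
  move=> hL; have PL : P i (upd b i L) by apply/eP.
  move=> j; rewrite ltnS leq_eqVlt => /orP [/eqP -> //|hj].
  have hd : @ptset (Zs i) b (upd b i L) by rewrite /ptset /= sdist_sym sdist_upd // sdist_refl.
  exact: (closed_pt_sub (cY (ltnW hi)) tb hd).
apply: (@projT_VB F char2 (line m) (Zs i.+1) (fun f => f i) _ (PV (r i) e)) => //.
- exact: cont_coord.
- exact: closed_PV.
- by move=> u [tu hb]; exact: toP.
- move=> L hL; apply: (acyclic_pt char2 (b := upd b i L : Zs i.+1)) => u; split.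
    move=> [[tu hb] hd]; have h1 := up u hb.
    have h2 : @ptset (Zs i.+1) (upd b i L) (upd b i (u i)).
      rewrite /ptset; apply: (@sdist_lub0 (line m) i.+1) => j hj; rewrite /upd; case: eqP => _; [exact: hd|exact: dist_refl].
    by rewrite /ptset /= in h1 h2 *; have := dist_tri (upd b i L : Zs i.+1) (upd b i (u i)) u; have := dist_ge0 (upd b i L : Zs i.+1) u; rewrite /= h1 h2; lra.
  move=> hd; have hd' : sdist (X := line m) i.+1 (upd b i L) u = 0%Re := hd.
  split; last first.
    have := @sdist_coord (line m) i.+1 (upd b i L) u i (ltnSn i); rewrite hd' {1}/upd eqxx /ptset.
    by have := dist_ge0 L (u i); lra.
  split; first exact: (closed_pt_sub cU (tob L hL) hd).
  rewrite /ptset; apply: (@sdist_lub0 (line m) i) => j hj.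
  have := @sdist_coord (line m) i.+1 (upd b i L) u j; rewrite hd' => h.
  have {}h := h ltac:(lia); rewrite /upd in h; move: h; case: eqP => [|_]; first lia.
  by have := dist_ge0 (b j) (u j); lra.
- by move=> p; exact: zeta_cocycle.
- by apply: (projective_space char2) => //; exact: rpos.
Qed.

Let pid (x : seq Zt -> F) : pull (fun u : Zt => u) x = x.
Proof. by apply: functional_extensionality => s; rewrite /pull map_id. Qed.

Let YB i : (i < N)%N -> forall u : Zt, (tow i.+1 u /\ tow i u) <-> tow i.+1 u.
Proof. by move=> hi u; split=> [[]//|h]; split=> //; exact: tow_sub. Qed.

(** Stage i + 1 is a projective bundle over stage i, on which the powers of t_i below [r i] are
    independent over the cohomology of the base. *)
Lemma tower_inj i (p : {poly NP i}) : (i < N)%N -> (size p <= r i)%N -> JY i.+1 p -> forall j, JY i p`_j.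
Proof.
move=> hi sp jp j.
case: (ltnP j (r i)) => hj; last first.
  by rewrite nth_default; [exact: Jn0|exact: leq_trans sp hj].
move=> q.
have := @PBT_inj F char2 (Zs i) (Zs i.+1) id (tow i.+1) (tow i) (r i) (tl i) (@cont_trunc (line m) x0 i.+1 i (leqnSn i))
   (cY hi) (cY (ltnW hi)) (@tl_pure F m i) (fun p => @tl_coc F char2 m x0 i.+1 (tow i.+1) i p (ltnSn i)) (fun b tb => tow_fibre hi tb)
   (q + j.*2) (fun k => @evc F m i p`_k) _ _ j hj.
rewrite addnK; apply.
  by move=> k _; apply: evc_coc.
apply: (@B_mono F (Zs i.+1) (tow i.+1)); [by move=> t []|]; apply: B_ext (jp (q + j.*2)%N) => s _.
by rewrite (@evc_wide F m i p (r i) s sp); apply: eq_bigr => k _; rewrite pid.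
Qed.

Lemma tower_const i (c : NP i) : (i < N)%N -> JY i.+1 (c%:P : NP i.+1) -> JY i c.
Proof.
move=> hi h; have := @tower_inj i c%:P hi _ h 0%N; rewrite coefC /=; apply.
by apply: leq_trans (size_polyC_leq1 _) _; exact: rpos.
Qed.

(* Artin normal form: the degree in t_j is below r j. *)
Fixpoint art (i : nat) : NP i -> Prop :=
  match i return NP i -> Prop with
  | O => fun _ => True
  | S i' => fun p : {poly (NP i')} => (size p <= r i')%N /\ forall j, art p`_j
  end.

Lemma art0 i : art (0 : NP i).
Proof. by elim: i => [//|i IH]; split=> [|j]; rewrite ?size_poly0 // coef0. Qed.

Lemma tower_indep i (Q : NP i) : (i <= N)%N -> art Q -> JY i Q -> Q = 0.
Proof.
elim: i Q => [|i IH] Q hi.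
  move=> _ h; have T0 : tow 0 (fun _ => x0) by [].
  exact: (@pt_inj F (Zs 0) (fun _ => x0) (tow 0) 1 Q T0 isT (h 1%N)).
move=> [sq aq] jq; apply/polyP => j; rewrite coef0; apply: IH (aq j) _; first lia.
exact: tower_inj.
Qed.

(** Leray-Hirsch at each stage: the Artin polynomials represent all cohomology classes. Coefficients
    whose degree would be negative are set to 0. *)
Lemma tower_surj i p x : (i <= N)%N -> @Zc F (Zs i) (tow i) p x ->
  exists Q : NP i, art Q /\ @Bc F (Zs i) (tow i) p (fsub x (ev Q)).
Proof.
elim: i p x => [|i IH] p x hi zx.
  have pt0 (t : Zs 0) : tow 0 t <-> @ptset (Zs 0) (fun _ => x0) t by split.
  have [_ ac] := acyclic_pt char2 pt0.
  have [c hc] := ac p x zx.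
  by exists c.
have hi' : (i < N)%N by lia.
have [|xs [zxs bxs]] := @PBT_surj F char2 (Zs i) (Zs i.+1) id (tow i.+1) (tow i) (r i) (tl i) (@cont_trunc (line m) x0 i.+1 i (leqnSn i))
   (cY hi') (cY (ltnW hi')) (@tl_pure F m i) (fun p => @tl_coc F char2 m x0 i.+1 (tow i.+1) i p (ltnSn i)) (fun b tb => tow_fibre hi' tb) p x.
  by apply: Z_mono zx => t [].
have ex j : exists Q : NP i, art Q /\ ((j < r i)%N -> @Bc F (Zs i) (tow i) (p - j.*2) (fsub (xs j) (ev Q))).
  case: (ltnP j (r i)) => hj; last by exists 0; split=> //; exact: art0.
  case: (leqP j.*2 p) => hp.
    have [|Q [aq bq]] := IH (p - j.*2)%N (xs j) (ltnW hi').
      by have := zxs j hj; rewrite /Zc subSn.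
    by exists Q.
  exists 0; split; first exact: art0.
  by move=> _; exists (@fzero F _); have -> : (p - j.*2 = 0)%N; [lia|exact: K_0].
pose Q j := proj1_sig (constructive_indefinite_description _ (ex j)).
have hQ j : art (Q j) /\ ((j < r i)%N -> @Bc F (Zs i) (tow i) (p - j.*2) (fsub (xs j) (ev (Q j)))).
  by rewrite /Q; case: constructive_indefinite_description.
pose R : {poly NP i} := \poly_(j < r i) Q j.
exists R; split.
  split=> [|j]; first exact: size_poly.
  by rewrite coef_poly; case: ifP => _; [case: (hQ j)|exact: art0].
apply: B_trans (@B_mono F (Zs i.+1) _ (tow i.+1) p _ (fun t => proj2 (YB hi' t)) bxs) _.
have h (k : 'I_(r i)) : @Bc F (Zs i.+1) (tow i.+1) p (cup (fsub (xs k) (ev (Q k))) (cpow (tl i) k)).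
  apply: (B_cup_pure char2 (e := k.*2)).
  - by apply: cpow_pure; exact: tl_pure.
  - by apply: (cpow_coc char2) => q; exact: tl_coc.
  have := @B_pull F (Zs i) (Zs i.+1) id (tow i.+1) (tow i) (p - k.*2) _ (@cont_trunc (line m) x0 i.+1 i (leqnSn i)) (@tow_sub i) (proj2 (hQ k) (ltn_ord k)).
  by rewrite pid.
have := @B_sum F (Zs i.+1) (tow i.+1) p _ (index_enum 'I_(r i)) _ h.
apply: B_ext => s _; rewrite /fsub (@evc_wide F m i R (r i) s (size_poly _ _)) -sumrB; apply: eq_bigr => k _.
by rewrite pid cup_subl /fsub coef_poly ltn_ord.
Qed.

Lemma artN i (Q : NP i) : art Q -> art (- Q).
Proof.
elim: i Q => [//|i IH] Q [sq aq]; split=> [|j]; first by rewrite size_polyN.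
by rewrite coefN; apply: IH; exact: aq.
Qed.

Lemma art_comp i d (Q : NP i) : art Q -> art (comp d Q).
Proof.
elim: i d Q => [//|i IH] d Q [sq aq]; split=> [|j]; last first.
  by rewrite coef_comp; case: ifP => _; [apply: IH; exact: aq|exact: art0].
apply/(@leq_sizeP (NP i)) => j hj; rewrite coef_comp nth_default ?comp0 ?if_same //.
exact: leq_trans sq hj.
Qed.

End Tower.

(** * Evaluation at roots of unity *)

Section Evaluation.
Variable F : fieldType.
Notation NP := (NP F).

(** Substitution t_j := v j, with [io] on the coefficients. *)
Fixpoint evr (S : comNzRingType) (io : {rmorphism F -> S}) (v : nat -> S) (i : nat) : {rmorphism NP i -> S} :=
  match i return {rmorphism NP i -> S} with
  | O => io
  | S i' => horner_morph (f := evr io v i') (fun x => mulrC (v i') (evr io v i' x)) : {rmorphism {poly NP i'} -> S}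
  end.

Section Basics.
Variables (S : comNzRingType) (io : {rmorphism F -> S}).

Lemma evr_poly v i (p : {poly NP i}) : evr io v i.+1 p = (map_poly (evr io v i) p).[v i].
Proof. by []. Qed.

Lemma evrC v i (c : NP i) : evr io v i.+1 (c%:P : {poly NP i}) = evr io v i c.
Proof. exact: horner_morphC. Qed.

Lemma evrX v i : evr io v i.+1 ('X : {poly NP i}) = v i.
Proof. exact: horner_morphX. Qed.

Lemma evr_ext v v' i (P : NP i) : (forall j, (j < i)%N -> v j = v' j) -> evr io v i P = evr io v' i P.
Proof.
elim: i P => [//|i IH] P h; rewrite !evr_poly h //; congr (_.[_]).
by apply/polyP => j; rewrite !coef_map /= IH // => a ha; apply: h; lia.
Qed.

Lemma evr_hom v t i d (P : NP i) : evr io (fun j => v j * t) i (comp d P) = evr io v i (comp d P) * t ^+ d.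
Proof.
elim: i d P => [|i IH] d P.
  by rewrite /=; case: eqP => [->|_]; rewrite ?expr0 ?mulr1 // rmorph0 mul0r.
set q := (comp d P : {poly NP i}).
rewrite !evr_poly -/q.
have sz (w : nat -> S) : (size (map_poly (evr io w i) q) <= d.+1)%N.
  by apply: leq_trans (size_poly _ _) _; exact: size_poly.
rewrite !(horner_coef_wide _ (sz _)) mulr_suml; apply: eq_bigr => j _.
rewrite !coef_map /= /q coef_comp; have hj : (j <= d)%N by have := ltn_ord j; lia.
have e : t ^+ d = t ^+ (d - j) * t ^+ j by rewrite -exprD subnK.
by rewrite hj IH exprMn e; ring.
Qed.
End Basics.

Lemma evr_nat (S S' : comNzRingType) (io : {rmorphism F -> S}) (io' : {rmorphism F -> S'}) (g : {rmorphism S -> S'}) v i (P : NP i) :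
  (forall c, g (io c) = io' c) -> g (evr io v i P) = evr io' (fun j => g (v j)) i P.
Proof.
move=> h; elim: i P => [|i IH] P; first exact: h.
rewrite !evr_poly -horner_map /= -map_poly_comp; congr (_.[_]).
by apply: eq_map_poly => x /=; exact: IH.
Qed.

Lemma evr_coefs (io : {rmorphism F -> {poly F}}) v w i (p : {poly NP i}) : (forall c, io c = c%:P) ->
  (forall j, (j < i)%N -> v j = (w j)%:P) -> v i = 'X ->
  evr io v i.+1 p = map_poly (evr (idfun : {rmorphism F -> F}) w i) p.
Proof.
move=> hio hv vi; rewrite evr_poly vi.
have E x : evr io v i x = (evr (idfun : {rmorphism F -> F}) w i x)%:P.
  rewrite (evr_ext io x hv).
  by rewrite -(@evr_nat F {poly F} idfun io polyC w i x) // => c; rewrite hio.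
rewrite (eq_map_poly E) map_poly_comp.
have -> : map_poly polyC (map_poly (evr (idfun : {rmorphism F -> F}) w i) p) = (map_poly (evr (idfun : {rmorphism F -> F}) w i) p) ^:P by [].
set q := map_poly _ p; have -> : (q ^:P).['X] = q \Po 'X by []; exact: comp_polyXr.
Qed.

End Evaluation.

(** * Divided differences of X^m *)

Section FlagPolynomials.
Variable F : fieldType.
Notation NP := (NP F).
Variable m : nat.

(* [Gp i] is the complete symmetric polynomial of degree m - i in t_0, ..., t_(i-1), X. *)
Fixpoint Gp (i : nat) : {poly NP i} :=
  match i return {poly NP i} with
  | O => 'X^m
  | S i' => Pdiv.Ring.rdivp ((Gp i') ^:P - (Gp i')%:P) ('X - ('X : {poly NP i'})%:P)
  end.

(** The division in [Gp] is exact because its numerator vanishes at X = t_i: each step forms a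
    divided difference, starting from X^m. *)
Lemma Gp_rec i : Gp i.+1 * ('X - ('X : {poly NP i})%:P) = (Gp i) ^:P - (Gp i)%:P.
Proof.
set p := (Gp i) ^:P - _; set d := 'X - _.
have /Pdiv.Ring.rmodp_eq0P r0 : Pdiv.Ring.rdvdp d p.
  apply/Pdiv.Ring.polyXsubCP; rewrite /p hornerD hornerN hornerC.
  by have -> : ((Gp i) ^:P).['X] = Gp i \Po 'X by []; rewrite comp_polyXr subrr.
by have := Pdiv.RingMonic.rdivp_eq (monicXsubC ('X : {poly NP i})) p; rewrite -/d r0 addr0 => e; exact: esym e.
Qed.

Fixpoint tv (i a : nat) : NP i :=
  match i return NP i with O => 0 | S i' => if a == i' then ('X : {poly NP i'}) else (tv i' a)%:P end.
(** [Gp a] with its variable X read as t_a, then viewed in more variables: the complete symmetric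
    polynomial of degree m - a in t_0, ..., t_a, a Newton coefficient of X^m. *)
Fixpoint gm (i a : nat) : NP i :=
  match i return NP i with O => 0 | S i' => if a == i' then (Gp i' : {poly NP i'}) else (gm i' a)%:P end.

Definition nodes (i j : nat) : {poly NP i} := \prod_(a < j) ('X - (tv i a)%:P).

Lemma nodes_lift i j : (j <= i)%N -> nodes i.+1 j = (nodes i j) ^:P.
Proof.
move=> hj; rewrite /nodes rmorph_prod; apply: eq_bigr => a _.
rewrite rmorphB /= map_polyX map_polyC /=; case: eqP => // E; have := ltn_ord a; lia.
Qed.

(** Newton interpolation of X^m at the nodes t_0, ..., t_(i-1); [Gp_rec] splits one more term off
    the remainder. *)
Lemma newton i : 'X^m = \sum_(j < i) (gm i j)%:P * nodes i j + Gp i * nodes i i.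
Proof.
elim: i => [|i IH]; first by rewrite big_ord0 add0r /nodes big_ord0 mulr1.
have E : 'X^m = ('X^m : {poly NP i}) ^:P by rewrite map_polyXn.
rewrite E {E} IH rmorphD rmorph_sum rmorphM big_ord_recr -addrA; congr (_ + _).
  apply: eq_bigr => j _; rewrite rmorphM /= map_polyC /= nodes_lift //; last by have := ltn_ord j; lia.
  by case: eqP => // E; have := ltn_ord j; lia.
have Ni : nodes i.+1 i.+1 = nodes i.+1 i * ('X - ('X : {poly NP i})%:P).
  by rewrite /nodes big_ord_recr /= eqxx.
have Gi : (gm i.+1 i)%:P = ((Gp i)%:P : {poly NP i.+1}) by rewrite /= eqxx.
change (((Gp i) ^:P : {poly NP i.+1}) * ((nodes i i) ^:P : {poly NP i.+1}) = (gm i.+1 i)%:P * nodes i.+1 i + Gp i.+1 * nodes i.+1 i.+1).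
rewrite -nodes_lift // Ni Gi -[X in X * _ = _](subrK ((Gp i)%:P : {poly NP i.+1})) -Gp_rec.
by set u : {poly NP i.+1} := (Gp i)%:P; set v := nodes _ _; set w := Gp _; set x : {poly NP i.+1} := 'X - _; ring.
Qed.

Lemma Gp_monic i : (i <= m)%N -> Gp i \is monic /\ size (Gp i) = (m - i).+1.
Proof.
elim: i => [|i IH] hi; first by rewrite monicXn size_polyXn subn0.
have [mG sG] := IH (ltnW hi).
have mG' : (Gp i) ^:P \is monic by exact: monic_map.
have sG' : size (Gp i)^:P = (m - i).+1 by rewrite size_map_polyC.
have lt : (size (- (Gp i)%:P : {poly {poly NP i}}) < size (Gp i)^:P)%N.
  by rewrite size_polyN sG'; apply: leq_ltn_trans (size_polyC_leq1 _) _; lia.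
have mH : (Gp i)^:P - (Gp i)%:P \is monic by rewrite monicE lead_coefDl // -monicE.
have sH : size ((Gp i)^:P - (Gp i)%:P) = (m - i).+1 by rewrite size_polyDl.
rewrite -Gp_rec in mH sH.
have mX : 'X - ('X : {poly NP i})%:P \is monic by exact: monicXsubC.
split; first by rewrite monicMr in mH.
have G0 : Gp i.+1 != 0 by apply: contraTneq mH => ->; rewrite mul0r monicE lead_coef0 eq_sym oner_eq0.
by move: sH; rewrite (size_Mmonic G0 mX) size_XsubC addn2 => -[e]; rewrite -subSn // subSS; exact: e.
Qed.

(** The N j are monic of degree j, so the coefficients are recovered from the top down. *)
Lemma triangular (S : comNzRingType) (I : S -> Prop) (c : nat -> S) (N : nat -> {poly S}) r :
  (forall a b, I a -> I b -> I (a - b)) -> (forall a b, I b -> I (a * b)) ->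
  (forall j, (j < r)%N -> N j \is monic /\ size (N j) = j.+1) ->
  (forall k, I (\sum_(j < r) (c j)%:P * N j)`_k) -> forall j, (j < r)%N -> I (c j).
Proof.
move=> IB IM; elim: r => [//|r IH] hN hI.
have [mN sN] := hN r (ltnSn r).
have cr : I (c r).
  have := hI r; rewrite coef_sum big_ord_recr big1 /=; last first.
    move=> j _; have [_ sj] := hN j (ltnW (ltn_ord j)).
    by rewrite coefCM nth_default ?mulr0 // sj.
  rewrite add0r coefCM; have -> : (N r)`_r = 1 by move/monicP: mN; rewrite /lead_coef sN.
  by rewrite mulr1.
move=> j; rewrite ltnS leq_eqVlt => /orP [/eqP -> //|hj].
apply: IH hj => [k hk|k]; first by apply: hN; lia.
have := hI k; rewrite big_ord_recr /= coefD coefCM => h.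
by have := IB _ _ h (IM (N r)`_k _ cr); rewrite [_ * c r]mulrC addrK.
Qed.

End FlagPolynomials.

(** * Values at distinct roots of unity *)

Section RootsOfUnity.
Variables (F : fieldType) (m : nat) (rs : seq F).
Hypotheses (urs : uniq rs) (srs : size rs = m) (rsm : forall c, c \in rs -> c ^+ m = 1).
Notation NP := (NP F).
Notation Gp := (Gp F m).
Notation S2 := {poly {poly F}}.

Definition adm i (w : nat -> F) := uniq (mkseq w i) && all (fun c => c \in rs) (mkseq w i).

Lemma admS i w : adm i.+1 w = [&& adm i w, w i \in rs & w i \notin mkseq w i].
Proof.
rewrite /adm mkseqS rcons_uniq all_rcons.
by case: (w i \in rs); case: (w i \notin _); case: (uniq _); rewrite /= ?andbT ?andbF.
Qed.

Definition cst2 : {rmorphism F -> S2} := (polyC : {rmorphism {poly F} -> S2}) \o (polyC : {rmorphism F -> {poly F}}).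

Section Value.
Variables (w : nat -> F).
(** The outer variable plays the role of tau; the inner one stays free for the quotient of s by
    tau. *)
Let v : nat -> S2 := fun j => cst2 (w j) * 'X.
Notation ev i := (evr cst2 v i).
Let gval i (y : S2) := (map_poly (ev i) (Gp i)).[y].

Let gval_rec i y : gval i.+1 y * (y - v i) = gval i y - gval i (v i).
Proof.
have := congr1 (fun p : {poly NP i.+1} => (map_poly (ev i.+1) p).[y]) (Gp_rec F m i).
rewrite rmorphM rmorphB /= hornerM map_polyX map_polyC /= hornerXsubC horner_morphX => ->.
rewrite rmorphB /= hornerD hornerN map_polyC /= hornerC; congr (_ - _).
rewrite /gval -map_poly_comp; congr (_.[_]); apply: eq_map_poly => x.
exact: evrC.
Qed.

(** X^m takes the same value tau^m at all points c tau, so its divided differences of positive order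
    vanish there; distinctness of the roots allows cancelling the differences of the nodes. *)
Let gval0 i c : (0 < i)%N -> adm i w -> c \in rs -> c \notin mkseq w i -> gval i (cst2 c * 'X) = 0.
Proof.
have nz (a b : F) : a != b -> cst2 a * 'X - cst2 b * 'X != 0.
  by move=> ab; rewrite -mulrBl mulf_neq0 ?polyX_eq0 // -rmorphB /= !polyC_eq0 subr_eq0.
elim: i c => [//|i IH] c _; rewrite admS => /and3P [aw wi wn] hc.
rewrite mkseqS mem_rcons inE negb_or => /andP [cw cn].
have h : gval i (cst2 c * 'X) = gval i (v i).
  case: i IH aw wi wn cw cn => [|i] IH aw wi wn cw cn; last by rewrite !IH.
  by rewrite /gval /= map_polyXn !hornerXn /v /= !exprMn -!rmorphXn /= !rsm.
have := gval_rec i (cst2 c * 'X); rewrite h subrr => /eqP; rewrite mulf_eq0 => /orP [/eqP h1|h1]; first exact: h1.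
by case/negP: (nz _ _ cw); exact: h1.
Qed.

Lemma Gp_root i : adm i.+1 w -> evr cst2 v i.+1 (Gp i) = if i == 0%N then 'X^m else 0.
Proof.
rewrite admS evr_poly -/(gval i (v i)) => /and3P [aw wi wn].
case: i aw wi wn => [|i] aw wi wn; last by rewrite gval0.
by rewrite /gval /= map_polyXn hornerXn /v exprMn -rmorphXn /= rsm // rmorph1 mul1r.
Qed.
End Value.

(** After the choice of w_0, ..., w_(i-1) there remain at least m - i roots, more than the degree in
    the next variable, so the Artin bounds are what vanishing on distinct tuples can detect. *)
Lemma interpolation i (P : NP i) : (i <= m)%N -> art (fun j => m - j)%N P ->
  (forall w, adm i w -> evr (idfun : {rmorphism F -> F}) w i P = 0) -> P = 0.
Proof.
elim: i P => [|i IH] P hi; first by move=> _ h; apply: (h (fun _ => 0)).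
move=> [sP aP] h; apply/polyP => j; rewrite coef0; apply: IH (aP j) _; first lia.
move=> w aw; set p := (P : {poly NP i}) in sP aP h *.
pose q := map_poly (evr (idfun : {rmorphism F -> F}) w i) p.
suff q0 : q = 0 by rewrite -coef_map -/q q0 coef0.
pose l := [seq c <- rs | c \notin mkseq w i].
have ul : uniq l by exact: filter_uniq.
have sl : (m - i <= size l)%N.
  have cp := count_predC (mem (mkseq w i)) rs; rewrite srs in cp; rewrite /l size_filter.
  have ci : (count (mem (mkseq w i)) rs <= i)%N.
    rewrite -size_filter -{2}(size_mkseq w i); apply: uniq_leq_size; first exact: filter_uniq.
    by move=> c; rewrite mem_filter => /andP [].
  have e : count (predC (mem (mkseq w i))) rs = count (fun c => c \notin mkseq w i) rs by exact: eq_count.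
  by rewrite -e; lia.
apply: (@roots_geq_poly_eq0 F q l) => //; last first.
  apply: leq_trans (size_poly _ _) _; exact: leq_trans sP sl.
apply/allP => c; rewrite mem_filter => /andP [cn cr]; apply/rootP.
pose w' j := if j == i then c else w j.
have ww j' : (j' < i)%N -> w' j' = w j' by rewrite /w'; case: eqP => //; lia.
have ms : mkseq w' i = mkseq w i.
  by apply/eq_in_map => a; rewrite mem_iota add0n => /andP [_ ha]; exact: ww.
have wi : w' i = c by rewrite /w' eqxx.
have := h w'; rewrite admS /adm ms wi cr cn andbT -/(adm i w) aw => /(_ isT).
rewrite evr_poly wi => <-; congr (_.[_]); apply/polyP => a; rewrite !coef_map /=.
by apply/esym/evr_ext.
Qed.

End RootsOfUnity.

(** * Flag bundles *)

Section Category.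
Variable F : fieldType.
Hypothesis char2 : forall x : F, x + x = 0.
Variables (m : nat) (x0 : uvec m).
Notation Zs := (Zs x0).
Notation NP := (NP F).
Notation ev := (@evc F m _).

Lemma cprod_evc n (A : Zs n -> Prop) i (I : Type) (l : seq I) (Q : I -> NP i) p : (i <= n)%N ->
  Bc A p (fsub (ev (\prod_(a <- l) Q a)) (@cprod F (Zs n) (map (fun a => ev (Q a)) l))).
Proof.
move=> hi; elim: l p => [|a l IH] p.
  apply: B_K; apply: K_ext (K_z F A p) => s hs.
  by rewrite /fsub big_nil evc1 //= subrr.
rewrite big_cons /=; apply: B_trans (evcM char2 A _ _ p hi) _.
by rewrite -cup_subr; apply: (B_cupr char2) => // q; exact: evc_coc.
Qed.

Lemma LS_null n (A : Zs n -> Prop) i (I : Type) (l : seq I) (Q : I -> NP i) (C : I -> Zs n -> Prop) : (i <= n)%N ->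
  (forall a p, Bc (fun t => A t /\ C a t) p (ev (Q a))) ->
  (forall t, A t -> exists a, List.In a l /\ C a t) -> Jn A (\prod_(a <- l) Q a).
Proof.
move=> hi hb cov p; apply: B_congr (cprod_evc A l Q p hi) _.
by apply: (@cprod_cover F char2 (Zs n) I l (fun a => ev (Q a)) A C p) => // a q; exact: evc_coc.
Qed.

Lemma evc_tv i a s : (a < i)%N -> (0 < size s)%N -> ev (tv F i a) s = tl F (m := m) a s.
Proof.
elim: i => [//|i IH] ha hs /=; case: eqP => [->|ne]; first by have := @evcX F char2 m i s hs.
by have := @evcC F m i (tv F i a) s hs; rewrite IH //; lia.
Qed.

Lemma tv_diff_null n (A : Zs n -> Prop) i a b c p : (i <= n)%N -> (a < i)%N -> (b < i)%N -> (0 < c)%Re ->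
  (forall f, A f -> (c <= ov (f a) (f b))%Re) -> Bc A p (ev (tv F i a - tv F i b)).
Proof.
move=> hi ha hb c0 hc.
have ca : @cont (line m) (Zs n) (fun f => f a) by apply: cont_coord; lia.
have cb : @cont (line m) (Zs n) (fun f => f b) by apply: cont_coord; lia.
have := @zeta_null F char2 m (Zs n) (fun f => f a) (fun f => f b) A c p ca cb c0 hc.
by apply: B_ext => s hs; rewrite evcB // !evc_tv.
Qed.

Lemma tv_null n (A : Zs n -> Prop) i a (e : uvec m) c p : (i <= n)%N -> (a < i)%N -> (0 < c)%Re ->
  (forall f, A f -> (c <= ov (f a) e)%Re) -> Bc A p (ev (tv F i a)).
Proof.
move=> hi ha c0 hc.
have ca : @cont (line m) (Zs n) (fun f => f a) by apply: cont_coord; lia.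
have := @zeta_null F char2 m (Zs n) (fun f => f a) (fun f => e) A c p ca (@cont_const (line m) (Zs n) e) c0 hc.
by apply: B_ext => s hs; rewrite /fsub zeta_const subr0 evc_tv.
Qed.

Lemma Jn_mono n n' (A : Zs n -> Prop) (A' : Zs n' -> Prop) i (P : NP i) : (n <= n')%N -> (forall t, A' t -> A t) -> Jn A P -> Jn A' P.
Proof.
move=> hn hA h p; have := @B_pull F (Zs n) (Zs n') id A' A p _ (@cont_trunc (line m) x0 n' n hn) hA (h p).
by apply: B_ext => s _; rewrite /pull map_id.
Qed.

End Category.

Section OrthogonalComplement.
Local Close Scope ring_scope.
Local Open Scope R_scope.
Variable m : nat.
Notation uvec := (uvec m).

Lemma orth_frame r (e : nat -> uvec) (g : nat -> uvec) j : onf r e -> (j <= r)%nat ->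
  (forall a, (a < j)%nat -> PV r e (g a)) -> onf j g ->
  exists e', onf (r - j)%nat e' /\ forall w, (PV r e w /\ forall a, (a < j)%nat -> ip w (g a) = RtoC 0) <-> PV (r - j)%nat e' w.
Proof.
move=> he; elim: j => [|j IH] hj hg og.
  exists e; rewrite subn0; split=> // w; split; [by case|move=> h; split=> // a; lia].
have [e1 [o1 h1]] : exists e', onf (r - j)%nat e' /\ forall w, (PV r e w /\ forall a, (a < j)%nat -> ip w (g a) = RtoC 0) <-> PV (r - j)%nat e' w.
  apply: IH; [lia|by move=> a ha; apply: hg; lia|by move=> a b ha hb; apply: og; lia].
have E : (r - j)%nat = (r - j.+1)%nat.+1 by lia.
rewrite E in o1 h1.
have [|e2 [o2 h2]] := frame_orth o1 (u := g j).
  by apply/h1; split; [apply: hg; lia|move=> a ha; apply: og; lia].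
exists e2; split=> // w; rewrite -[PV _ e2 w]/(osum _ e2 w = 1) -h2 -[osum _ e1 w = 1]/(PV _ e1 w) -h1; split.
  move=> [hw ha]; split; last by apply: ha; lia.
  by split=> // a haj; apply: ha; lia.
move=> [[hw ha] hb]; split=> // a haj; case: (PeanoNat.Nat.eq_dec a j) => [->//|n].
by apply: ha; lia.
Qed.

Definition e0vec (i : nat) : cvec := fun j => if j == i then RtoC 1 else RtoC 0.

Lemma hdotn_e0 r i (v : cvec) : hdotn r v (e0vec i) = if (i < r)%N then v i else RtoC 0.
Proof.
elim: r => [//|r IH] /=; rewrite IH /e0vec ltnS; case: ltngtP => h.
- by apply: Ceq => /=; sring.
- by apply: Ceq => /=; sring.
- by rewrite h; apply: Ceq => /=; sring.
Qed.

Lemma e0_unit i : (i < m)%N -> norm2 m (e0vec i) = 1.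
Proof. by move=> h; rewrite norm2E /hdot hdotn_e0 h /e0vec eqxx. Qed.

Definition bas (x0 : uvec) (i : nat) : uvec :=
  match Bool.bool_dec (i < m)%N true with left h => exist _ (e0vec i) (e0_unit h) | right _ => x0 end.

Lemma uv_bas x0 i : (i < m)%N -> uv (bas x0 i) = e0vec i.
Proof. by rewrite /bas; case: Bool.bool_dec. Qed.

Lemma onf_bas x0 : onf m (bas x0).
Proof.
move=> i j hi hj ne; rewrite /ip (uv_bas x0 hj) /hdot hdotn_e0 hj (uv_bas x0 hi) /e0vec.
by case: eqP => // e; case: ne.
Qed.

Lemma osum_bas x0 r (u : uvec) : (r <= m)%N -> osum r (bas x0) u = norm2 r (uv u).
Proof.
elim: r => [//|r IH] h /=; rewrite IH; last by apply: ltnW.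
by rewrite /ov /ip (uv_bas x0 h) /hdot hdotn_e0 h.
Qed.

Lemma PV_full x0 (u : uvec) : PV m (bas x0) u.
Proof. by rewrite /PV osum_bas // uv1. Qed.

(** Pigeonhole; r + 1 instead of r makes the contradiction strict and avoids division by 0. These
    bounds supply the covers of the Lusternik-Schnirelmann arguments. *)
Lemma osum_some r (e : nat -> uvec) u : osum r e u = 1 -> exists i, (i < r)%nat /\ / (INR r + 1) <= ov u (e i).
Proof.
move=> h; apply: NNPP => n.
have r0 := pos_INR r; set c := / (INR r + 1) in n *.
have cr : (INR r + 1) * c = 1 by rewrite /c; apply: Rinv_r; lra.
have c0 : 0 < c by apply: Rinv_0_lt_compat; lra.
suff : osum r e u <= INR r * c by lra.
have {h}: forall i, (i < r)%nat -> ov u (e i) <= c.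
  by move=> i hi; apply: Rnot_lt_le => h'; apply: n; exists i; split=> //; lra.
move: (c) => d; elim: (r) => [|q IH] h; first by rewrite /=; lra.
have {}IH := IH (fun i hi => h i ltac:(lia)).
have := h q ltac:(lia); rewrite S_INR [osum _ _ _]/=; lra.
Qed.

End OrthogonalComplement.

Section FlagBundle.
Variables (m : nat) (x0 : uvec m).
Notation Zt := (nat -> line m).
Notation Zs := (Zs x0).

Lemma closed_forall (T : cpm) n (A : nat -> T -> Prop) : (forall a, (a < n)%N -> closed (A a)) ->
  closed (fun t => forall a, (a < n)%N -> A a t).
Proof.
elim: n => [|n IH] h; first by move=> x nx; case: nx.
apply: closed_ext (closedI (IH _) (h n (ltnSn n))) => [t|a ha]; last by apply: h; lia.
split=> [[h1 h2] a|h1]; last by split=> [a ha|]; apply: h1; lia.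
by rewrite ltnS leq_eqVlt => /orP [/eqP -> //|]; exact: h1.
Qed.

Lemma updE (f : Zt) i u : upd f i u i = u.
Proof. by rewrite /upd eqxx. Qed.

Lemma updN (f : Zt) i u a : (a < i)%N -> upd f i u a = f a.
Proof. by rewrite /upd; case: eqP => //; lia. Qed.

Lemma closed_orth n a b : (a < n)%N -> (b < n)%N -> @closed (Zs n) (fun f => ip (f a) (f b) = RtoC 0).
Proof.
move=> ha hb.
have ca : @cont (line m) (Zs n) (fun f => f a) by exact: cont_coord.
have cb : @cont (line m) (Zs n) (fun f => f b) by exact: cont_coord.
have := @closed_eq (Zs n) (fun f => ov (f a) (f b)) 0%Re (rcont_ov ca cb).
apply: closed_ext => f; split; first exact: ov0_ip.
by rewrite /ov => ->; rewrite /Cnorm2 /=; lra.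
Qed.

Definition flag (j : nat) (f : Zt) := forall a, (a < j)%N -> ip (f j) (f a) = RtoC 0.
Definition flags (f : Zt) := forall j, (j < m)%N -> flag j f.

Lemma cont_pick j : (m <= j)%N -> @cont (Zs m.+1) (Zs j.+1) (fun f => upd f m (f j)).
Proof.
move=> hj u e e0; exists e; split=> // v hv; apply: (@sdist_lub (line m) m.+1 (upd u m (u j)) (upd v m (v j)) e e0) => i hi.
rewrite /upd; case: eqP => _; first by apply: Rle_lt_trans (@sdist_coord (line m) j.+1 u v j _) hv; lia.
by apply: Rle_lt_trans (@sdist_coord (line m) j.+1 u v i _) hv; lia.
Qed.

Lemma flags_ext f g : (forall j, (j < m)%N -> f j = g j) -> flags f -> flags g.
Proof. by move=> h hf j hj a ha; rewrite -!h; [exact: hf|lia|lia]. Qed.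

Variables (k : nat) (V : Zt -> line m -> Prop).
Hypothesis k0 : (0 < k)%N.
Hypothesis m0 : (0 < m)%N.
Hypothesis Vext : forall f g, (forall j, (j < m)%N -> f j = g j) -> forall u, V f u -> V g u.
Hypothesis Vfr : forall f, flags f -> exists e, onf k e /\ forall u, V f u <-> PV k e u.
Hypothesis Vcl : @closed (Zs m.+1) (fun f => flags f /\ V f (f m)).

(* Orthogonal lines of C^m, then orthogonal lines of [V], then one further line of [V]. *)
Definition PC (j : nat) (f : Zt) : Prop := if (j < m)%N then flag j f else
  V f (f j) /\ ((j < m + k)%N -> forall b, (m <= b < j)%N -> ip (f j) (f b) = RtoC 0).
Definition rC (j : nat) : nat := if (j < m)%N then (m - j)%N else if (j < m + k)%N then (m + k - j)%N else k.

Lemma PC_lt j f : (j < m)%N -> PC j f = flag j f.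
Proof. by rewrite /PC => ->. Qed.

Lemma tow_flags f : tow PC m f <-> flags f.
Proof. by split=> h j hj; have := h j hj; rewrite PC_lt. Qed.

Lemma tow_flags_le i f : (m <= i)%N -> tow PC i f -> flags f.
Proof. by move=> h t j hj; have := t j (leq_trans hj h); rewrite PC_lt. Qed.

Lemma rC_pos i : (0 < rC i)%N.
Proof. by rewrite /rC; case: (ltnP i m) => ?; [lia|case: (ltnP i (m + k)) => ?; lia]. Qed.

Lemma closed_V j : (m <= j)%N -> @closed (Zs j.+1) (fun f => flags f /\ V f (f j)).
Proof.
move=> hj; have := closed_pre (cont_pick hj) Vcl; apply: closed_ext => f; rewrite updE.
have e1 a : (a < m)%N -> upd f m (f j) a = f a by exact: updN.
have e2 a : (a < m)%N -> f a = upd f m (f j) a by move=> ha; rewrite e1.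
split=> -[h1 h2]; split.
- exact: flags_ext h1.
- exact: Vext h2.
- exact: flags_ext h1.
- exact: Vext h2.
Qed.

Lemma closed_tower i : @closed (Zs i) (tow PC i).
Proof.
elim: i => [|i IH]; first by move=> f nf; case: nf.
have cT : @closed (Zs i.+1) (tow PC i) by exact: (@closed_pre (Zs i) (Zs i.+1) id _ (@cont_trunc (line m) x0 i.+1 i (leqnSn i)) IH).
have tE f : tow PC i.+1 f <-> tow PC i f /\ PC i f.
  split=> [h|[h1 h2] j]; first by split=> [j hj|]; apply: h; lia.
  by rewrite ltnS leq_eqVlt => /orP [/eqP -> //|]; exact: h1.
case: (ltnP i m) => hi.
  apply: closed_ext (closedI cT (@closed_forall (Zs i.+1) i (fun a f => ip (f i) (f a) = RtoC 0) _)) => [f|a ha].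
    by rewrite tE PC_lt.
  by apply: closed_orth; lia.
have cO : @closed (Zs i.+1) (fun f => forall b, (b < i)%N -> ((i < m + k)%N && (m <= b)%N) -> ip (f i) (f b) = RtoC 0).
  apply: (@closed_forall (Zs i.+1) i (fun b f => ((i < m + k)%N && (m <= b)%N) -> ip (f i) (f b) = RtoC 0)) => b hb.
  case: ((i < m + k)%N && (m <= b)%N); last by move=> f nf; case: nf.
  apply: closed_ext (@closed_orth i.+1 i b (ltnSn i) (ltnW hb)) => f; split=> // h; exact: h.
apply: closed_ext (closedI cT (closedI (closed_V hi) cO)) => f; rewrite tE; split.
  move=> [tf [[_ vf] h]]; split=> //; rewrite /PC ltnNge hi /=; split=> // ik b /andP [mb bi].
  by apply: h => //; rewrite ik mb.
move=> [tf]; rewrite /PC ltnNge hi /= => -[vf h]; split=> //; split.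
  by split=> //; exact: tow_flags_le tf.
by move=> b bi /andP [ik mb]; apply: h => //; rewrite mb bi.
Qed.

Lemma frames_tower i f : (i < (m + k).+1)%N -> tow PC i f ->
  exists e, onf (rC i) e /\ forall u, PC i (upd f i u) <-> PV (rC i) e u.
Proof.
move=> hi tf; rewrite /rC; case: (ltnP i m) => him.
  have [||e [oe he]] := @orth_frame m m (bas x0) f i (onf_bas x0) (ltnW him).
  - by move=> a _; exact: PV_full.
  - have half a b : (a < b)%N -> (b < i)%N -> ip (f b) (f a) = RtoC 0.
      by move=> ab bi; have := tf b bi; rewrite PC_lt; [apply|lia].
    move=> a b ha hb ne; case: (ltngtP a b) => // l; last exact: half.
    by rewrite ip_conj half //; apply: Ceq => /=; lra.
  exists e; split=> // u; rewrite -he PC_lt // /flag updE; split.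
    by move=> h; split=> [|a ha]; [exact: PV_full|have := h a ha; rewrite updN].
  by move=> [_ h] a ha; rewrite updN //; exact: h.
have ff := tow_flags_le him tf; have [e [oe he]] := Vfr ff.
have vu u : V (upd f i u) u <-> V f u.
  by split; apply: Vext => j hj; rewrite updN //; lia.
have vf a : (m <= a < i)%N -> V f (f a).
  by move=> /andP [ma ai]; have := tf a ai; rewrite /PC ltnNge ma /= => -[].
case: ltnP => hik; last first.
  exists e; split=> // u; rewrite -he /PC ltnNge him /= updE vu.
  by split=> [[]//|h]; split=> //; lia.
have [|||e' [oe' he']] := @orth_frame m k e (fun a => f (m + a)%N) (i - m)%N oe _.
- lia.
- by move=> a ha; apply/he; apply: vf; lia.
- have half a b : (a < b)%N -> (b < i - m)%N -> ip (f (m + b)%N) (f (m + a)%N) = RtoC 0.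
    move=> ab bi; have := tf (m + b)%N ltac:(lia); rewrite /PC ltnNge leq_addr /= => -[_ h].
    by apply: h; lia.
  move=> a b ha hb ne; case: (ltngtP a b) => // l; last exact: half.
  by rewrite ip_conj half //; apply: Ceq => /=; lra.
have E : (k - (i - m) = m + k - i)%N by lia.
rewrite E in oe' he'; exists e'; split=> // u; rewrite -he' /PC ltnNge him /= updE vu he hik; split.
  move=> [h1 h2]; split=> // a ha; have := h2 isT (m + a)%N; rewrite updN; last lia.
  by apply; lia.
move=> [h1 h2]; split=> // _ b hb; rewrite updN; last lia.
have -> : b = (m + (b - m))%N by lia.
by apply: h2; lia.
Qed.

End FlagBundle.

Lemma In_iota q a : (a < q)%N -> List.In a (index_iota 0 q).
Proof.
have H n b : (b <= a < b + n)%N -> List.In a (iota b n).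
  elim: n b => [|n IH] b h; first lia.
  by case: (eqVneq b a) => [->|ne]; [left|right; apply: IH; lia].
by move=> h; apply: H; lia.
Qed.

Section FrameSums.
Local Close Scope ring_scope.
Local Open Scope R_scope.

(** Rotate e until its last vector spans the same line as the last vector of g, then drop both. *)
Lemma osum_frame m r (e g : nat -> uvec m) : onf r e -> onf r g -> (forall a, (a < r)%nat -> osum r e (g a) = 1) ->
  forall w, osum r g w = osum r e w.
Proof.
elim: r e => [//|r IH] e he hg h w.
have [e' [on' [os' o']]] := frame_rotate he (h r (ltnSn r)).
rewrite -os' /=; congr (_ + _); last by rewrite !(ov_sym w); exact: ov1_eq.
apply: IH => [i j hi hj|i j hi hj|a ha]; [by apply: on'; lia|by apply: hg; lia|].
have := h a ltac:(lia); rewrite -os' /=.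
suff -> : ov (g a) (e' r) = 0 by lra.
rewrite ov_sym -(ov1_eq _ o') /ov hg /Cnorm2 /=; [lra|lia|lia|lia].
Qed.

Lemma osum_flags m (x0 : uvec m) (f : nat -> uvec m) w : @flags m f -> osum m f w = 1.
Proof.
move=> hf; rewrite (@osum_frame m m (bas x0)); [exact: PV_full|exact: onf_bas| |by move=> a _; exact: PV_full].
have half a b : (a < b)%N -> (b < m)%N -> ip (f b) (f a) = RtoC 0 by move=> ab bm; exact: hf.
move=> a b ha hb ne; case: (ltngtP a b) => // l; last exact: half.
by rewrite ip_conj half //; apply: Ceq => /=; lra.
Qed.
End FrameSums.

Section FlagRing.
Variable F : fieldType.
Hypothesis char2 : forall x : F, x + x = 0.
Variables (m : nat) (x0 : uvec m).
Hypothesis m0 : (0 < m)%N.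
Notation Zt := (nat -> line m).
Notation Zs := (Zs x0).
Notation NP := (NP F).

(* The tower of complete flags of C^m followed by one arbitrary further line z: comparing
   z^m = 0 with prod (z - t_a) = 0 by Newton interpolation yields the relations of the flag manifold. *)
Let VT (f : Zt) (u : line m) := True.
Let PA := PC m VT.

Let frA i f : (i < (m + m).+1)%N -> tow PA i f ->
  exists e, onf (rC m m i) e /\ forall u, PA i (upd f i u) <-> PV (rC m m i) e u.
Proof.
apply: (@frames_tower m x0 m VT) => // g _.
by exists (bas x0); split; [exact: onf_bas|move=> u; split=> // _; exact: PV_full].
Qed.

Let clA i : (i <= (m + m).+1)%N -> @closed (Zs i) (tow PA i).
Proof.
move=> _; apply: (@closed_tower m x0 m VT) => //.
apply: closed_ext (@closed_forall (Zs m.+1) m (fun j f => flag j f) _) => [f|j hj]; first by split=> [h|[]].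
by apply: closed_forall => a ha; apply: closed_orth; lia.
Qed.

Let rA i : (i < (m + m).+1)%N -> (0 < rC m m i)%N.
Proof. by move=> _; exact: rC_pos. Qed.

Lemma gm_null a : (a < m)%N -> @Jn F m x0 m (@flags m) m (gm F m m a).
Proof.
move=> ha.
have n1 : @Jn F m x0 m.+1 (tow PA m.+1) m.+1 (('X : {poly NP m}) ^+ m).
  have := @LS_null F char2 m x0 m.+1 (tow PA m.+1) m.+1 nat (index_iota 0 m) (fun _ => tv F m.+1 m)
    (fun a f => (/ (INR m + 1) <= ov (f m) (bas x0 a))%Re) (leqnn _).
  rewrite big_mkord /= eqxx prodr_const card_ord; apply.
    move=> b p; have := @tv_null F char2 m x0 m.+1 _ m.+1 m (bas x0 b) (/ (INR m + 1))%Re p (leqnn _) (ltnSn m).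
    rewrite /= eqxx; apply; last by move=> f [].
    by apply: Rinv_0_lt_compat; have := pos_INR m; lra.
  move=> f _; have [b [hb h]] := osum_some (PV_full x0 (f m)).
  by exists b; split=> //; exact: In_iota.
have n2 : @Jn F m x0 m.+1 (tow PA m.+1) m.+1 (nodes F m m).
  have := @LS_null F char2 m x0 m.+1 (tow PA m.+1) m.+1 nat (index_iota 0 m) (fun b => if (b < m)%N then tv F m.+1 m - tv F m.+1 b else 1)
    (fun a f => (a < m)%N /\ (/ (INR m + 1) <= ov (f m) (f a))%Re) (leqnn _).
  have -> : nodes F m m = \prod_(b <- index_iota 0 m) (if (b < m)%N then tv F m.+1 m - tv F m.+1 b else 1).
    rewrite big_mkord; apply: eq_bigr => b _; rewrite ltn_ord /= eqxx.
    by case: eqP => // E; have := ltn_ord b; lia.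
  apply.
    move=> b p; case: (ltnP b m) => hb; last by apply: B_mono (B_K (K_emp p _)) => t [_ []]; lia.
    apply: (@tv_diff_null F char2 m x0 m.+1 _ m.+1 m b (/ (INR m + 1))%Re p) => //; first lia.
      by apply: Rinv_0_lt_compat; have := pos_INR m; lra.
    by move=> f [_ []].
  move=> f tf; have ff : flags f by exact: (@tow_flags_le m m VT m.+1 f (leqnSn m) tf).
  have [b [hb h]] := osum_some (osum_flags x0 (f m) ff).
  by exists b; split=> //; exact: In_iota.
(* Newton's formula with all m nodes, where the factor [Gp F m m] is 1. The left side has degree
   below m in z, so [tower_inj] applies. *)
have e : \sum_(j < m) (gm F m m j)%:P * nodes F m j = ('X : {poly NP m}) ^+ m - nodes F m m.
  have [mG sG] := Gp_monic F (leqnn m); rewrite subnn in sG.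
  have G1 : Gp F m m = 1.
    have /size_poly1P [c c0 E] : size (Gp F m m) == 1%N by rewrite sG.
    by move: mG; rewrite E monicE lead_coefC => /eqP ->.
  by rewrite (newton F m m) G1 mul1r addrK.
have n3 : @Jn F m x0 m.+1 (tow PA m.+1) m.+1 (\sum_(j < m) (gm F m m j)%:P * nodes F m j : {poly NP m}).
  by rewrite e; exact: JnB.
have mN j : (j <= m)%N -> nodes F m j \is monic /\ size (nodes F m j) = j.+1.
  move=> hj; split; first by apply: monic_prod => i _; exact: monicXsubC.
  by rewrite /nodes size_prod_XsubC /index_enum -enumT size_enum_ord.
have sz : (size (\sum_(j < m) (gm F m m j)%:P * nodes F m j : {poly NP m})%R <= rC m m m)%N.
  apply: leq_trans (size_sum _ _ _) _; apply/bigmax_leqP => j _; rewrite mul_polyC.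
  apply: leq_trans (size_scale_leq _ _) _; rewrite (proj2 (mN j (ltnW (ltn_ord j)))) /rC ltnn.
  by have := ltn_ord j; case: (ltnP m (m + m)); lia.
have n4 := tower_inj char2 clA frA rA (i := m) (leq_addr _ _) sz n3.
apply: (@triangular (NP m) (fun c => @Jn F m x0 m (@flags m) m c) (gm F m m) (nodes F m) m) => //.
- by move=> c d; exact: JnB.
- by move=> c d; apply: JnM.
- by move=> j hj; apply: mN; lia.
- by move=> j; apply: Jn_mono (n4 j) => // t; move/(@tow_flags m m VT).
Qed.

(** The relation involves only t_0, ..., t_a, so it descends from complete flags to partial ones,
    one projective bundle at a time. *)
Lemma flag_null i a : (i <= m)%N -> (a < i)%N -> @Jn F m x0 i (tow PA i) i (gm F m i a).
Proof.
move=> hi ha; have [d hd] : exists d, (i + d = m)%N by exists (m - i)%N; lia.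
elim: d i hd hi ha => [|d IH] i hd hi ha.
  have E : i = m by lia.
  by rewrite E; apply: Jn_mono (gm_null _) => //; [move=> t; move/(@tow_flags m m VT)|lia].
have := IH i.+1 ltac:(lia) ltac:(lia) ltac:(lia); rewrite /=; case: eqP => [|_]; first lia.
by apply: (tower_const char2 clA frA rA); lia.
Qed.

Lemma art_ext r r' i (Q : NP i) : (forall j, (j < i)%N -> r j = r' j) -> art r Q -> art r' Q.
Proof.
elim: i Q => [//|i IH] Q h [sq aq]; split; first by rewrite -h.
by move=> j; apply: IH (aq j) => a ha; apply: h; exact: ltn_trans ha (ltnSn i).
Qed.

Lemma rC_lt k j : (j < m)%N -> rC m k j = (m - j)%N.
Proof. by rewrite /rC => ->. Qed.

Lemma flag_indep (Q : NP m) : art (fun j => m - j)%N Q -> @Jn F m x0 m (@flags m) m Q -> Q = 0.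
Proof.
move=> aQ jQ; apply: (tower_indep char2 clA frA rA (i := m)); first lia.
  by apply: art_ext aQ => j hj; rewrite rC_lt.
by apply: Jn_mono jQ => // t; move/(@tow_flags m m VT).
Qed.

Section Roots.
Variable rs : seq F.
Hypothesis rsm : forall c, c \in rs -> c ^+ m = 1.
Let vw (w : nat -> F) : nat -> {poly {poly F}} := fun j => cst2 F (w j) * 'X.
(* Substituting t_j := w_j tau for distinct m-th roots of unity w_j, every relation
   of the flag manifold becomes divisible by tau^m. *)
Let good i (Q : NP i) := @Jn F m x0 i (tow PA i) i Q /\
  forall w, adm rs i w -> exists c, evr (cst2 F) (vw w) i Q = c * 'X^m.

Let goodD i (Q Q' : NP i) : good Q -> good Q' -> good (Q + Q').
Proof.
move=> [j h] [j' h']; split; first exact: JnD.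
move=> w aw; have [c hc] := h w aw; have [c' hc'] := h' w aw.
by exists (c + c'); rewrite rmorphD mulrDl -hc -hc'.
Qed.

Let goodM i (Q Q' : NP i) : good Q -> good (Q' * Q).
Proof.
move=> [j h]; split; first exact: JnM.
move=> w aw; have [c hc] := h w aw.
by exists (evr (cst2 F) (vw w) i Q' * c); rewrite rmorphM hc mulrA.
Qed.

Let goodC i (Q : NP i) : good Q -> good (Q%:P : NP i.+1).
Proof.
move=> [j h]; split.
  by apply/JnC; apply: Jn_mono j => // t; exact: tow_sub.
move=> w; rewrite admS => /and3P [aw _ _]; have [c hc] := h w aw.
by exists c; rewrite -hc; exact: evrC.
Qed.

Let good0 i : good (0 : NP i).
Proof. by split; [exact: Jn0|move=> w _; exists 0; rewrite rmorph0 mul0r]. Qed.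

Let good_sum i r (Q : nat -> NP i) : (forall j, good (Q j)) -> good (\sum_(j < r) Q j).
Proof.
move=> h; elim: r => [|r IH]; first by rewrite big_ord0; exact: good0.
by rewrite big_ord_recr; apply: goodD.
Qed.

Let goodG i : (i < m)%N -> good (Gp F m i : NP i.+1).
Proof.
move=> hi; split; first by have := flag_null hi (ltnSn i); rewrite /= eqxx.
move=> w aw; rewrite /vw (Gp_root rsm aw).
by case: eqP => _; [exists 1; rewrite mul1r|exists 0; rewrite mul0r].
Qed.

(** Division by the monic relation [Gp F m i] lowers the degree in t_i below m - i; the coefficients
    of the remainder are reduced recursively. *)
Let reduce i (Q : NP i) : (i <= m)%N -> exists2 A : NP i, art (fun j => m - j)%N A & good (Q - A).
Proof.
elim: i Q => [|i IH] Q hi; first by exists Q => //; rewrite subrr; exact: good0.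
have [mG sG] := Gp_monic F (ltnW hi).
set q := (Q : {poly NP i}); pose R := Pdiv.Ring.rmodp q (Gp F m i).
have eq : q = Pdiv.Ring.rdivp q (Gp F m i) * Gp F m i + R by exact: Pdiv.RingMonic.rdivp_eq.
have sR : (size R <= m - i)%N by rewrite -ltnS -sG; apply: Pdiv.Ring.ltn_rmodpN0; exact: monic_neq0.
have ex j : exists A : NP i, art (fun j => m - j)%N A /\ good (R`_j - A).
  by have [A a g] := IH R`_j (ltnW hi); exists A.
pose A j := proj1_sig (constructive_indefinite_description _ (ex j)).
have hA j : art (fun j => m - j)%N (A j) /\ good (R`_j - A j).
  by rewrite /A; case: constructive_indefinite_description.
exists (\poly_(j < m - i) A j).
  split=> [|j]; first exact: size_poly.
  by rewrite coef_poly; case: ifP => _; [case: (hA j)|exact: art0].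
have -> : Q - \poly_(j < m - i) A j = Pdiv.Ring.rdivp q (Gp F m i) * Gp F m i + \sum_(j < m - i) 'X^j * (R`_j - A j)%:P.
  rewrite -[LHS]/(q - \poly_(j < m - i) A j) {1}eq -addrA; congr (_ + _).
  have RE : R = \poly_(j < m - i) R`_j.
    apply/polyP => j; rewrite coef_poly; case: ltnP => // hj.
    by rewrite nth_default //; exact: leq_trans sR hj.
  rewrite {1}RE !poly_def -sumrB; apply: eq_bigr => j _.
  by rewrite -scalerBl -mul_polyC mulrC.
apply: goodD; first by apply: goodM; exact: goodG.
by apply: (@good_sum i.+1 (m - i) (fun j => 'X^j * (R`_j - A j)%:P : {poly NP i})) => j; apply: goodM; apply: goodC; case: (hA j).
Qed.

(** The Artin form of a relation is again a relation, hence 0 by independence. The relation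
    therefore equals what [reduce] subtracted, and that is divisible by tau^m. *)
Lemma flag_null_roots (Q : NP m) w : @Jn F m x0 m (@flags m) m Q -> adm rs m w ->
  exists c, evr (cst2 F) (fun j => cst2 F (w j) * 'X) m Q = c * 'X^m.
Proof.
move=> jQ aw; have [A aA gA] := reduce Q (leqnn m).
have A0 : A = 0.
  apply: flag_indep => //; have -> : A = Q - (Q - A) by rewrite opprB addrC subrK.
  apply: JnB => //; case: gA => h _; apply: Jn_mono h => // t; by move/(@tow_flags m m VT).
by rewrite A0 subr0 in gA; case: gA => _; exact.
Qed.

End Roots.
End FlagRing.

(** * The coincidence theorem for flags *)

Lemma mem_In (T : eqType) (x : T) (s : seq T) : x \in s -> List.In x s.
Proof.
by elim: s => [//|y s IH]; rewrite inE => /orP [/eqP ->|/IH h]; [left|right].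
Qed.

Section Coincidence.
Variable F : fieldType.
Hypothesis char2 : forall x : F, x + x = 0.
Variables (m : nat) (x0 : uvec m).
Notation Zt := (nat -> line m).
Notation Zs := (Zs x0).
Notation NP := (NP F).
Variable rs : seq F.
Hypotheses (urs : uniq rs) (srs : size rs = m) (rsm : forall c, c \in rs -> c ^+ m = 1).
Variables (k n q : nat) (V : Zt -> line m -> Prop).
Hypothesis k0 : (0 < k)%N.
Hypothesis nm : (n < m)%N.
Hypothesis kq : (k + q <= m)%N.
Hypothesis Vext : forall f g, (forall j, (j < m)%N -> f j = g j) -> forall u, V f u -> V g u.
Hypothesis Vfr : forall f, flags f -> exists e, onf k e /\ forall u, V f u <-> PV k e u.
Hypothesis Vcl : @closed (Zs m.+1) (fun f => flags f /\ V f (f m)).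
Hypothesis Vn : forall f u, flags f -> V f u -> norm2 n (uv u) = 1%Re.

Let m0 : (0 < m)%N.
Proof. lia. Qed.
Let P := PC k V.
Let N := (m + k).+1.
Let cP i : (i <= N)%N -> @closed (Zs i) (tow P i).
Proof. by move=> _; exact: closed_tower. Qed.
Let fP i f (h : (i < N)%N) := @frames_tower m x0 k V k0 m0 Vext Vfr i f h.
Let rP i : (i < N)%N -> (0 < rC m k i)%N.
Proof. by move=> _; exact: rC_pos. Qed.

Let V_of i f : (m <= i)%N -> tow P i.+1 f -> flags f /\ V f (f i).
Proof.
move=> hi tf; have ff := tow_flags_le (leqW hi) tf; split=> //.
by have := tf i (ltnSn i); rewrite /P /PC ltnNge hi /= => -[].
Qed.

Let inv_pos (a : nat) : (0 < / (INR a + 1))%Re.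
Proof. by apply: Rinv_0_lt_compat; have := pos_INR a; lra. Qed.

Let sn_null : @Jn F m x0 m.+1 (tow P m.+1) m.+1 (('X : {poly NP m}) ^+ n).
Proof.
have := @LS_null F char2 m x0 m.+1 (tow P m.+1) m.+1 nat (index_iota 0 n) (fun _ => tv F m.+1 m)
    (fun a f => (/ (INR n + 1) <= ov (f m) (bas x0 a))%Re) (leqnn _).
rewrite big_mkord /= eqxx prodr_const card_ord; apply.
  move=> b p; have := @tv_null F char2 m x0 m.+1 _ m.+1 m (bas x0 b) (/ (INR n + 1))%Re p (leqnn _) (ltnSn m).
  rewrite /= eqxx; apply; last by move=> f [].
  exact: inv_pos.
move=> f tf; have [ff vf] := V_of (leqnn m) tf.
have o1 : osum n (bas x0) (f m) = 1%Re by rewrite osum_bas; [exact: (Vn ff vf)|lia].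
have [b [hb h]] := osum_some o1.
by exists b; split=> //; exact: In_iota.
Qed.

Let hor_null i (p : {poly NP i}) (A : Zs i -> Prop) t : (forall j, Jn A p`_j) -> Jn A p.[t].
Proof.
move=> h; rewrite horner_coef; apply: Jn_sum => // j; apply: JnMr => //; exact: h.
Qed.

Lemma dvd_Xn (p : {poly F}) d r : p \is monic -> size p = r.+1 -> p %| 'X^d -> p = 'X^r.
Proof.
move=> mp sp; have {1}-> : 'X = 'X - (0 : F)%:P by rewrite polyC0 subr0.
move=> /dvdp_exp_XsubCP [j _]; rewrite polyC0 subr0 => e.
have pj : p = 'X^j by apply/eqP; rewrite -eqp_monic ?monicXn.
by move: sp; rewrite pj size_polyXn => -[->].
Qed.

(* The line s in V satisfies a homogeneous equation s^k = A(t, s), and s^n = 0.  At roots of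
   unity the monic polynomial x^k - A(w, x) therefore divides x^n, so A vanishes there; as A
   is in Artin form, A = 0. *)
Let sk_null : @Jn F m x0 m.+1 (tow P m.+1) m.+1 (('X : {poly NP m}) ^+ k).
Proof.
have zx : @Zc F (Zs m.+1) (tow P m.+1) k.*2.+1 (@evc F m m.+1 (('X : {poly NP m}) ^+ k)) by apply: evc_coc.
have [A [aA bA]] := tower_surj char2 cP fP rP (i := m.+1) ltac:(rewrite /N; lia) zx.
(* The homogeneous part of weight k is still a relation, is monic of degree k in s, and scales as
   tau^k under the substitution. *)
set p : {poly NP m} := comp k (('X : {poly NP m}) ^+ k - A : NP m.+1).
have jp : @Jn F m x0 m.+1 (tow P m.+1) m.+1 p.
  by apply: J_comp; apply: B_ext bA => s hs; rewrite evcB.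
have rk : rC m k m = k by rewrite /rC ltnn; case: (ltnP m (m + k)) => ?; lia.
have [sA cA] := aA; rewrite rk in sA.
have pk : p`_k = 1.
  by rewrite /p coef_comp leqnn subnn coefB coefXn eqxx nth_default // subr0 comp01.
have sp : size p = k.+1.
  apply/eqP; rewrite eqn_leq size_poly /=; apply: contraT; rewrite -leqNgt => h.
  by move: pk; rewrite nth_default // => /eqP; rewrite eq_sym oner_eq0.
have mp : p \is monic by rewrite monicE /lead_coef sp pk.
have ap j : (j < k)%N -> art (fun j => m - j)%N p`_j.
  move=> hj; rewrite /p coef_comp (ltnW hj) coefB coefXn ltn_eqF // sub0r.
  apply: art_comp; apply: artN; apply: art_ext (cA j) => a ha; exact: rC_lt.
(* As s^n and p are both null, so is the remainder; its degree in s is below k, so each of its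
   coefficients is a relation of the flag manifold. *)
pose Q := Pdiv.Ring.rdivp ('X^n) p; pose R := Pdiv.Ring.rmodp ('X^n) p.
have eX : 'X^n = Q * p + R by exact: Pdiv.RingMonic.rdivp_eq.
have sR : (size R <= k)%N by rewrite -ltnS -sp; apply: Pdiv.Ring.ltn_rmodpN0; exact: monic_neq0.
have jR j : @Jn F m x0 m (@flags m) m R`_j.
  have j1 : @Jn F m x0 m.+1 (tow P m.+1) m.+1 R.
    have -> : R = 'X^n - Q * p by rewrite eX addrC addKr.
    by apply: (@JnB F char2 m x0 m.+1 (tow P m.+1) m.+1) => [|]; [exact sn_null|apply: (JnM char2)].
  have := tower_inj char2 cP fP rP (i := m) ltac:(rewrite /N; lia) _ j1 j; rewrite rk => /(_ sR).
  by apply: Jn_mono => // t; move/(@tow_flags m k V).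
have p0 j : (j < k)%N -> p`_j = 0.
  move=> hj; apply: (interpolation urs srs (leqnn m) (ap j hj)) => w aw.
  pose pw := map_poly (evr (idfun : {rmorphism F -> F}) w m) p.
  suff e : pw = 'X^k by rewrite -coef_map -/pw e coefXn ltn_eqF.
  have mpw : pw \is monic by exact: monic_map.
  have spw : size pw = k.+1.
    by rewrite size_map_poly_id0 ?sp // (monicP mp) rmorph1 oner_eq0.
  apply: (@dvd_Xn pw n k mpw spw).
  (* The substitution is t_j = w_j tau and s = x tau, with x the inner variable. *)
  pose u (j : nat) : {poly {poly F}} := if (j < m)%N then cst2 F (w j) else 'X%:P.
  pose v j := u j * 'X.
  have um : u m = 'X%:P by rewrite /u ltnn.
  have evp : evr (cst2 F) v m.+1 p = pw%:P * 'X^k.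
    rewrite /v /p evr_hom -/p; congr (_ * _).
    pose u' (j : nat) : {poly F} := if (j < m)%N then (w j)%:P else 'X.
    have -> : pw = evr (polyC : {rmorphism F -> {poly F}}) u' m.+1 p.
      apply/esym/evr_coefs => //; last by rewrite /u' ltnn.
      by move=> a ha; rewrite /u' ha.
    have -> := @evr_nat F {poly F} {poly {poly F}} (polyC : {rmorphism F -> {poly F}}) (cst2 F) (polyC : {rmorphism {poly F} -> {poly {poly F}}}) u' m.+1 p (fun _ => erefl).
    by apply: evr_ext => a _; rewrite /u /u'; case: ifP.
  have [c hc] : exists c, evr (cst2 F) v m.+1 R = c * 'X^m.
    have ex j' : exists c, evr (cst2 F) v m R`_j' = c * 'X^m.
      have [c hc] := flag_null_roots char2 m0 rsm (jR j') aw.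
      by exists c; rewrite -hc; apply: evr_ext => a ha; rewrite /v /u ha.
    pose c j' := proj1_sig (constructive_indefinite_description _ (ex j')).
    have hc j' : evr (cst2 F) v m R`_j' = c j' * 'X^m.
      by rewrite /c; case: constructive_indefinite_description.
    exists (\sum_(j' < size R) c j' * v m ^+ j').
    have sz : (size (map_poly (evr (cst2 F) v m) R) <= size R)%N by exact: size_poly.
    rewrite evr_poly (horner_coef_wide _ sz) mulr_suml; apply: eq_bigr => j' _.
    by rewrite coef_map /= hc mulrAC.
  (* In the coefficient of tau^n the last term disappears because n < m; what is left says that [pw]
     divides x^n. *)
  have E : evr (cst2 F) v m.+1 ('X^n) = evr (cst2 F) v m.+1 Q * (pw%:P * 'X^k) + c * 'X^m.
    by rewrite eX rmorphD rmorphM evp hc.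
  rewrite rmorphXn evrX /v um exprMn -rmorphXn in E.
  have := congr1 (fun x : {poly {poly F}} => x`_n) E.
  rewrite /= coefD !coefMXn ltnn subnn nm addr0 coefC eqxx mulrA coefMXn => ->.
  case: ifP => _; first exact: dvdp0.
  by rewrite coefMC; apply: dvdp_mull.
suff -> : ('X : {poly NP m}) ^+ k = p by exact: jp.
apply/polyP => j; rewrite coefXn; case: eqP => [->|ne]; first by rewrite pk.
case: (ltnP j k) => hj; first by rewrite p0.
by rewrite nth_default // sp; lia.
Qed.

Lemma evcXn i d s : (0 < size s)%N -> @evc F m i.+1 (('X : {poly NP i}) ^+ d) s = cpow (tl F (m := m) i) d s.
Proof.
elim: d s => [|d IH] s hs /=; first by rewrite expr0; exact: (@evc1 F m i.+1 s hs).
have e := @evc_mulX F char2 m i ('X^d) s.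
rewrite exprSr; apply: etrans e _; congr (_ s); apply: cup_ext => // u hu; exact: IH.
Qed.

(** Any line of V may be moved to position m, so s^k = 0 also holds for the extra line following a
    frame of V. *)
Let zk_null : @Jn F m x0 (m + k).+1 (tow P (m + k).+1) (m + k).+1 (('X : {poly NP (m + k)}) ^+ k).
Proof.
move=> p; pose g (f : Zt) : Zt := upd f m (f (m + k)%N).
have mk : (m <= m + k)%N by exact: leq_addr.
have tg f : tow P (m + k).+1 f -> tow P m.+1 (g f).
  move=> tf; have [ff vf] := V_of mk tf.
  have e a : (a < m)%N -> f a = g f a by move=> ha; rewrite /g updN.
  move=> j; rewrite ltnS leq_eqVlt => /orP [/eqP ->|hj].
    rewrite /P /PC ltnn {2}/g updE; split; first exact: Vext vf.
    by move=> _ b /andP [h1 h2]; lia.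
  by rewrite /P PC_lt // => a; exact: (flags_ext e ff hj).
have := @B_pull F (Zs m.+1) (Zs (m + k).+1) g (tow P (m + k).+1) (tow P m.+1) p _ (@cont_pick m x0 (m + k) mk) tg (sk_null p).
apply: B_ext => s hs; rewrite /pull evcXn ?size_map // evcXn // -[LHS]/(pull g (cpow (tl F (m := m) m) k) s) cpow_pull.
congr (cpow _ k s); apply: functional_extensionality => u.
by rewrite /tl /pull -map_comp; congr zeta; apply: eq_map => f /=; rewrite /g updE.
Qed.

Let frame_of f : tow P (m + k) f -> flags f /\ onf k (fun a => f (m + a)%N) /\
  forall u, V f u -> osum k (fun a => f (m + a)%N) u = 1%Re.
Proof.
move=> tf; have ff := tow_flags_le (leq_addr k m) tf; split=> //.
have [e [oe he]] := Vfr ff.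
have vf a : (a < k)%N -> V f (f (m + a)%N).
  by move=> ha; have := tf (m + a)%N ltac:(lia); rewrite /P /PC ltnNge leq_addr /= => -[].
have og : onf k (fun a => f (m + a)%N).
  have half a b : (a < b)%N -> (b < k)%N -> ip (f (m + b)%N) (f (m + a)%N) = RtoC 0.
    move=> ab bi; have := tf (m + b)%N ltac:(lia); rewrite /P /PC ltnNge leq_addr /= => -[_ h].
    by apply: h; lia.
  move=> a b ha hb ne; case: (ltngtP a b) => // l; last exact: half.
  by rewrite ip_conj half //; apply: Ceq => /=; lra.
split=> // u vu; rewrite (osum_frame oe og); first by apply/he.
by move=> a ha; apply/he; exact: vf.
Qed.

Let chern : {poly NP (m + k)} := \prod_(a < k) ('X - (tv F (m + k) (m + a))%:P).

Let chern_null : @Jn F m x0 (m + k).+1 (tow P (m + k).+1) (m + k).+1 chern.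
Proof.
have := @LS_null F char2 m x0 (m + k).+1 (tow P (m + k).+1) (m + k).+1 'I_k (index_enum 'I_k)
  (fun b => tv F (m + k).+1 (m + k) - tv F (m + k).+1 (m + b))
  (fun a f => (/ (INR k + 1) <= ov (f (m + k)%N) (f (m + a)%N))%Re) (leqnn _).
have -> : \prod_(a : 'I_k) (tv F (m + k).+1 (m + k) - tv F (m + k).+1 (m + a)) = chern.
  apply: eq_bigr => a _; rewrite /= eqxx.
  by case: eqP => // E; have := ltn_ord a; lia.
apply.
  move=> b p; apply: (@tv_diff_null F char2 m x0 (m + k).+1 _ (m + k).+1 (m + k) (m + b) (/ (INR k + 1))%Re p) => //.
    by have := ltn_ord b; lia.
  by move=> f [].
move=> f tf; have [ff vf] := V_of (leq_addr k m) tf.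
have [_ [_ h]] := frame_of (tow_sub tf).
have [b [hb h']] := osum_some (h _ vf).
by exists (Ordinal hb); split=> //; apply: mem_In; exact: mem_index_enum.
Qed.

(** The extra line z of V satisfies both z^k = 0 and prod (z - s_a) = 0. Their difference has degree
    below k in z, so its coefficients are relations without z, and t_j may be substituted for z. *)
Let chern_diff (j : nat) : (j < m)%N ->
  @Jn F m x0 (m + k) (tow P (m + k)) (m + k) (\prod_(a < k) (tv F (m + k) j - tv F (m + k) (m + a)) - tv F (m + k) j ^+ k).
Proof.
move=> hj; pose D : {poly NP (m + k)} := chern - 'X^k.
have jD : @Jn F m x0 (m + k).+1 (tow P (m + k).+1) (m + k).+1 D.
  by apply: (@JnB F char2 m x0 (m + k).+1 (tow P (m + k).+1) (m + k).+1); [exact: chern_null|exact zk_null].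
have mc : chern \is monic by apply: monic_prod => i _; exact: monicXsubC.
have sc : size chern = k.+1 by rewrite /chern size_prod_XsubC /index_enum -enumT size_enum_ord.
have rk : rC m k (m + k) = k by rewrite /rC ltnNge leq_addr /= ltnn.
have sD : (size D <= rC m k (m + k))%N.
  rewrite rk; apply/leq_sizeP => i hi; rewrite coefB coefXn; case: eqP => [->|ne].
    by move/monicP: mc; rewrite /lead_coef sc /= => ->; rewrite subrr.
  by rewrite nth_default ?subr0 // sc; lia.
have jc := tower_inj char2 cP fP rP (i := (m + k)%N) (leqnn _) sD jD.
have := hor_null (tv F (m + k) j) jc; congr Jn.
rewrite /D hornerD hornerN hornerXn /chern horner_prod; congr (_ - _).
by apply: eq_bigr => a _; rewrite hornerXsubC.
Qed.

Fixpoint mo (i : nat) : NP i :=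
  match i return NP i with
  | O => 1
  | S i' => if (i' < q)%N then ((mo i')%:P * 'X^k : {poly NP i'}) else ((mo i')%:P : {poly NP i'})
  end.

Lemma mo_neq0 i : mo i <> 0.
Proof.
elim: i => [|i IH] /=; first by apply/eqP; exact: oner_neq0.
case: ifP => _ h; apply: IH.
  by have := congr1 (fun p : {poly NP i} => p`_k) h; rewrite coefMXn ltnn subnn coefC eqxx coef0.
by have := congr1 (fun p : {poly NP i} => p`_0) h; rewrite coefC eqxx coef0.
Qed.

(** For j < q the exponent k must stay below m - j, which is the inequality k + q <= m. *)
Lemma mo_art i : (i <= m)%N -> art (fun j => m - j)%N (mo i).
Proof.
elim: i => [//|i IH] hi; have a := IH (ltnW hi); split; last first.
  move=> j; rewrite /=; case: ifP => _; rewrite ?coefMXn ?coefC; case: ifP => // _; try exact: art0.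
  by case: ifP => // _; exact: art0.
rewrite /=; case: ifP => hq; last by apply: leq_trans (size_polyC_leq1 _) _; lia.
apply: leq_trans (size_polyMleq _ _) _; rewrite size_polyXn.
by have := size_polyC_leq1 (mo i); lia.
Qed.

Lemma mo_prod i : (q <= i)%N -> \prod_(j < q) tv F i j ^+ k = mo i.
Proof.
have L j (r : nat) : (r <= j)%N -> \prod_(a < r) tv F j.+1 a ^+ k = ((\prod_(a < r) tv F j a ^+ k)%:P : {poly NP j}).
  move=> hr; rewrite rmorph_prod; apply: eq_bigr => a _; rewrite rmorphXn /=.
  by case: eqP => // e; have := ltn_ord a; lia.
have lo j : (j <= q)%N -> \prod_(a < j) tv F j a ^+ k = mo j.
  elim: j => [|j IH] hj; first by rewrite big_ord0.
  by rewrite big_ord_recr L // IH ?(ltnW hj) //= hj eqxx.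
elim: i => [|i IH] hi; first by rewrite -lo //; move: hi; case: q.
move: hi; rewrite leq_eqVlt => /orP [/eqP e|hi]; first by rewrite -lo ?e.
have hi' : (q <= i)%N by [].
by rewrite L // IH //= ltnNge hi'.
Qed.

(* Without a coincidence the product of all t_j - s_a (j < q, a < k) vanishes, but it equals the
   product of the t_j^k, a nonzero Artin monomial of the flag manifold. *)
Lemma flag_coincidence_field : exists f, flags f /\ forall u j, V f u -> (j < q)%N -> ip u (f j) = RtoC 0.
Proof.
apply: NNPP => nex.
have pos f : tow P (m + k) f -> exists x : 'I_q * 'I_k, (0 < ov (f x.1) (f (m + x.2)%N))%Re.
  move=> tf; apply: NNPP => nx; have [ff [og hg]] := frame_of tf; apply: nex; exists f; split=> // u j vu hj.
  rewrite /ip (expand (uv (f j)) og (hg u vu)) csum0 // => a ha.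
  have -> : hdot m (uv (f (m + a)%N)) (uv (f j)) = RtoC 0; last by sring.
  rewrite -/(ip (f (m + a)%N) (f j)); apply: ov0_ip; rewrite ov_sym.
  have := ov_bd (f j) (f (m + a)%N); case=> b1 _; case: (Rle_lt_or_eq_dec _ _ b1) => [h|<- //].
  by case: nx; exists (Ordinal hj, Ordinal ha).
have cov i : (i < m + k)%N -> @cont (line m) (Zs (m + k)) (fun f => f i) by exact: cont_coord.
(* Compactness makes the overlaps uniformly positive, so each set of the cover kills one factor t_j
   - s_a. *)
have [||c [c0 hc]] := @rcont_lower (Zs (m + k)) (tow P (m + k)) ('I_q * 'I_k)%type (index_enum _)
    (fun x f => ov (f x.1) (f (m + x.2)%N)) _ (cP (leqnSn _)).
- by move=> [i a] /=; apply: rcont_ov; apply: cov; [have := ltn_ord i; lia|have := ltn_ord a; lia].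
- by move=> f /pos [x hx]; exists x; split=> //; apply: mem_In; exact: mem_index_enum.
have n1 : @Jn F m x0 (m + k) (tow P (m + k)) (m + k) (\prod_(x : 'I_q * 'I_k) (tv F (m + k) x.1 - tv F (m + k) (m + x.2))).
  apply: (@LS_null F char2 m x0 (m + k) (tow P (m + k)) (m + k) ('I_q * 'I_k)%type (index_enum _)
    (fun x => tv F (m + k) x.1 - tv F (m + k) (m + x.2))
    (fun x f => (c <= ov (f x.1) (f (m + x.2)%N))%Re) (leqnn _)) => // -[i a] p /=.
  have hi := ltn_ord i; have ha := ltn_ord a.
  by apply: (@tv_diff_null F char2 m x0 (m + k) _ (m + k) i (m + a) c p) => //; [lia|lia|move=> f []].
have n2 r : (r <= q)%N -> @Jn F m x0 (m + k) (tow P (m + k)) (m + k)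
    (\prod_(j < r) \prod_(a < k) (tv F (m + k) j - tv F (m + k) (m + a)) - \prod_(j < r) tv F (m + k) j ^+ k).
  elim: r => [|r IH] hr; first by rewrite !big_ord0 subrr; exact: Jn0.
  rewrite !big_ord_recr /=; set A := \prod_(j < r) _; set B := \prod_(a < k) _; set A' := \prod_(j < r) _; set B' := _ ^+ k.
  have -> : A * B - A' * B' = (A - A') * B + A' * (B - B') by ring.
  by apply: (JnD char2); [apply: (JnMr char2) => //; apply: IH; lia|apply: (JnM char2) => //; apply: chern_diff; lia].
have n3 : @Jn F m x0 (m + k) (tow P (m + k)) (m + k) (mo (m + k)).
  rewrite -mo_prod; last lia.
  have := JnB char2 n1 (n2 q (leqnn q)); rewrite pair_bigA opprB addrC subrK; exact.
(* The monomial is free of the s_a, so the relation descends through the k bundles of lines of V to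
   the flag manifold. *)
have n4 d : (d <= k)%N -> @Jn F m x0 (m + (k - d)) (tow P (m + (k - d))) (m + (k - d)) (mo (m + (k - d))).
  elim: d => [|d IH] hd; first by rewrite subn0.
  have := IH (ltnW hd); have -> : (m + (k - d) = (m + (k - d.+1)).+1)%N by lia.
  move=> /=; case: ifP => [|_]; first lia.
  by apply: (tower_const char2 cP fP rP); rewrite /N; lia.
have := n4 k (leqnn k); rewrite subnn addn0 => n5.
apply: (@mo_neq0 m); apply: (flag_indep char2 m0 (mo_art (leqnn m))).
by apply: Jn_mono n5 => // t; move/(@tow_flags m k V).
Qed.

End Coincidence.

(** The splitting field of X^m - 1 over the field with two elements; m is nonzero there, so the
    roots are simple. *)
Lemma roots_of_unity_char2 m : odd m -> exists (F : fieldType) (rs : seq F),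
  (forall x : F, x + x = 0) /\ uniq rs /\ size rs = m /\ (forall c, c \in rs -> c ^+ m = 1).
Proof.
move=> om; have m0 : (0 < m)%N by case: m om.
pose p : {poly 'F_2} := 'X^m - 1.
have p0 : p != 0 by rewrite -size_poly_gt0 size_XnsubC.
have [L [rs eq _]] := FinSplittingFieldFor p0.
have c2 : 2 \in [pchar L] by rewrite pchar_lalg; exact: pchar_Fp.
have ep : map_poly (in_alg L) p = 'X^m - 1 by rewrite rmorphB /= map_polyXn rmorph1.
rewrite ep in eq.
have n0 : m%:R != 0 :> L.
  by rewrite -(dvdn_pcharf c2) dvdn2 om.
exists L, rs; split; first by move=> x; rewrite -mulr2n -mulr_natl (pcharf0 c2) mul0r.
have sq : size (\prod_(z <- rs) ('X - z%:P)) = m.+1 by rewrite -(eqp_size eq) size_XnsubC.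
split; first by rewrite -separable_prod_XsubC -(eqp_separable eq) separable_Xn_sub_1.
split; first by move: sq; rewrite size_prod_XsubC => -[].
move=> c hc; have : root ('X^m - 1 : {poly L}) c by rewrite (eqp_root eq) root_prod_XsubC.
by rewrite rootE !hornerE subr_eq0 => /eqP.
Qed.

Theorem flag_coincidence m (x0 : uvec m) k n q (V : (nat -> line m) -> line m -> Prop) :
  odd m -> (0 < k)%N -> (n < m)%N -> (k + q <= m)%N ->
  (forall f g, (forall j, (j < m)%N -> f j = g j) -> forall u, V f u -> V g u) ->
  (forall f, flags f -> exists e, onf k e /\ forall u, V f u <-> PV k e u) ->
  @closed (Zs x0 m.+1) (fun f => flags f /\ V f (f m)) ->
  (forall f u, flags f -> V f u -> norm2 n (uv u) = 1%Re) ->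
  exists f, flags f /\ forall u j, V f u -> (j < q)%N -> ip u (f j) = RtoC 0.
Proof.
move=> om k0 nm kq Vext Vfr Vcl Vn.
have [F [rs [c2 [u [s r]]]]] := roots_of_unity_char2 om.
exact: (@flag_coincidence_field F c2 m x0 rs u s r k n q V).
Qed.

(** * Grassmannians *)

Ltac cring := lazymatch goal with |- @eq _ ?a ?b => change (@eq C a b) end; sring.

Section LinearAlgebra.
Local Close Scope ring_scope.
Local Open Scope R_scope.

Lemma csum_ext r f g : (forall i, (i < r)%nat -> f i = g i) -> csum r f = csum r g.
Proof.
elim: r => [//|r IH] h /=; rewrite h // IH // => i hi; apply: h; lia.
Qed.

Lemma csum_add r f g : (csum r f + csum r g)%C = csum r (fun i => f i + g i)%C.
Proof. by elim: r => [|r IH] /=; [cring|rewrite -IH; cring]. Qed.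

Lemma csum_scale r c f : (c * csum r f)%C = csum r (fun i => c * f i)%C.
Proof. by elim: r => [|r IH] /=; [cring|rewrite -IH; cring]. Qed.

Lemma csum_delta r i f : (i < r)%nat -> (forall a, (a < r)%nat -> a <> i -> f a = RtoC 0) -> csum r f = f i.
Proof.
elim: r => [//|r IH] hi h /=.
case: (PeanoNat.Nat.eq_dec i r) => [e|ne]; last first.
  rewrite IH; [|lia|by move=> a ha; apply: h; lia].
  by rewrite (h r); [cring|lia|lia].
by rewrite e csum0; [cring|move=> a ha; apply: h; lia].
Qed.

Lemma lincombE r c b j : lincomb r c b j = csum r (fun i => c i * b i j)%C.
Proof. by elim: r => [//|r IH]; rewrite /= /vadd /vscale IH. Qed.

Lemma vec_ext (u v : cvec) : (forall i, u i = v i) -> u = v.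
Proof. exact: functional_extensionality. Qed.

Definition Lin r (b : nat -> cvec) (v : cvec) := exists c, v = lincomb r c b.

Lemma Lin_add r b u v : Lin r b u -> Lin r b v -> Lin r b (vadd u v).
Proof.
move=> [c ->] [d ->]; exists (fun i => c i + d i)%C; apply: vec_ext => j.
rewrite /vadd !lincombE -[Cadd _ _]/(Cplus _ _) csum_add; apply: csum_ext => i _; cring.
Qed.

Lemma Lin_scale r b a v : Lin r b v -> Lin r b (vscale a v).
Proof.
move=> [c ->]; exists (fun i => a * c i)%C; apply: vec_ext => j.
rewrite /vscale !lincombE -[Cmul _ _]/(Cmult _ _) csum_scale; apply: csum_ext => i _; cring.
Qed.

Lemma Lin0 r b : Lin r b vzero.
Proof.
exists (fun _ => RtoC 0); apply: vec_ext => j; rewrite lincombE csum0 // => i _; cring.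
Qed.

Lemma Lin_in r b i : (i < r)%nat -> Lin r b (b i).
Proof.
move=> hi; exists (fun a => if a == i then RtoC 1 else RtoC 0); apply: vec_ext => j.
rewrite lincombE (csum_delta hi) ?eqxx; first by rewrite Cmult_1_l.
by move=> a _ ne; case: eqP => // _; cring.
Qed.

Lemma Lin_comb r b (W : cvec -> Prop) c : W vzero -> (forall u v, W u -> W v -> W (vadd u v)) ->
  (forall a v, W v -> W (vscale a v)) -> (forall i, (i < r)%nat -> W (b i)) -> W (lincomb r c b).
Proof.
move=> w0 wD wZ; elim: r => [//|r IH] h /=; apply: wD; first by apply: IH => i hi; apply: h; lia.
by apply: wZ; apply: h; lia.
Qed.

Lemma Lin_trans r s b e v : (forall i, (i < s)%nat -> Lin r b (e i)) -> Lin s e v -> Lin r b v.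
Proof.
by move=> h [c ->]; apply: Lin_comb => //; [exact: Lin0|exact: Lin_add|exact: Lin_scale].
Qed.

Lemma Lin_mono r s b v : (r <= s)%nat -> Lin r b v -> Lin s b v.
Proof. by move=> rs; apply: Lin_trans => i hi; apply: Lin_in; lia. Qed.

Lemma hdotn_ext r (u u' v v' : cvec) : (forall i, (i < r)%nat -> u i = u' i) -> (forall i, (i < r)%nat -> v i = v' i) ->
  hdotn r u v = hdotn r u' v'.
Proof.
elim: r => [//|r IH] hu hv /=; rewrite hu // hv // IH // => i hi; [apply: hu|apply: hv]; lia.
Qed.

Lemma hdotn_wide r s (u v : cvec) : (r <= s)%nat -> supported r u -> hdotn s u v = hdotn r u v.
Proof.
move=> rs su; elim: s rs => [|s IH]; first by case: r su.
rewrite leq_eqVlt => /orP [/eqP -> //|h] /=.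
rewrite IH // su; last by apply/leP.
by rewrite -[C0]/(RtoC 0); cring.
Qed.

Variable m : nat.

(** Elements of a Grassmannian are supported vectors, whereas a [uvec] is arbitrary beyond index m;
    truncation passes from the latter to the former. *)
Definition trunc (v : cvec) : cvec := fun i => if (i < m)%N then v i else C0.

Lemma supp_trunc v : supported m (trunc v).
Proof. by move=> i /leP h; rewrite /trunc ltnNge h. Qed.

Lemma trunc_id v : supported m v -> trunc v = v.
Proof.
move=> sv; apply: vec_ext => i; rewrite /trunc; case: ltnP => // h; rewrite sv //; exact/leP.
Qed.

Lemma hdot_truncl u v : hdot m (trunc u) v = hdot m u v.
Proof. by apply: hdotn_ext => // i hi; rewrite /trunc hi. Qed.

Lemma hdot_lincomb r c b w : hdot m (lincomb r c b) w = csum r (fun i => c i * hdot m (b i) w)%C.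
Proof.
elim: r => [|r IH]; last by rewrite /= hdot_addl hdot_scalel IH.
rewrite /= /hdot; elim: m => [//|q IH] /=; rewrite IH -[vzero q]/(RtoC 0); cring.
Qed.

Lemma norm2_0 v : supported m v -> norm2 m v = 0 -> v = vzero.
Proof.
move=> sv h; apply: vec_ext => i; case: (ltnP i m) => hi; last by apply: sv; apply/leP.
have := coord_le v hi; rewrite h; have := Cnorm2_ge0 (v i); rewrite /Cnorm2 => h1 h2.
by apply: Ceq => /=; nra.
Qed.

Lemma norm2_scale c v : norm2 m (vscale c v) = Cnorm2 c * norm2 m v.
Proof. by rewrite !norm2E hdot_scalel hdot_scaler hdot_self /Cnorm2 /=; sring. Qed.

Lemma normalize v : norm2 m v <> 0 -> exists (u : uvec m) (c : R), 0 < c /\ uv u = vscale (RtoC (/ c)) v.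
Proof.
move=> nz; have n0 := norm2_ge0 m v; pose c := sqrt (norm2 m v).
have c0 : 0 < c by apply: sqrt_lt_R0; lra.
have cc : c * c = norm2 m v by apply: sqrt_sqrt.
have h : norm2 m (vscale (RtoC (/ c)) v) = 1.
  rewrite norm2_scale -cc /Cnorm2 /=; sfield; lra.
by exists (exist (fun u => norm2 m u = 1) _ h), c.
Qed.

Notation tE e := (fun a => trunc (uv (e a))).

Lemma coef_onf r (e : nat -> uvec m) c i : onf r e -> (i < r)%nat -> hdot m (lincomb r c (tE e)) (uv (e i)) = c i.
Proof.
move=> he hi; rewrite hdot_lincomb (csum_delta hi) => [|a ha ne]; rewrite hdot_truncl.
  by rewrite -/(ip (e i) (e i)) ip_self; cring.
by rewrite -/(ip (e a) (e i)) he //; cring.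
Qed.

Lemma PV_Lin r (e : nat -> uvec m) (u : uvec m) : onf r e -> (PV r e u <-> Lin r (tE e) (trunc (uv u))).
Proof.
move=> he; split.
  move=> h; exists (fun i => ip u (e i)); apply: vec_ext => j; rewrite lincombE /trunc.
  case: ltnP => hj; last by rewrite csum0 // => i _; rewrite -[C0]/(RtoC 0); cring.
  have ex w := expand w he h.
  have := ex (e0vec j); rewrite {1}/hdot hdotn_e0 hj => ->.
  by apply: csum_ext => i _; rewrite /hdot hdotn_e0 hj.
move=> [c hc].
have ci i : (i < r)%nat -> ip u (e i) = c i by move=> hi; rewrite /ip -hdot_truncl hc coef_onf.
have z : norm2 m (resid r e u) = 0.
  have rd w : hdot m (resid r e u) w = RtoC 0.
    rewrite resid_dot -hdot_truncl hc hdot_lincomb.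
    rewrite (@csum_ext r _ (fun i => c i * hdot m (trunc (uv (e i))) w)%C); first by cring.
    by move=> i hi; rewrite ci // hdot_truncl.
  by rewrite norm2E rd.
by rewrite resid_norm // in z; rewrite /PV; lra.
Qed.

Lemma gram_schmidt (x0 : uvec m) r b : (forall i, (i < r)%nat -> supported m (b i)) ->
  (forall c : nat -> Cx, lincomb r c b = vzero -> forall i, (i < r)%coq_nat -> c i = C0) ->
  exists e : nat -> uvec m, onf r e /\ (forall i, (i < r)%nat -> Lin r b (trunc (uv (e i)))) /\
    forall i, (i < r)%nat -> Lin r (tE e) (b i).
Proof.
move=> sb ind.
suff H j : (j <= r)%nat -> exists e : nat -> uvec m, onf j e /\ (forall i, (i < j)%nat -> Lin j b (trunc (uv (e i)))) /\
    forall i, (i < j)%nat -> Lin j (tE e) (b i) by exact: (H r (leqnn r)).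
elim: j => [|j IH] hj; first by exists (fun _ => x0); split; [move=> i|split=> i].
have [e [oe [eb be]]] := IH (ltnW hj).
pose p := lincomb j (fun i => hdot m (b j) (uv (e i))) (tE e).
pose w := vadd (b j) (vscale (- RtoC 1)%C p).
have sp : supported m p.
  move=> i hi; rewrite /p lincombE csum0 // => a _; rewrite (supp_trunc _ hi) -[C0]/(RtoC 0); cring.
have sw : supported m w.
  by move=> i hi; rewrite /w /vadd /vscale (sb j hj i hi) (sp i hi); apply: Ceq; rewrite /=; lra.
have pb : Lin j b p by apply: (Lin_trans eb); exists (fun i => hdot m (b j) (uv (e i))).
have wn : norm2 m w <> 0.
  move=> h; have w0 := norm2_0 sw h.
  have bj : b j = p.
    apply: vec_ext => i; have := congr1 (fun v : cvec => v i) w0; rewrite /w /vadd /vscale /vzero => e1.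
    have e2 := congr1 fst e1; have e3 := congr1 snd e1; rewrite /= in e2 e3.
    by apply: Ceq; lra.
  have [c hc] := pb.
  (* If the residue were zero, [b j] would be a combination of its predecessors: a relation with
     coefficient -1 at j. *)
  have := ind (fun i => if (i < j)%N then c i else if i == j then (- RtoC 1)%C else RtoC 0) _ j (elimT ltP hj).
  rewrite ltnn eqxx => /(_ _)/(congr1 fst) /= q; suff : -1 = 0 by lra.
  apply: q; apply: vec_ext => i; rewrite lincombE.
  have L s : (j < s)%nat -> csum s (fun a => (if (a < j)%N then c a else if a == j then (- RtoC 1)%C else RtoC 0) * b a i)%C = (csum j (fun a => c a * b a i) - b j i)%C.
    elim: s => [//|s IHs]; rewrite ltnS leq_eqVlt => /orP [/eqP <-|hs] /=.
      rewrite ltnn eqxx (@csum_ext j _ (fun a => c a * b a i)%C) => [|a ha]; last by rewrite ha.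
      cring.
    by rewrite IHs // ltnNge (ltnW hs) /= gtn_eqF //; cring.
  by rewrite L // -lincombE -hc bj -[vzero i]/(RtoC 0); cring.
have [u [c [c0 hu]]] := normalize wn.
have su : supported m (uv u).
  by move=> i hi; rewrite hu /vscale (sw i hi); apply: Ceq; rewrite /=; lra.
have wo i : (i < j)%nat -> hdot m w (uv (e i)) = RtoC 0.
  by move=> hi; rewrite /w hdot_addl hdot_scalel /p coef_onf //; cring.
have uo i : (i < j)%nat -> ip u (e i) = RtoC 0 by move=> hi; rewrite /ip hu hdot_scalel wo //; cring.
pose e' i := if i == j then u else e i.
have ej : e' j = u by rewrite /e' eqxx.
have el i : (i < j)%nat -> e' i = e i by rewrite /e'; case: eqP => //; lia.
have bw : b j = vadd p (vscale (RtoC c) (uv u)).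
  apply: vec_ext => i; rewrite hu /w /vadd /vscale; apply: Ceq; rewrite /=; sfield; lra.
have inc i : (i < j)%nat -> Lin j.+1 (tE e') (tE e i).
  by move=> hi; have := @Lin_in j.+1 (tE e') i (leqW hi); rewrite el.
exists e'; split; last split.
- move=> a a' ha ha' ne.
  have cz : Cconj (RtoC 0) = RtoC 0 by apply: Ceq => /=; lra.
  case: (PeanoNat.Nat.eq_dec a j) => [ea|na].
    by rewrite ea ej el ?uo //; lia.
  case: (PeanoNat.Nat.eq_dec a' j) => [ea|na'].
    by rewrite ea ej el; [rewrite ip_conj uo //|]; lia.
  by rewrite !el; [apply: oe|..]; lia.
- move=> i hi; case: (PeanoNat.Nat.eq_dec i j) => [ei|ni].
    rewrite ei ej trunc_id // hu; apply: Lin_scale; apply: Lin_add; first by apply: Lin_in.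
    by apply: Lin_scale; apply: (Lin_mono (leqnSn j)).
  by rewrite el; [apply: (Lin_mono (leqnSn j)); apply: eb|]; lia.
- move=> i hi; case: (PeanoNat.Nat.eq_dec i j) => [ei|ni].
    rewrite ei bw; apply: Lin_add; last first.
      by apply: Lin_scale; have := @Lin_in j.+1 (tE e') j (ltnSn j); rewrite ej trunc_id.
    by apply: (Lin_trans inc); exists (fun i => hdot m (b j) (uv (e i))).
  by apply: (Lin_trans inc); apply: be; lia.
Qed.

Lemma grass_frame (x0 : uvec m) n k (W : Grass n k) : (n <= m)%nat ->
  exists e : nat -> uvec m, onf k e /\ forall v, gsub W v <-> Lin k (tE e) v.
Proof.
case: W => V [[sV [V0 [VD VZ]]] [b [bV [bi bs]]]] nm; rewrite /gsub /=.
have sb i : (i < k)%nat -> supported m (b i).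
  by move=> /ltP hi j hj; apply: (sV _ (bV i hi)); lia.
have [e [oe [eb be]]] := gram_schmidt x0 sb bi.
exists e; split=> // v; split.
  by move=> /bs hv; apply: (Lin_trans be).
move=> /(Lin_trans eb) [c ->]; apply: Lin_comb => // i hi; apply: bV; exact/ltP.
Qed.

End LinearAlgebra.

(** * From a map of Grassmannians to a family of subspaces over flags *)

Section Linking.
Local Close Scope ring_scope.
Local Open Scope R_scope.

(** Needed because a map out of [Grass] may be applied to different presentations of one
    subspace. *)
Lemma grass_ext n k (y y' : Grass n k) : (forall v, gsub y v <-> gsub y' v) -> y = y'.
Proof.
case: y => V h; case: y' => V' h'; rewrite /gsub /= => e.
have E : V = V' by apply: functional_extensionality => v; exact: propositional_extensionality.
by case: V' / E h' e => h' e; congr exist; exact: proof_irrelevance.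
Qed.

Lemma norm2_wide r s (u : cvec) : (r <= s)%nat -> supported r u -> norm2 s u = norm2 r u.
Proof. by move=> rs su; rewrite !norm2E /hdot (hdotn_wide u rs su). Qed.

Lemma norm2_mono r s (u : cvec) : (r <= s)%nat -> norm2 r u <= norm2 s u.
Proof.
elim: s => [|s IH]; first by case: r => // _; lra.
rewrite leq_eqVlt => /orP [/eqP ->|h]; first lra.
by have := IH h; rewrite /=; have := Cnorm2_ge0 (u s); lra.
Qed.

Lemma closed_flags m (x0 : uvec m) r : (m <= r)%nat -> @closed (Zs x0 r) (@flags m).
Proof.
move=> hr; apply: (@closed_forall (Zs x0 r) m (fun j f => flag j f)) => j hj.
by apply: closed_forall => a ha; apply: closed_orth; lia.
Qed.

Variables (m n k l M : nat).
Hypotheses (k1 : (0 < k)%nat) (nM : (n < M)%nat) (Mm : (M <= m)%nat) (lm : (l <= m)%nat) (kl : (k + (m - l) <= M)%nat).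
Variable x0 : uvec M.
Let q := (m - l)%nat.
Let qM : (q <= M)%nat.
Proof. rewrite /q; lia. Qed.

Lemma hdot_emb v w : hdot m v (trunc M w) = hdot M v w.
Proof.
rewrite hdot_conj /hdot (hdotn_wide v Mm (@supp_trunc M w)) -/(hdot M (trunc M w) v) hdot_truncl.
by rewrite -hdot_conj.
Qed.

Lemma norm2_trunc (u : uvec M) : norm2 M (trunc M (uv u)) = 1.
Proof. by rewrite norm2E hdot_truncl hdot_conj hdot_truncl -hdot_conj -norm2E uv1. Qed.

Lemma emb_unit (u : uvec M) : norm2 m (trunc M (uv u)) = 1.
Proof. by rewrite norm2E hdot_emb hdot_truncl -norm2E uv1. Qed.

Definition emb (u : uvec M) : uvec m := exist (fun w => norm2 m w = 1) _ (emb_unit u).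

Lemma ip_emb u v : ip (emb u) (emb v) = ip u v.
Proof. by rewrite /ip /= hdot_emb hdot_truncl. Qed.

(* The orthogonal complement in C^m of the first m - l lines of a flag of C^M. *)
Definition Xs (f : nat -> uvec M) (v : cvec) : Prop :=
  supported m v /\ forall j, (j < q)%nat -> hdot M v (uv (f j)) = RtoC 0.

Lemma onf_flags (f : nat -> uvec M) r : @flags M f -> (r <= M)%nat -> onf r f.
Proof.
move=> ff rM; have half a b : (a < b)%nat -> (b < r)%nat -> ip (f b) (f a) = RtoC 0.
  by move=> ab br; apply: ff => //; lia.
move=> a b ha hb ne; case: (ltngtP a b) => // h; last exact: half.
by rewrite ip_conj half //; apply: Ceq => /=; lra.
Qed.

Lemma Xs_grass (f : nat -> uvec M) : @flags M f -> exists y : Grass m l, forall v, gsub y v <-> Xs f v.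
Proof.
move=> ff; pose g j := emb (f j).
have og : onf q g by move=> a b ha hb ne; rewrite ip_emb; exact: (onf_flags ff qM).
have qm : (q <= m)%nat by lia.
have [|e [oe he]] := @orth_frame m m (bas (emb x0)) g q (onf_bas _) qm _ og.
  by move=> a _; exact: PV_full.
have ql : (m - q)%nat = l by rewrite /q; lia.
rewrite ql in oe he.
have sub : is_subspace m (Xs f).
  split; first by move=> v [].
  split; first by split=> // j _; rewrite -[vzero]/(lincomb 0 (fun _ => RtoC 0) (fun _ => vzero)) hdot_lincomb.
  split.
    move=> u v [su hu] [sv hv]; split=> [i hi|j hj]; last by rewrite hdot_addl hu // hv //; cring.
    by rewrite /vadd su // sv //; apply: Ceq; rewrite /=; lra.
  move=> c v [sv hv]; split=> [i hi|j hj]; last by rewrite hdot_scalel hv //; cring.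
  by rewrite /vscale sv //; apply: Ceq; rewrite /=; lra.
have dim : has_dim l (Xs f).
  exists (fun i => trunc m (uv (e i))); split; [|split].
  - move=> i /ltP hi; split; first exact: supp_trunc.
    have /he [_ h] := osum_basis oe hi.
    by move=> j hj; rewrite -hdot_emb hdot_truncl; exact: h.
  - move=> c hc i /ltP hi; rewrite -(coef_onf c oe hi) hc.
    by rewrite -[vzero]/(lincomb 0 (fun _ => RtoC 0) (fun _ => vzero)) hdot_lincomb.
  - move=> v [sv hv]; change (Lin l (fun i => trunc m (uv (e i))) v).
    case: (Req_dec (norm2 m v) 0) => [/(norm2_0 sv) ->|nz]; first exact: Lin0.
    have [u [c [c0 hu]]] := normalize nz.
    have su : supported m (uv u) by move=> i hi; rewrite hu /vscale sv //; apply: Ceq; rewrite /=; lra.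
    have -> : v = vscale (RtoC c) (trunc m (uv u)).
      by rewrite trunc_id // hu; apply: vec_ext => i; rewrite /vscale; apply: Ceq; rewrite /=; sfield; lra.
    apply: Lin_scale; apply/PV_Lin => //; apply/he; split; first exact: PV_full.
    by move=> a ha; rewrite /ip /= hdot_emb hu hdot_scalel hv //; cring.
by exists (exist (fun V => is_subspace m V /\ has_dim l V) _ (conj sub dim)).
Qed.

Lemma vnorm_lincomb (g : nat -> uvec M) c r eta : (forall j, (j < r)%nat -> Cmod (c j) <= eta) ->
  vnorm m (lincomb r c (fun a => trunc M (uv (g a)))) <= INR r * eta.
Proof.
elim: r => [|r IH] h.
  rewrite /vnorm norm2E hdot_lincomb /= sqrt_0; lra.
rewrite S_INR; apply: Rle_trans (vnorm_comb _ _ _ _) _.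
have n1 : vnorm m (trunc M (uv (g r))) = 1 by rewrite /vnorm emb_unit sqrt_1.
rewrite n1; have := IH (fun j hj => h j (leqW hj)); have := h r (ltnSn r); rewrite -/lincomb; lra.
Qed.

(** The witness is v minus its projection onto the first q lines of g; since v is orthogonal to f_j,
    each of the q coefficients of that projection is at most [ldist (g j) (f j)]. *)
Lemma Xs_gap (f g : nat -> uvec M) eta : @flags M g -> (forall j, (j < q)%nat -> ldist (g j) (f j) <= eta) ->
  forall v, Xs f v -> vnorm m v = 1 -> exists w, Xs g w /\ vnorm m (vsub v w) <= INR q * eta.
Proof.
move=> fg hd v [sv hv] nv; have og := onf_flags fg qM.
pose c j := hdot M v (uv (g j)); pose p := lincomb q c (fun a => trunc M (uv (g a))).
have sp : supported m p.
  move=> i hi; rewrite /p lincombE csum0 // => a _.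
  by rewrite (@supp_trunc M (uv (g a)) i); [rewrite -[C0]/(RtoC 0); cring|lia].
exists (vsub v p); split.
  split; first by move=> i hi; rewrite /vsub /vadd /vscale sv // sp //; apply: Ceq; rewrite /=; lra.
  move=> j hj; rewrite /vsub hdot_addl hdot_scalel /p (coef_onf c og hj) /c.
  by apply: Ceq; rewrite /=; sring.
have -> : vsub v (vsub v p) = p.
  by apply: vec_ext => i; rewrite /vsub /vadd /vscale; apply: Ceq; rewrite /=; sring.
apply: vnorm_lincomb => j hj; apply: Rle_trans (hd j hj).
have -> : c j = hdot M v (vadd (uv (g j)) (vscale (- ip (g j) (f j))%C (uv (f j)))).
  by rewrite hdot_addr hdot_scaler hv // /c; cring.
apply: Rle_trans (CSmod _ _ _) _; rewrite -ldist_proj.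
have : vnorm M v <= 1 by rewrite -nv; apply: sqrt_le_1_alt; exact: norm2_mono.
by have := ldist_ge0 (g j) (f j); have := vnorm_ge0 M v; nra.
Qed.

Lemma csum_osum r (e : nat -> uvec M) u : csum r (fun i => ip u (e i) * hdot M (uv (e i)) (uv u))%C = RtoC (osum r e u).
Proof.
elim: r => [//|r IH] /=; rewrite IH RtoC_plus; congr Cplus.
by rewrite -/(ip (e r) u) (ip_conj (e r) u) /ov; apply: Ceq; rewrite /= /Cnorm2; sring.
Qed.

(** The normalised residue of u after projection to the span. *)
Lemma separate r (e : nat -> uvec M) u : onf r e -> ~ PV r e u ->
  exists p : uvec M, 0 < ov u p /\ forall i, (i < r)%nat -> ip (e i) p = RtoC 0.
Proof.
move=> he hn; have b := bessel u he.
have lt : osum r e u < 1 by case: (Rle_lt_or_eq_dec _ _ b) => // h; case: hn.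
have [|p [c [c0 hp]]] := @normalize M (resid r e u); first by rewrite resid_norm //; lra.
exists p; split.
  rewrite ov_sym /ov /ip hp hdot_scalel resid_dot csum_osum hdot_self uv1 Cnorm2_mult.
  have ic : 0 < / c by exact: Rinv_0_lt_compat.
  by rewrite /Cnorm2 /=; apply: Rmult_lt_0_compat; nra.
move=> i hi; rewrite ip_conj /ip hp hdot_scalel resid_dot (csum_delta hi).
  by rewrite -/(ip (e i) (e i)) ip_self -/(ip u (e i)); apply: Ceq; rewrite /=; sring.
by move=> a ha ne; rewrite -/(ip (e a) (e i)) he //; cring.
Qed.

Variable F : Grass m l -> Grass n k.
Hypothesis cF : grass_continuous F.

(** The lines of the image subspace. The point y is quantified because [Xs f] is known to be an
    element of the Grassmannian only when f is a flag; [VbE] shows that its choice is immaterial. *)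
Definition Vb (f : nat -> line M) (u : line M) : Prop :=
  exists y : Grass m l, (forall v, gsub y v <-> Xs f v) /\ gsub (F y) (trunc M (uv u)).

Lemma VbE f y u : (forall v, gsub y v <-> Xs f v) -> (Vb f u <-> gsub (F y) (trunc M (uv u))).
Proof.
move=> hy; split=> [[y' [hy' h]]|h]; last by exists y.
by have -> : y = y' by apply: grass_ext => v; rewrite hy hy'.
Qed.

(** The only use of continuity. A line outside the image at f0 overlaps a vector p orthogonal to
    that image; nearby flags have images close in the gap metric, hence nearly orthogonal to p, and
    cannot contain a nearby line. *)
Lemma closed_Vb : @closed (Zs x0 M.+1) (fun f => @flags M f /\ Vb f (f M)).
Proof.
move=> f0 nA; case: (classic (@flags M f0)) => [ff|nf]; last first.
  have [e [e0 he]] := @closed_flags M x0 M.+1 (leqnSn M) f0 nf.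
  by exists e; split=> // f hf [h _]; exact: (he f hf).
have [y0 hy0] := Xs_grass ff.
have nV : ~ gsub (F y0) (trunc M (uv (f0 M))) by move=> h; apply: nA; split=> //; apply/(VbE _ hy0).
have [e [oe he]] := grass_frame x0 (F y0) (ltnW nM).
have [|p [a0 hp]] := separate (u := f0 M) oe; first by rewrite PV_Lin // -he.
set a := ov (f0 M) p in a0.
(* Cauchy-Schwarz bounds the overlap with p by the square of the gap; eps <= 1 makes eps^2 at most a
   / 2. *)
pose eps := Rmin 1 (a / 2).
have eps0 : 0 < eps by apply: Rmin_glb_lt; lra.
have [delta [d0 hdel]] := cF y0 eps0.
pose eta := delta / (INR q + 1); have q0 := pos_INR q.
have eta0 : 0 < eta by apply: Rdiv_lt_0_compat; lra.
have eq : INR q * eta < delta.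
  have -> : delta = (INR q + 1) * eta by rewrite /eta; sfield; lra.
  by nra.
have cM : @cont (line M) (Zs x0 M.+1) (fun f => f M) by exact: cont_coord.
have rc : rcont (fun f : Zs x0 M.+1 => ov (f M) p) by apply: rcont_ov => //; exact: cont_const.
have [|d1 [d10 hd1]] := rc f0 (a / 2); first lra.
exists (Rmin eta d1); split; first exact: Rmin_glb_lt.
move=> f hf [fl vf].
have f1 : dist (f0 : Zs x0 M.+1) f < eta by apply: Rlt_le_trans hf _; exact: Rmin_l.
have f2 : dist (f0 : Zs x0 M.+1) f < d1 by apply: Rlt_le_trans hf _; exact: Rmin_r.
have [y hy] := Xs_grass fl.
have {}vf : gsub (F y) (trunc M (uv (f M))) by apply/(VbE _ hy).
have ld j : (j < q)%nat -> ldist (f0 j) (f j) <= eta.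
  move=> hj; have := @sdist_coord (line M) M.+1 f0 f j ltac:(lia); move: f1; rewrite /=; lra.
have gap : gap_lt m delta (gsub y0) (gsub y).
  split=> v hv nv.
    have [||w [hw1 hw2]] := @Xs_gap f0 f eta fl _ v _ nv; first by move=> j hj; rewrite ldist_sym; exact: ld.
      by apply/hy0.
    by exists w; split; [apply/hy|lra].
  have [||w [hw1 hw2]] := @Xs_gap f f0 eta ff _ v _ nv; first exact: ld.
    by apply/hy.
  by exists w; split; [apply/hy0|lra].
have [_ g2] := hdel y gap.
have sF z v : gsub (F z) v -> supported n v by have [[h _] _] := proj2_sig (F z); exact: h.
have nn : norm2 n (trunc M (uv (f M))) = 1 by rewrite -(norm2_wide (ltnW nM) (sF _ _ vf)) norm2_trunc.
have [|w [hw1 hw2]] := g2 _ vf; first by rewrite /vnorm nn sqrt_1.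
have wp : hdot M w (uv p) = RtoC 0.
  have [c ->] := proj1 (he w) hw1; rewrite hdot_lincomb csum0 // => i hi.
  by rewrite hdot_truncl -/(ip (e i) p) hp //; cring.
have h1 : hdot M (vsub (trunc M (uv (f M))) w) (uv p) = ip (f M) p.
  by rewrite /vsub hdot_addl hdot_scalel wp hdot_truncl -/(ip (f M) p); apply: Ceq; rewrite /=; sring.
have cs := CS M (vsub (trunc M (uv (f M))) w) (uv p); rewrite h1 -/(ov (f M) p) uv1 in cs.
have sv : supported n (vsub (trunc M (uv (f M))) w).
  by move=> i hi; rewrite /vsub /vadd /vscale (sF _ _ vf i hi) (sF _ _ hw1 i hi); apply: Ceq; rewrite /=; lra.
rewrite (norm2_wide (ltnW nM) sv) -vnorm_sqr in cs.
have e1 := Rmin_l 1 (a / 2); have e2 := Rmin_r 1 (a / 2); rewrite -/eps in e1 e2.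
have nv := vnorm_ge0 n (vsub (trunc M (uv (f M))) w).
have h3 := hd1 f f2; rewrite -/a in h3.
have : ov (f M) p < a / 2 by nra.
by split_Rabs; lra.
Qed.

Lemma coincidence : odd M -> exists x : Grass m l, forall v : cvec, gsub (F x) v -> gsub x v.
Proof.
move=> oM.
have sF z v : gsub (F z) v -> supported n v by have [[h _] _] := proj2_sig (F z); exact: h.
have [|||f [ff hf]] := @flag_coincidence M x0 k n q Vb oM k1 nM kl _ _ closed_Vb _.
- move=> f g fg u [y [hy h]]; exists y; split=> // v; rewrite hy /Xs; split=> -[sv hv]; split=> // j hj.
    by rewrite -fg ?hv //; lia.
  by rewrite fg ?hv //; lia.
- move=> f ff; have [y hy] := Xs_grass ff; have [e [oe he]] := grass_frame x0 (F y) (ltnW nM).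
  by exists e; split=> // u; rewrite (VbE u hy) he PV_Lin.
- move=> f u ff; have [y hy] := Xs_grass ff => /(VbE u hy) h.
  rewrite -(norm2_trunc u) (norm2_wide (ltnW nM) (sF _ _ h)) !norm2E /hdot.
  by congr fst; apply: hdotn_ext => i hi; rewrite /trunc; case: ltnP => //; lia.
have [y hy] := Xs_grass ff; exists y => v hv; apply/hy; split.
  by move=> i hi; apply: (sF _ _ hv); lia.
move=> j hj; have sv : supported M v by move=> i hi; apply: (sF _ _ hv); lia.
case: (Req_dec (norm2 M v) 0) => [/(norm2_0 sv) ->|nz].
  by rewrite -[vzero]/(lincomb 0 (fun _ => RtoC 0) (fun _ => vzero)) hdot_lincomb.
have [u [c [c0 hu]]] := normalize nz.
have Vu : Vb f u.
  apply/(VbE u hy); rewrite trunc_id => [|i hi]; last by rewrite hu /vscale sv //; apply: Ceq; rewrite /=; lra.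
  by rewrite hu; have [[_ [_ [_ h]]] _] := proj2_sig (F y); exact: h.
have := hf u j Vu hj; rewrite /ip hu hdot_scalel => h0.
have -> : hdot M v (uv (f j)) = (RtoC c * (RtoC (/ c) * hdot M v (uv (f j))))%C.
  by apply: Ceq; rewrite /=; sfield; lra.
by rewrite h0; cring.
Qed.

End Linking.

(* Restores the Peano reading of the order and the subtraction in [nat_scope]. *)
From Corelib Require Import Peano.
Open Scope R_scope.

Theorem theorem1p3 (m n k l : nat)
  (hk : (1 <= k <= Nat.div n 2)%nat)
  (hl : (1 <= l <= Nat.div m 2)%nat)
  (hkl : (k < l)%nat)
  (hdim : (n - k < m - l)%nat)
  (hcase : (2 * k * k - k - 1 <= m - l)%nat \/ (1 <= k <= 3)%nat)
  (f : Grass m l -> Grass n k)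
  (hf : grass_continuous f) :
  exists x : Grass m l, forall v : cvec, gsub (f x) v -> gsub x v.
Proof.
(* The largest odd M <= m. Losing one dimension is affordable: k < l and n - k < m - l give n <= m -
   2 < M, and k < l gives k + (m - l) <= m - 1 <= M. *)
have [M [oM [M1 M2]]] : exists M, is_true (odd M) /\ (M <= m)%nat /\ (m <= S M)%nat.
  case o : (odd m); first by exists m; split=> //; lia.
  by exists (Nat.pred m); split; [move: o; case: m hl {hdim hcase f hf} => [|m' _] /=; [lia|case: odd]|lia].
have M0 : is_true (ssrnat.leq 1 M) by case: M oM {M1 M2}.
apply: (@coincidence m n k l M _ _ _ _ _ (exist (fun u => norm2 M u = 1) _ (e0_unit M0)) f hf oM); lia.
Qed.
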